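(* Let $r\geqslant3$ and let $\widehat{\mathcal L}_1$ be the class of $r$th order linear homogeneous ODEs in the rational form $x^{(r)}+a_{r-2}(t)x^{(r-2)}+\dots+a_1(t)x'+a_0(t)x=0$ with arbitrary smooth functions $a_{r-2},\dots,a_0$ of $t$. For each equation $\mathcal E$ from $\widehat{\mathcal L}_1$, a point transformation is the transformational part of an admissible transformation in $\widehat{\mathcal L}_1$ with $\mathcal E$ as source if and only if it is of the form $$\tilde t=T(t),\quad \tilde x=C\,(T_t(t))^{\frac{r-1}2}x+X_0(t),$$ where $T$ and $X_0$ are smooth functions of $t$ with $T_t\ne0$, $C$ is a nonzero constant, and the product $T_t^{-\frac{r-1}2}X_0$ is a solution of $\mathcal E$. (For even $r$, $|T_t|$ is substituted for $T_t$ in these powers in the real case, or a branch of the square root is fixed in the complex case.) This means that the class $\widehat{\mathcal L}_1$ is uniformly semi-normalized with respect to linear superposition of solutions.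
   Context: The underlying field $\mathbb F$ is $\mathbb R$ or $\mathbb C$; all variables, functions and constants are real or complex, respectively. $x=x(t)$ is the unknown function, $x^{(k)}=d^kx/dt^k$; $T_t$ is the derivative of $T$. Everything is local: functions and transformations are smooth and considered on suitable open domains. A point transformation is a transformation $\tilde t=T(t,x)$, $\tilde x=X(t,x)$ with nonvanishing Jacobian $\partial(T,X)/\partial(t,x)$; it acts on ODEs via prolongation to derivatives. An admissible transformation of a class of ODEs is a triple $(\mathcal E,\tilde{\mathcal E},\mathcal T)$, where $\mathcal E$ (the source) and $\tilde{\mathcal E}$ (the target) are equations of the class and $\mathcal T$ (the transformational part) is a point transformation mapping $\mathcal E$ to $\tilde{\mathcal E}$. The (usual) equivalence (pseudo)group of the class consists of the point transformations in the joint space of $t$, $x$, the derivatives of $x$ and the arbitrary elements (the coefficients parameterizing the class) that are consistent with the contact structure, are projectable to the $(t,x)$-space (the components for $t$ and $x$ depend only on $(t,x)$), and map every equation of the class to an equation of the class. A class of homogeneous linear ODEs of order $r$ is called uniformly semi-normalized with respect to linear superposition of solutions if the transformational part of any admissible transformation of the class can be represented as the composition of a linear superposition symmetry transformation $\tilde t=t$, $\tilde x=x+\varphi(t)$ of the source equation $\mathcal E$ ($\varphi$ a solution of $\mathcal E$) with the projection of an element of the equivalence group of the class to the $(t,x)$-space; the linear superposition symmetry groups of all the equations are of the same structure (commutative and $r$-dimensional). *)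

(* Defs.v *)
(* Everything is written over a [numFieldType] K with its norm topology and is
   used for K = R (a [realType]) and K = R[i].  As [differentiable] refers to
   K-linear differentials, "smooth" is C^oo for K = R and holomorphic for
   K = R[i].

   Locality: equations and transformations live on open domains, and a point
   transformation is described in a neighbourhood of an arbitrary point of its
   domain. *)
From HB Require Import structures.
From mathcomp Require Import all_boot all_order all_algebra.
From mathcomp Require Import all_classical all_reals all_analysis.
From mathcomp Require Export complex.
Set Implicit Arguments.
Unset Strict Implicit.
Unset Printing Implicit Defensive.
Import Order.TTheory GRing.Theory Num.Theory.
Import numFieldNormedType.Exports.
Local Open Scope ring_scope.
Local Open Scope classical_set_scope.

(* All iterated directional derivatives exist and are differentiable on U,
   which is meant to be open. *)
Definition smooth_on (K : numFieldType) (V W : normedModType K)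
    (U : set V) (f : V -> W) : Prop :=
  forall (vs : seq V) (p : V), U p ->
    differentiable (foldr (fun v g => 'D_v g) f vs) p.

Definition smooth_near (K : numFieldType) (V W : normedModType K)
    (p : V) (f : V -> W) : Prop :=
  exists2 U : set V, open_nbhs p U & smooth_on U f.

(* x^(r) + a_{r-2}(t) x^(r-2) + ... + a_0(t) x = 0, with a_i = coef _ 0 i. *)
Record equation (K : numFieldType) (r : nat) := Equation {
  dom : set K;
  coef : K -> 'rV[K]_r.-1;
  open_dom : open dom;
  smooth_coef : smooth_on dom coef }.

Definition solves (K : numFieldType) (r : nat) (E : equation K r)
    (phi : K -> K) (t : K) : Prop :=
  derive1n r phi t + \sum_(i < r.-1) coef E t ord0 i * derive1n i phi t = 0.

Definition local_solution (K : numFieldType) (r : nat) (E : equation K r)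
    (t0 : K) (phi : K -> K) : Prop :=
  smooth_near t0 phi /\ \forall t \near t0, dom E t /\ solves E phi t.

(* The jet space J^r with coordinates (t, (x, x', ..., x^(r))). *)
Notation jet K r := (prod K 'rV[K]_(S r)).

Definition jx (K : numFieldType) (r : nat) (j : jet K r) (k : nat) : K :=
  j.2 ord0 (inord k).

Definition base (K : numFieldType) (r : nat) (j : jet K r) : K * K :=
  (j.1, jx j 0).

Definition holds (K : numFieldType) (r : nat) (E : equation K r)
    (j : jet K r) : Prop :=
  jx j r + \sum_(i < r.-1) coef E j.1 ord0 i * jx j i = 0.

(* The total derivative D_t = d/dt + \sum_(k < r) x^(k+1) d/dx^(k), truncated
   to J^r; it agrees with the untruncated one on functions of order < r. *)
Definition total_derivative (K : numFieldType) (r : nat) (F : jet K r -> K)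
    (j : jet K r) : K :=
  'D_((1, \row_(k < r.+1) (if (k < r)%N then jx j k.+1 else 0)) : jet K r) F j.

(* D_t T, for the point transformation F = (T, X). *)
Definition DtT (K : numFieldType) (r : nat) (F : K * K -> K * K)
    (j : jet K r) : K :=
  total_derivative (fun i : jet K r => (F (base i)).1) j.

(* ((D_t T)^-1 D_t)^k X, which has order k. *)
Definition prolong_x (K : numFieldType) (r : nat) (F : K * K -> K * K)
    (k : nat) : jet K r -> K :=
  iter k (fun G j => total_derivative G j / DtT F j)
    (fun i : jet K r => (F (base i)).2).

Definition prolong (K : numFieldType) (r : nat) (F : K * K -> K * K)
    (j : jet K r) : jet K r :=
  ((F (base j)).1, \row_(k < r.+1) prolong_x F k j).

Definition jacobian2 (K : numFieldType) (F : K * K -> K * K) (p : K * K) : K :=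
  let Ft := 'D_((1, 0) : K * K) F p in
  let Fx := 'D_((0, 1) : K * K) F p in
  Ft.1 * Fx.2 - Fx.1 * Ft.2.

Definition point_transformation (K : numFieldType) (Om : set (K * K))
    (F : K * K -> K * K) : Prop :=
  [/\ open Om, smooth_on Om F & forall p, Om p -> jacobian2 F p != 0].

(* (E, E', F) is an admissible transformation, F being defined on Om.  The
   prolongation of F is only defined at the jets with D_t T != 0. *)
Definition admissible (K : numFieldType) (r : nat) (E E' : equation K r)
    (Om : set (K * K)) (F : K * K -> K * K) : Prop :=
  [/\ point_transformation Om F,
      forall p, Om p -> dom E p.1 /\ dom E' (F p).1 &
      forall j : jet K r, Om (base j) -> DtT F j != 0 ->
        holds E j <-> holds E' (prolong F j)].

Definition transformational_part (K : numFieldType) (r : nat)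
    (E : equation K r) (p : K * K) (F : K * K -> K * K) : Prop :=
  exists (Om : set (K * K)) (E' : equation K r), Om p /\ admissible E E' Om F.

(* "h is the function s |-> s^((r-1)/2) near tau". *)
Definition real_half_power (R : realType) (r : nat) (tau : R) (h : R -> R) :
    Prop :=
  h = fun s => if odd r then s ^+ r.-1./2 else `|s| `^ (r.-1%:R / 2).

Definition sqrt_branch (K : numFieldType) (tau : K) (rho : K -> K) : Prop :=
  \forall z \near tau, {for z, continuous rho} /\ rho z ^+ 2 = z.

Definition complex_half_power (R : realType) (r : nat) (tau : R[i])
    (h : R[i] -> R[i]) : Prop :=
  if odd r then h = fun s => s ^+ r.-1./2
  else exists2 rho : R[i] -> R[i], sqrt_branch tau rho &
         h = fun s => rho s ^+ r.-1.

Definition of_normal_form (K : numFieldType) (r : nat)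
    (half_power : K -> (K -> K) -> Prop) (E : equation K r) (p : K * K)
    (F : K * K -> K * K) : Prop :=
  exists (T X0 : K -> K) (C : K) (h : K -> K),
    [/\ smooth_near p.1 T, smooth_near p.1 X0,
        (\forall t \near p.1, derive1 T t != 0), C != 0 & half_power (derive1 T p.1) h] /\
    local_solution E p.1 (fun t => (h (derive1 T t))^-1 * X0 t) /\
    \forall q \near p, F q = (T q.1, C * h (derive1 T q.1) * q.2 + X0 q.1).

(* The joint space of t, x, the derivatives of x and the coefficients. *)
Notation joint K r := (prod (jet K r) 'rV[K]_(Nat.pred r)).

(* v is annihilated by the contact forms dx^(k) - x^(k+1) dt, k < r, at j. *)
Definition contact_vector (K : numFieldType) (r : nat) (j v : jet K r) : Prop :=
  forall k, (k < r)%N -> jx v k = jx j k.+1 * v.1.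

(* The derivatives and the coefficients are unrestricted, except for the
   singular set D_t T = 0 of the prolongation: an element of the equivalence
   pseudogroup acts on every equation, hence on all values of coefficients. *)
Definition joint_dom (K : numFieldType) (r : nat) (Om : set (K * K))
    (F : K * K -> K * K) : set (joint K r) :=
  [set w | Om (base w.1) /\ DtT F w.1 != 0].

(* Phi is an element of the equivalence pseudogroup and F, with domain Om, is
   its projection to the (t, x)-space. *)
Definition equivalence_transformation (K : numFieldType) (r : nat)
    (Om : set (K * K)) (F : K * K -> K * K) (Phi : joint K r -> joint K r) :
    Prop :=
  let W := @joint_dom K r Om F in
  [/\ point_transformation Om F,
      smooth_on W Phi /\ (forall w, W w -> bijective ('d Phi w)),
      forall w, W w -> base (Phi w).1 = F (base w.1),
      forall w v, W w -> contact_vector w.1 v.1 ->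
        contact_vector (Phi w).1 ('d Phi w v).1 &
      forall E : equation K r, exists E' : equation K r,
        forall w, W w -> dom E w.1.1 -> w.2 = coef E w.1.1 ->
          [/\ dom E' (Phi w).1.1, (Phi w).2 = coef E' (Phi w).1.1 &
              holds E w.1 <-> holds E' (Phi w).1]].

Definition superposition (K : numFieldType) (phi : K -> K) (p : K * K) :
    K * K :=
  (p.1, p.2 + phi p.1).

Definition superposition_symmetry (K : numFieldType) (r : nat)
    (E : equation K r) (t0 : K) (S : K * K -> K * K) : Prop :=
  exists2 phi : K -> K, local_solution E t0 phi & S = superposition phi.

(* The linear superposition symmetries of E near t0, up to equality near t0,
   form a group parametrized linearly and bijectively by (K^r, +). *)
Definition superposition_group_dim (K : numFieldType) (r : nat)
    (E : equation K r) (t0 : K) : Prop :=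
  exists psi : 'I_r -> K -> K,
    let sigma (c : 'rV[K]_r) :=
      superposition (fun t => \sum_(i < r) c ord0 i * psi i t) in
    [/\ forall c, superposition_symmetry E t0 (sigma c),
        forall c d, sigma (c + d) = sigma c \o sigma d &
        forall S, superposition_symmetry E t0 S ->
          exists! c, \forall t \near t0, forall x, S (t, x) = sigma c (t, x)].

Definition uniformly_semi_normalized (K : numFieldType) (r : nat) : Prop :=
  (forall (E E' : equation K r) Om F, admissible E E' Om F ->
     forall p, Om p ->
     exists (phi : K -> K) Om1 F1 (Phi : joint K r -> joint K r),
       [/\ local_solution E p.1 phi,
           equivalence_transformation Om1 F1 Phi &
           \forall q \near p, Om1 (superposition phi q) /\
                              F q = F1 (superposition phi q)]) /\
  (forall (E : equation K r) t0, dom E t0 -> superposition_group_dim E t0).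

(* Main.v *)
(* An admissible transformation (T, X) first satisfies T_x = 0: otherwise the total
   derivative of T vanishes at some jet over the given point, and clearing
   denominators in the prolonged target equation gives a contradiction in the limit
   there.  Once T depends on t only, differentiating the prolonged equation along
   the tangent direction x^(r-1) gives X_xx = 0 and
   X_xt = ((r - 1) / 2) X_x T_tt / T_t, so X = C T_t^((r-1)/2) x + X_0, and the jets
   mapped to the zero solution show that X_0 / X_x solves the source equation.
   Conversely, for such maps the coefficients of the prolongation form an invertible
   triangular matrix, from which the target equation is read off; the same formula
   lifts the homogeneous part to the equivalence group.  The superposition group is
   handled by existence and uniqueness for linear systems.

   The real and complex cases are treated together over any Archimedean field in
   which geometrically converging sequences have a limit: the mean value inequality
   is proved by bisection, without order completeness. *)
Require Import Defs.
From HB Require Import structures.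
From mathcomp Require Import all_boot all_order all_algebra.
From mathcomp Require Import all_classical all_reals all_analysis.
From mathcomp Require Import ring lra zify.
Set Implicit Arguments.
Unset Strict Implicit.
Unset Printing Implicit Defensive.
Import Order.TTheory GRing.Theory Num.Theory.
Import numFieldNormedType.Exports.
Local Open Scope ring_scope.
Local Open Scope classical_set_scope.

(** * One-variable calculus over a complete Archimedean field *)

(** The hypothesis r >= 3 is spent on T_x = 0. Over a point with T_x nonzero, x' is chosen to make
    D_t T vanish and then x'' to make D_t (D_t T) equal to 1, so x'' must be free in the source
    equation, that is, 2 < r. Admissibility says nothing at such a jet, which is why it is
    approached as a limit.

    The exponent (r - 1)/2 comes from the coefficient of x^(r-1) in the prolongation of order r. It
    collects one derivative from each diagonal coefficient X_x / T_t^i with i < r, and 0 + ... + (r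
    - 1) = r (r - 1)/2. The rational form has no room for this term, so it must vanish.

    Writing X = X_x (x + phi) with phi = X_0 / X_x splits the transformation into a superposition
    followed by a fibre-linear map; this splitting is the semi-normalization itself. A half power h
    enters only through h' = (r - 1)/2 h / s, by which it agrees with X_x up to a constant
    factor. *)

Definition archimedean_field (K : numFieldType) : Prop :=
  forall x : K, exists n : nat, `|x| <= n%:R.

(** Completeness with an explicit rate: 2 B / 2^n is the tail of the geometric series of steps, so
    every limit taken below carries its error bound. *)
Definition geometrically_complete (K : numFieldType) : Prop :=
  forall (B : K) (u : nat -> K),
    (forall n, `|u n.+1 - u n| <= B / 2 ^+ n) ->
    exists l, forall n, `|u n - l| <= 2 * B / 2 ^+ n.

(** * Derivatives as division-free estimates *)

Section DerivativeEstimates.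
Variable K : numFieldType.

(** Multiplying the difference quotient by [h] removes the division; the estimate is trivial at
    [h = 0], so the neighbourhood need not be punctured. *)
Lemma is_derive_dirP (V : normedModType K) (f : V -> K) (x v : V) (a : K) :
  is_derive x v f a <->
  forall e, 0 < e -> \forall h \near (0 : K),
    `|f (x + h *: v) - f x - h * a| <= e * `|h|.
Proof.
have key (b h : K) : h != 0 -> forall e,
    (`|b - h^-1 *: (f (h *: v + x) - f x)| <= e) =
    (`|f (x + h *: v) - f x - h * b| <= e * `|h|).
  move=> h0 e; rewrite -(ler_pM2r (_ : 0 < `|h|)) ?normr_gt0// -normrM.
  rewrite mulrBl -[_ *: _]/(_ * _) mulrAC mulVf// mul1r distrC addrC [x + _]addrC.
  by rewrite [b * h]mulrC [- _ + _]addrC.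
split=> [[df <-] e e0|H].
  have := df; rewrite /derivable => /cvgrPdist_le /(_ _ e0).
  move=> /nbhs_normP[d /= d0 Hd]; apply/nbhs_normP; exists d => //= h hd.
  have [->|h0] := eqVneq h 0.
    by rewrite scale0r addr0 subrr mul0r subr0 normr0 mulr0.
  suff : `|'D_v f x - h^-1 *: (f (h *: v + x) - f x)| <= e by rewrite key.
  exact: Hd.
have cv : (fun h => h^-1 *: ((f \o shift x) (h *: v) - f x)) @ (0 : K)^' --> a.
  apply/cvgrPdist_le => e e0.
  have /nbhs_normP[d /= d0 Hd] := H e e0; apply/nbhs_normP; exists d => //= h hd h0.
  suff : `|a - h^-1 *: (f (h *: v + x) - f x)| <= e by [].
  by rewrite key//; exact: Hd.
apply: DeriveDef; first by apply/cvg_ex; exists a.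
exact: cvg_lim.
Qed.

Lemma is_derive1P (f : K -> K) (x a : K) :
  is_derive x 1 f a <->
  forall e, 0 < e -> \forall t \near x, `|f t - f x - a * (t - x)| <= e * `|t - x|.
Proof.
rewrite is_derive_dirP; split=> H e e0.
  rewrite (near_shift 0 x); near=> t.
  rewrite /= subr0.
  have : `|f (x + t *: (1 : K)) - f x - t * a| <= e * `|t| by near: t; exact: H.
  by rewrite addrK [t + x]addrC [t *: _]mulr1 [a * t]mulrC.
rewrite (near_shift x 0); near=> t; rewrite /= sub0r.
have : `|f t - f x - a * (t - x)| <= e * `|t - x| by near: t; exact: H.
by rewrite [_ *: _]mulr1 subrKC [_ * a]mulrC.
Unshelve. all: by end_near. Qed.

Lemma near0_normP (P : K -> Prop) (x : K) :
  (\forall t \near x, P t) <-> exists2 d, 0 < d & forall t, `|t - x| < d -> P t.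
Proof.
split=> [/nbhs_normP[d /= d0 Hd]|[d d0 Hd]].
  by exists d => // t td; apply: Hd; rewrite /= distrC.
by apply/nbhs_normP; exists d => //= t td; apply: Hd; rewrite distrC.
Qed.

Lemma near_neq0 (tau : K) : tau != 0 -> \forall s \near tau, s != 0.
Proof.
move=> tau0; apply/near0_normP; exists `|tau|; first by rewrite normr_gt0.
by move=> t; apply: contraTneq => ->; rewrite sub0r normrN ltxx.
Qed.

(** The order is only partial when K is complex; positive elements are real, hence comparable, and
    this replaces the minimum of two radii. *)
Lemma pos_lower_bound (a b : K) : 0 < a -> 0 < b ->
  exists d, [/\ 0 < d, d <= a & d <= b].
Proof.
move=> a0 b0; have [ab|/ltW ba] := real_leP (gtr0_real a0) (gtr0_real b0).
  by exists a.
by exists b.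
Qed.

Lemma is_derive_lineP (V : normedModType K) (f : V -> K) (x v : V) (a : K) :
  is_derive x v f a <-> is_derive (0 : K) 1 (fun h => f (x + h *: v)) a.
Proof.
rewrite is_derive_dirP is_derive1P; split=> H e e0.
  near=> h; rewrite scale0r addr0 subr0 [a * h]mulrC.
  by near: h; exact: H.
have {}H := H e e0; near=> h.
have : `|f (x + h *: v) - f (x + 0 *: v) - a * (h - 0)| <= e * `|h - 0| by near: h.
by rewrite scale0r addr0 subr0 [a * h]mulrC.
Unshelve. all: by end_near. Qed.

Lemma is_derive_diff (V W : normedModType K) (f : V -> W) (x v : V) :
  differentiable f x -> is_derive x v f ('d f x v).
Proof. by move=> df; apply: DeriveDef; [exact: diff_derivable|rewrite deriveE]. Qed.

(** Only the derivative of [f] along [v] is required: on the line through [x] the inner function has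
    one variable, where derivable and differentiable agree. *)
Lemma is_derive1_chain (V : normedModType K) (g : K -> K) (f : V -> K) (x v : V) (a b : K) :
  is_derive (f x) 1 g b -> is_derive x v f a -> is_derive x v (g \o f) (a * b).
Proof.
move=> dg /is_derive_lineP df; apply/is_derive_lineP.
have f0 : f x = f (x + (0 : K) *: v) by rewrite scale0r addr0.
have Df : differentiable (fun h : K => f (x + h *: v)) (0 : K).
  by apply/derivable1_diffP; case: df.
have Dg : differentiable g (f (x + (0 : K) *: v)).
  by rewrite -f0; apply/derivable1_diffP; case: dg.
have E1 : 'd (fun h : K => f (x + h *: v)) (0 : K) 1 = a.
  by rewrite -deriveE//; exact: derive_val.
have E2 : 'd g (f (x + (0 : K) *: v)) 1 = b.
  by rewrite -deriveE// -f0; exact: derive_val.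
have -> : a * b = 'd (g \o (fun h : K => f (x + h *: v))) (0 : K) 1.
  rewrite diff_comp//= E1 -[X in 'd g _ X]mulr1 -[a * 1]/(a *: (1 : K)).
  by rewrite linearZ /= E2.
exact: (is_derive_diff (1 : K) (differentiable_comp Df Dg)).
Qed.

End DerivativeEstimates.

(** * The mean value inequality *)

Section MeanValue.
Variable K : numFieldType.
Hypothesis archK : archimedean_field K.
Hypothesis compK : geometrically_complete K.

Lemma expr2_ge n : (n%:R : K) <= 2 ^+ n.
Proof. by rewrite -natrX ler_nat ltnW// ltn_expl. Qed.

Lemma geometric_small (B e : K) : 0 <= B -> 0 < e -> exists n, B / 2 ^+ n < e.
Proof.
move=> B0 e0; have [n Hn] := archK (B / e).
exists n.+1; rewrite ltr_pdivrMr ?exprn_gt0// mulrC -ltr_pdivrMr//.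
rewrite ger0_norm in Hn; last by rewrite divr_ge0// ltW.
apply: le_lt_trans Hn _; apply: le_lt_trans (expr2_ge n) _.
by rewrite exprS ltr_pMl ?exprn_gt0// ltr1n.
Qed.

(** A failure [y < x] would leave a gap that the error eventually undercuts. The bound is asked only
    for arbitrarily large [m], so that a proof may raise the index as it needs. *)
Lemma le_geometric (x y B : K) : x \is Num.real -> y \is Num.real -> 0 <= B ->
  (forall n, exists2 m, (n <= m)%N & x <= y + B / 2 ^+ m) -> x <= y.
Proof.
move=> xr yr B0 H; rewrite real_leNgt//; apply/negP => yx.
have [|n Hn] := @geometric_small B (x - y) B0; first by rewrite subr_gt0.
have [m nm xB] := H n; have : x < x.
  apply: le_lt_trans xB _; rewrite -ltrBrDl; apply: le_lt_trans Hn.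
  by rewrite ler_wpM2l// lef_pV2 ?posrE ?exprn_gt0// ler_eXn2l ?ltr1n.
by rewrite ltxx.
Qed.

Lemma midpoint_le (z x y rho : K) : `|x - z| <= rho -> `|y - z| <= rho ->
  `|(x + y) / 2 - z| <= rho.
Proof.
move=> hx hy; have -> : (x + y) / 2 - z = ((x - z) + (y - z)) / 2 by field.
rewrite normrM normfV (ger0_norm (ler0n _ 2)) ler_pdivrMr ?ltr0n//.
by apply: le_trans (ler_normD _ _) _; rewrite mulr_natr mulr2n lerD.
Qed.

(** If a chord were steeper than [M], one of its halves would be at least as steep. Repeated halving
    closes in on a point [c] of the ball, where differentiability bounds the slope by [M] plus a
    small error. Only midpoints are used, so the argument covers complex segments as well. *)
Lemma mean_value_closed (f f' : K -> K) (z rho M : K) :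
  0 <= M -> 0 <= rho ->
  (forall t, `|t - z| <= rho -> is_derive t 1 f (f' t)) ->
  (forall t, `|t - z| <= rho -> `|f' t| <= M) ->
  forall x y, `|x - z| <= rho -> `|y - z| <= rho -> `|f y - f x| <= M * `|y - x|.
Proof.
move=> M0 rho0 df bf x y hx hy.
rewrite real_leNgt ?rpredM ?normr_real ?ger0_real//; apply/negP => ltM.
have xy : 0 < `|y - x|.
  rewrite normr_gt0; apply/eqP => E; move: ltM.
  by move/eqP: E; rewrite subr_eq0 => /eqP ->; rewrite !subrr normr0 mulr0 ltxx.
pose M' := `|f y - f x| / `|y - x|.
have MM' : M < M' by rewrite ltr_pdivlMr.
have M'r : M' \is Num.real by rewrite ger0_real// divr_ge0.
have M'E : M' * `|y - x| = `|f y - f x| by rewrite divfK// gt_eqF.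
clearbody M'.
pose step (p : K * K) := let m := (p.1 + p.2) / 2 in
  if M' * `|m - p.1| <= `|f m - f p.1| then (p.1, m) else (m, p.2).
pose p n := iter n step (x, y).
have half (a b : K) : a / 2 + a / 2 = a by field.
have normhalf (a b : K) : `|(a + b) / 2 - a| = `|b - a| / 2 /\
                          `|b - (a + b) / 2| = `|b - a| / 2.
  have -> : `|b - a| / 2 = `|(b - a) / 2| by rewrite normrM normfV (ger0_norm (ler0n _ 2)).
  by split; congr `|_|; field.
have inv n : [/\ `|(p n).1 - z| <= rho, `|(p n).2 - z| <= rho,
    `|(p n).2 - (p n).1| = `|y - x| / 2 ^+ n &
    M' * `|(p n).2 - (p n).1| <= `|f (p n).2 - f (p n).1|].
  elim: n => [|n [h1 h2 hd hf]].
    rewrite /p /= expr0 divr1; split=> //.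
    by rewrite M'E.
  rewrite /p iterS -/(p n) /step; move: (p n) h1 h2 hd hf => [a b]/= h1 h2 hd hf.
  have [n1 n2] := normhalf a b.
  case: ifPn => [hm|]/=.
    split=> //; first exact: midpoint_le.
    by rewrite n1 hd exprS invfM; field; rewrite ?expf_neq0.
  rewrite -real_ltNge ?rpredM ?normr_real// => hm.
  split=> //; first exact: midpoint_le.
    by rewrite n2 hd exprS invfM; field; rewrite ?expf_neq0.
  rewrite n2; rewrite n1 in hm.
  move: hf; rewrite -{1}(half `|b - a|)// mulrDr => hf.
  rewrite -(lerD2l (M' * (`|b - a| / 2))); apply: le_trans hf _.
  have -> : f b - f a = (f ((a + b) / 2) - f a) + (f b - f ((a + b) / 2)) by ring.
  by apply: le_trans (ler_normD _ _) _; rewrite lerD2r ltW.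
have [|c Hc] := @compK `|y - x| (fun n => (p n).1).
  move=> n; have [_ _ hd _] := inv n.
  rewrite /p iterS -/(p n) /step; move: (p n) hd => [a b]/= hd.
  have [n1 n2] := normhalf a b; have xn0 : 0 <= `|y - x| / 2 ^+ n by rewrite divr_ge0 ?exprn_ge0.
  case: ifPn => _ /=; first by rewrite subrr normr0.
  by rewrite n1 hd ler_piMr// invf_le1 ?ltr0n// ler1n.
have hc : `|c - z| <= rho.
  apply: (@le_geometric _ _ (2 * `|y - x|)); rewrite ?normr_real ?ger0_real ?mulr_ge0//.
  move=> n; exists n => //; have [h1 _ _ _] := inv n.
  have -> : c - z = ((p n).1 - z) - ((p n).1 - c) by ring.
  by apply: le_trans (ler_normB _ _) _; apply: lerD.
(* The endpoints lie within 2 D and 3 D of [c], so the two remainders add up to at most 5 e D = (M'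
   - M)/2 D; the slope is then at most (M + M')/2, which is below [M']. *)
pose e := (M' - M) / 10.
have e0 : 0 < e by rewrite divr_gt0 ?ltr0n// subr_gt0.
have /is_derive1P/(_ e e0)/near0_normP[d d0 Hd] := df c hc.
have [||n Hn] := @geometric_small (3 * `|y - x|) d; rewrite ?mulr_ge0//.
have [_ _ hd hf] := inv n.
pose D := `|y - x| / 2 ^+ n; rewrite -/D in hd.
have D0 : 0 < D by rewrite divr_gt0 ?exprn_gt0.
have a1 : `|(p n).1 - c| <= 2 * D by rewrite /D mulrA; exact: Hc.
have a2 : `|(p n).2 - c| <= 3 * D.
  have -> : (p n).2 - c = ((p n).2 - (p n).1) + ((p n).1 - c) by ring.
  apply: le_trans (ler_normD _ _) _; rewrite hd.
  have -> : 3 * D = D + 2 * D by ring.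
  by rewrite lerD.
have D3 : 3 * D < d by rewrite /D mulrA.
have H1 := Hd _ (le_lt_trans a2 D3).
have H2 : `|f (p n).1 - f c - f' c * ((p n).1 - c)| <= e * `|(p n).1 - c|.
  by apply: Hd; apply: le_lt_trans a1 (le_lt_trans _ D3); rewrite ler_pM2r// ler_nat.
have : M' * D <= M * D + e * (3 * D) + e * (2 * D).
  rewrite -hd; apply: le_trans hf _.
  have -> : f (p n).2 - f (p n).1 = f' c * ((p n).2 - (p n).1)
    + (f (p n).2 - f c - f' c * ((p n).2 - c)) - (f (p n).1 - f c - f' c * ((p n).1 - c)).
    by ring.
  apply: le_trans (ler_normB _ _) _; apply: lerD; last first.
    by apply: le_trans H2 _; rewrite ler_pM2l// hd.
  apply: le_trans (ler_normD _ _) _; apply: lerD; last first.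
    by apply: le_trans H1 _; rewrite ler_pM2l// hd.
  by rewrite normrM ler_wpM2r// bf.
have -> : M * D + e * (3 * D) + e * (2 * D) = (M + M') / 2 * D by rewrite /e; field.
rewrite ler_pM2r// ler_pdivlMr ?ltr0n// mulr_natr mulr2n lerD2r => /(lt_le_trans MM').
by rewrite ltxx.
Qed.

Lemma mean_value (f f' : K -> K) (z rho M : K) : 0 <= M ->
  (forall t, `|t - z| < rho -> is_derive t 1 f (f' t)) ->
  (forall t, `|t - z| < rho -> `|f' t| <= M) ->
  forall x y, `|x - z| < rho -> `|y - z| < rho -> `|f y - f x| <= M * `|y - x|.
Proof.
move=> M0 df bf x y hx hy.
have [h|h] := real_leP (normr_real (x - z)) (normr_real (y - z)).
  apply: (@mean_value_closed f f' z `|y - z|) => // t ht.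
    by apply: df; apply: le_lt_trans hy.
  by apply: bf; apply: le_lt_trans hy.
apply: (@mean_value_closed f f' z `|x - z|) => //; last exact: ltW.
  by move=> t ht; apply: df; apply: le_lt_trans hx.
by move=> t ht; apply: bf; apply: le_lt_trans hx.
Qed.

Lemma mean_value_affine (f f' : K -> K) (a z rho M : K) : 0 <= M -> 0 <= rho ->
  (forall t, `|t - z| <= rho -> is_derive t 1 f (f' t)) ->
  (forall t, `|t - z| <= rho -> `|f' t - a| <= M) ->
  forall x y, `|x - z| <= rho -> `|y - z| <= rho ->
    `|f y - f x - a * (y - x)| <= M * `|y - x|.
Proof.
move=> M0 rho0 df bf x y hx hy.
have -> : f y - f x - a * (y - x) = (f y - a * y) - (f x - a * x) by ring.
apply: (@mean_value_closed (fun t => f t - a * t) (fun t => f' t - a) z rho) => // t ht.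
have dt := df t ht; apply: is_derive_eq.
by rewrite /GRing.scale /= mulr1.
Qed.

Lemma derive0_constant (f : K -> K) (z rho : K) :
  (forall t, `|t - z| < rho -> is_derive t 1 f 0) ->
  forall x, `|x - z| < rho -> f x = f z.
Proof.
move=> df x hx; apply/eqP; rewrite -subr_eq0 -normr_le0 -[0](mul0r `|x - z|).
apply: (@mean_value f (fun=> 0) z rho) => //; first by move=> *; rewrite normr0.
by rewrite subrr normr0; apply: le_lt_trans hx.
Qed.

End MeanValue.

(** * Uniform limits and primitives *)

Section LimitsOfDerivatives.
Variable K : numFieldType.
Hypothesis archK : archimedean_field K.
Hypothesis compK : geometrically_complete K.

Lemma geometric_le (B : K) n m : 0 <= B -> (n <= m)%N -> B / 2 ^+ m <= B / 2 ^+ n.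
Proof.
by move=> B0 nm; rewrite ler_wpM2l// lef_pV2 ?posrE ?exprn_gt0// ler_eXn2l ?ltr1n.
Qed.

(** The mean value inequality for [f m - f n] bounds its increments by 2 B / 2^n |t - s| uniformly
    in m >= n; letting [m] grow transfers this to [F - f n], and the derivative of one fixed [f n]
    does the rest. The 3 B in the choice of [n] is this 2 B plus the distance B from [f' n] to
    [g]. *)
Lemma derive_uniform_limit (f f' : nat -> K -> K) (F g : K -> K) (z rho B : K) :
  0 <= B ->
  (forall n t, `|t - z| < rho -> is_derive t 1 (f n) (f' n t)) ->
  (forall n t, `|t - z| < rho -> `|f n t - F t| <= B / 2 ^+ n) ->
  (forall n t, `|t - z| < rho -> `|f' n t - g t| <= B / 2 ^+ n) ->
  forall t, `|t - z| < rho -> is_derive t 1 F (g t).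
Proof.
move=> B0 df fF f'g s hs; apply/is_derive1P => e e0.
have [||n Hn] := @geometric_small K archK (3 * B) (e / 2); rewrite ?mulr_ge0 ?divr_gt0//.
have key t : `|t - z| < rho ->
    `|(F t - f n t) - (F s - f n s)| <= 2 * B / 2 ^+ n * `|t - s|.
  move=> ht; have bn0 m : 0 <= B / 2 ^+ m by rewrite divr_ge0 ?exprn_ge0.
  apply: (@le_geometric K archK _ _ (2 * B)); rewrite ?normr_real ?mulr_ge0//.
    by rewrite ger0_real// !mulr_ge0 ?invr_ge0 ?exprn_ge0.
  move=> m0; exists (maxn m0 n); first exact: leq_maxl.
  set m := maxn _ _; have nm : (n <= m)%N by exact: leq_maxr.
  have -> : (F t - f n t) - (F s - f n s) =
    ((f m t - f n t) - (f m s - f n s)) + ((f m s - F s) - (f m t - F t)) by ring.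
  apply: le_trans (ler_normD _ _) _; apply: lerD; last first.
    apply: le_trans (ler_normB _ _) _; rewrite -mulrA mulr_natl mulr2n.
    by apply: lerD; apply: fF.
  apply: (@mean_value K archK compK (fun t => f m t - f n t)
    (fun t => f' m t - f' n t) z rho) => //.
  - by rewrite -mulrA mulr_ge0.
  - by move=> u hu; have := df m u hu; have := df n u hu => *; apply: is_derive_eq.
  - move=> u hu; have -> : f' m u - f' n u = (f' m u - g u) - (f' n u - g u) by ring.
    apply: le_trans (ler_normB _ _) _; rewrite -mulrA mulr_natl mulr2n.
    apply: lerD; last exact: f'g.
    by apply: le_trans (f'g _ _ hu) _; apply: geometric_le.
have e2 : 0 < e / 2 by rewrite divr_gt0.
have /is_derive1P/(_ _ e2)/near0_normP[d d0 Hd] := df n s hs.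
have r0 : 0 < rho - `|s - z| by rewrite subr_gt0.
have [d' [d'0 d'd d'r]] := pos_lower_bound d0 r0.
apply/near0_normP; exists d' => // t td'.
have td := lt_le_trans td' d'd; have tr := lt_le_trans td' d'r.
have ht : `|t - z| < rho.
  have -> : t - z = (t - s) + (s - z) by ring.
  by apply: le_lt_trans (ler_normD _ _) _; rewrite -ltrBrDr.
have -> : F t - F s - g s * (t - s) = ((F t - f n t) - (F s - f n s))
  + ((f n t - f n s - f' n s * (t - s)) + (f' n s - g s) * (t - s)) by ring.
apply: le_trans (ler_normD _ _) _; apply: le_trans (lerD (key t ht) (ler_normD _ _)) _.
have -> : e = e / 2 + e / 2 by field.
rewrite (mulrDl _ _ `|_|) addrCA.
apply: lerD; first exact: Hd.
rewrite normrM -mulrDl ler_wpM2r//.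
apply: le_trans (ltW Hn).
have -> : 3 * B / 2 ^+ n = 2 * B / 2 ^+ n + B / 2 ^+ n by rewrite -mulrDl; congr (_ / _); ring.
by rewrite lerD2l f'g.
Qed.

Lemma is_derive_sum_seq (V : normedModType K) (I : Type) (r : seq I) (f : I -> V -> K)
    (f' : I -> K) (t v : V) :
  (forall i, is_derive t v (f i) (f' i)) ->
  is_derive t v (fun s => \sum_(i <- r) f i s) (\sum_(i <- r) f' i).
Proof.
move=> df; elim: r => [|i r IH].
  rewrite big_nil; have -> : (fun s => \sum_(i <- [::]) f i s) = cst 0.
    by apply/funext => s; rewrite big_nil.
  exact: is_derive_cst.
rewrite big_cons; have -> : (fun s => \sum_(j <- i :: r) f j s) =
   f i + (fun s => \sum_(j <- r) f j s).
  by apply/funext => s; rewrite big_cons.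
exact: is_deriveD.
Qed.

Lemma norm_sum_le (I : finType) (F : I -> K) (B : K) :
  (forall i, `|F i| <= B) -> `|\sum_i F i| <= #|I|%:R * B.
Proof.
move=> H; apply: le_trans (ler_norm_sum _ _ _) _.
by rewrite mulr_natl -sumr_const; apply: ler_sum.
Qed.

(* The primitive is a limit of dyadic Riemann sums on the segment [z, t]. *)
Lemma primitive (f f1 f2 : K -> K) (z rho M : K) : 0 <= M -> 0 < rho ->
  (forall t, `|t - z| < rho ->
    [/\ is_derive t 1 f (f1 t), is_derive t 1 f1 (f2 t), `|f1 t| <= M & `|f2 t| <= M]) ->
  exists F : K -> K, F z = 0 /\ forall t, `|t - z| < rho -> is_derive t 1 F (f t).
Proof.
move=> M0 rho0 H.
pose tau n k (t : K) := z + k%:R / 2 ^+ n * (t - z).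
pose F n t := \sum_(k < 2 ^ n) (t - z) / 2 ^+ n * f (tau n k t).
(* [G'] is the derivative of (t - z) f(t). The derivative of the Riemann sum [F n] is the exact
   average of [G'] over the dyadic points, while (t - z) f(t) telescopes into its increments between
   these points; the two are compared through the Lipschitz constant [L] of [G']. *)
pose G' t := f t + (t - z) * f1 t.
pose F' n t := \sum_(k < 2 ^ n) 2 ^- n * G' (tau n k t).
pose L := 2 * M + rho * M.
have L0 : 0 <= L by rewrite addr_ge0 ?mulr_ge0// ltW.
have tau_near n k t : (k <= 2 ^ n)%N -> `|tau n k t - z| <= `|t - z|.
  move=> hk; rewrite /tau addrC addKr normrM ler_piMl//.
  rewrite ger0_norm ?divr_ge0 ?exprn_ge0// ler_pdivrMr ?exprn_gt0// mul1r.
  by rewrite -natrX ler_nat.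
have dF n t : `|t - z| < rho -> is_derive t 1 (F n) (F' n t).
  move=> ht; apply: is_derive_sum_seq => k.
  have hk : (k <= 2 ^ n)%N by apply: ltnW.
  have [d1 _ _ _] := H _ (le_lt_trans (tau_near n k t hk) ht).
  have dt : is_derive t 1 (tau n k) (k%:R / 2 ^+ n).
    rewrite /tau; apply: is_derive_eq.
    by rewrite add0r subr0 /GRing.scale/= mulr1.
  have dl : is_derive t 1 (fun s => (s - z) / 2 ^+ n) (2 ^- n).
    have -> : (fun s => (s - z) / 2 ^+ n) = (fun s => 2 ^- n * (s - z)).
      by apply/funext => s; rewrite mulrC.
    apply: is_derive_eq.
    by rewrite subr0 /GRing.scale/= mulr1.
  have := is_deriveM dl (is_derive1_chain d1 dt).
  congr (is_derive _ _ _ _); rewrite /GRing.scale/= /G' /tau.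
  by field; rewrite expf_neq0.
have dG t : `|t - z| < rho -> is_derive t 1 (fun s => (s - z) * f s) (G' t).
  move=> ht; have [d1 _ _ _] := H _ ht.
  have dl : is_derive t 1 (fun s => s - z) 1 by apply: is_derive_eq; rewrite subr0.
  have := is_deriveM dl d1; congr (is_derive _ _ _ _).
  by rewrite /GRing.scale/= /G'; ring.
have dG' t : `|t - z| < rho -> is_derive t 1 G' (2 * f1 t + (t - z) * f2 t).
  move=> ht; have [d1 d2 _ _] := H _ ht.
  have dl : is_derive t 1 (fun s => s - z) 1 by apply: is_derive_eq; rewrite subr0.
  have := is_deriveD d1 (is_deriveM dl d2); congr (is_derive _ _ _ _).
  by rewrite /GRing.scale/=; ring.
have G'_lip x y : `|x - z| < rho -> `|y - z| < rho -> `|G' y - G' x| <= L * `|y - x|.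
  apply: (mean_value archK compK L0 dG') => t ht; have [_ _ b1 b2] := H _ ht.
  apply: le_trans (ler_normD _ _) _; apply: lerD.
    by rewrite normrM ger0_norm// ler_wpM2l.
  by rewrite normrM ler_pM// ltW.
have F'f n t : `|t - z| < rho -> `|F' n t - f t| <= L * rho / 2 ^+ n.
  move=> ht; have [->|tz] := eqVneq t z.
    rewrite (_ : F' n z = f z) ?subrr ?normr0 ?divr_ge0 ?exprn_ge0 ?mulr_ge0 ?(ltW rho0)//.
    rewrite /F' (eq_bigr (fun=> 2 ^- n * f z)); last first.
      by move=> k _; rewrite /G' /tau !subrr mulr0 addr0 subrr mul0r addr0.
    rewrite sumr_const card_ord -[_ *+ _]mulr_natl natrX mulrA divff ?mul1r//.
  have h0 : 0 < `|t - z| by rewrite normr_gt0 subr_eq0.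
  rewrite -(ler_pM2l h0) -normrM mulrBr.
  pose d := (t - z) / 2 ^+ n.
  have -> : (t - z) * f t = \sum_(k < 2 ^ n)
     ((tau n k.+1 t - z) * f (tau n k.+1 t) - (tau n k t - z) * f (tau n k t)).
    rewrite -(big_mkord xpredT (fun k => (tau n k.+1 t - z) * f (tau n k.+1 t)
                       - (tau n k t - z) * f (tau n k t))).
    rewrite (telescope_sumr (fun k => (tau n k t - z) * f (tau n k t)))//.
    rewrite /tau mul0r mul0r addr0 subrr mul0r subr0 natrX divff ?expf_neq0//.
    by rewrite mul1r subrKC.
  rewrite /F' mulr_sumr -sumrB.
  apply: le_trans (@norm_sum_le _ _ (L * `|d| * `|d|) _) _ => /=; last first.
    rewrite card_ord natrX /d normrM normfV [`|2 ^+ n|]ger0_norm ?exprn_ge0//.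
    have -> : 2 ^+ n * (L * (`|t - z| / 2 ^+ n) * (`|t - z| / 2 ^+ n)) =
      `|t - z| * (L * `|t - z| / 2 ^+ n) by field; rewrite expf_neq0.
    rewrite ler_pM2l// ler_pM2r ?invr_gt0 ?exprn_gt0//.
    by apply: ler_wpM2l => //; exact: ltW.
  move=> k; have dk : tau n k.+1 t - tau n k t = d.
    by rewrite /tau /d -natr1; field; rewrite expf_neq0.
  rewrite mulrA -/d mulrC -{1}dk.
  have near_tau u : `|u - tau n k t| <= `|d| -> `|u - z| <= `|t - z|.
    move=> hu; have -> : u - z = (u - tau n k t) + (tau n k t - z) by ring.
    apply: le_trans (ler_normD _ _) _; apply: le_trans (lerD hu (lexx _)) _.
    rewrite /tau [z + _]addrC addrK /d !normrM normfV !(@ger0_norm _ (2 ^+ n)) ?exprn_ge0//.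
    rewrite (ger0_norm (ler0n _ k)) addrC.
    have -> : k%:R / 2 ^+ n * `|t - z| + `|t - z| / 2 ^+ n = k.+1%:R / 2 ^+ n * `|t - z|.
      by rewrite -natr1; field; rewrite expf_neq0.
    by rewrite ler_piMl// ler_pdivrMr ?exprn_gt0// mul1r -natrX ler_nat.
  have dk0 : `|tau n k t - tau n k t| <= `|d| by rewrite subrr normr0.
  have dk1 : `|tau n k.+1 t - tau n k t| <= `|d| by rewrite dk.
  rewrite distrC -{2}dk.
  apply: (@mean_value_affine K archK compK (fun s => (s - z) * f s) G' _ (tau n k t) `|d|) => //.
  - by rewrite mulr_ge0.
  - by move=> u hu; apply: dG; apply: le_lt_trans ht; apply: near_tau.
  - move=> u hu; apply: le_trans (G'_lip _ _ _ _) _; last exact: ler_wpM2l.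
      by apply: le_lt_trans ht; apply: near_tau.
    by apply: le_lt_trans ht; apply: near_tau.
have Fz n : F n z = 0 by rewrite /F big1// => k _; rewrite subrr !mul0r.
have C0 : 0 <= L * rho by rewrite mulr_ge0// ltW.
set C := L * rho in F'f C0; clearbody C.
have r1 := ltW rho0.
have /choice[F0 HF0] : forall t, exists l, `|t - z| < rho ->
    forall n, `|F n t - l| <= 2 * (2 * C * rho) / 2 ^+ n.
  move=> t; have [ht|ht] := pselect (`|t - z| < rho); last by exists 0.
  have [|l Hl] := compK (B := 2 * C * rho) (u := fun n => F n t); last by exists l.
  move=> n; rewrite -[F n.+1 t]subr0 -(subrr (F n t)).
  have -> : F n.+1 t - (F n t - F n t) - F n t = (F n.+1 t - F n t) - (F n.+1 z - F n z).
    by rewrite !Fz; ring.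
  apply: le_trans (_ : 2 * C / 2 ^+ n * `|t - z| <= _); last first.
    by rewrite mulrAC ler_wpM2r ?invr_ge0 ?exprn_ge0// ler_wpM2l ?mulr_ge0// ltW.
  apply: (@mean_value K archK compK (fun t => F n.+1 t - F n t)
    (fun t => F' n.+1 t - F' n t) z rho) => //.
  - by rewrite !mulr_ge0 ?invr_ge0 ?exprn_ge0.
  - by move=> u hu; have := dF n u hu; have := dF n.+1 u hu => *; apply: is_derive_eq.
  - move=> u hu; have -> : F' n.+1 u - F' n u = (F' n.+1 u - f u) - (F' n u - f u) by ring.
    apply: le_trans (ler_normB _ _) _; rewrite -mulrA mulr_natl mulr2n.
    apply: lerD; last exact: F'f.
    by apply: le_trans (F'f _ _ hu) _; apply: geometric_le.
  - by rewrite subrr normr0.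
exists (fun t => F0 t - F0 z); split=> [|t ht]; first exact: subrr.
have := @derive_uniform_limit F F' F0 f z rho (C + 2 * (2 * C * rho)).
move=> /(_ _ dF _ _ t ht) dF0.
have dd : is_derive t 1 F0 (f t).
  apply: dF0.
  - by rewrite addr_ge0 ?mulr_ge0.
  - move=> n u hu; apply: le_trans (HF0 u hu n) _.
    by rewrite ler_pM2r ?invr_gt0 ?exprn_gt0// lerDr.
  - move=> n u hu; apply: le_trans (F'f n u hu) _.
    by rewrite ler_pM2r ?invr_gt0 ?exprn_gt0// lerDl !mulr_ge0.
by apply: is_derive_eq; rewrite subr0.
Qed.

End LimitsOfDerivatives.

(** * Linear differential systems on a small ball *)

Section LinearSystems.
Variable K : numFieldType.
Hypothesis archK : archimedean_field K.
Hypothesis compK : geometrically_complete K.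

(** The class in which Picard iteration runs: [primitive] asks for two bounded derivatives of the
    integrand, and the class is closed under sums, products and primitives. *)
Definition bounded_C2 (z rho : K) (f : K -> K) : Prop :=
  exists (f1 f2 : K -> K) (M : K), 0 <= M /\ forall t, `|t - z| < rho ->
    [/\ is_derive t 1 f (f1 t), is_derive t 1 f1 (f2 t),
        `|f t| <= M, `|f1 t| <= M & `|f2 t| <= M].

Variables z rho : K.
Local Notation B2 := (bounded_C2 z rho).

Lemma bounded_C2_cst (c : K) : B2 (fun=> c).
Proof.
exists (fun=> 0), (fun=> 0), `|c|; split=> // t ht.
by split; rewrite ?normr0//; exact: is_derive_cst.
Qed.

Lemma bounded_C2D f g : B2 f -> B2 g -> B2 (fun t => f t + g t).
Proof.
move=> [f1 [f2 [M [M0 Hf]]]] [g1 [g2 [N [N0 Hg]]]].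
exists (fun t => f1 t + g1 t), (fun t => f2 t + g2 t), (M + N).
split=> [|t ht]; first exact: addr_ge0.
have [a1 a2 a3 a4 a5] := Hf t ht; have [b1 b2 b3 b4 b5] := Hg t ht.
by split; try exact: is_deriveD; apply: le_trans (ler_normD _ _) _; apply: lerD.
Qed.

Lemma bounded_C2M f g : B2 f -> B2 g -> B2 (fun t => f t * g t).
Proof.
move=> [f1 [f2 [M [M0 Hf]]]] [g1 [g2 [N [N0 Hg]]]].
exists (fun t => f t * g1 t + g t * f1 t).
exists (fun t => (f t * g2 t + g1 t * f1 t) + (g t * f2 t + f1 t * g1 t)).
have MN0 : 0 <= M * N by rewrite mulr_ge0.
have le4 (k : nat) : (k <= 4)%N -> k%:R * (M * N) <= 4 * (M * N).
  by move=> hk; rewrite ler_wpM2r// ler_nat.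
exists (4 * (M * N)).
split=> [|t ht]; first by rewrite mulr_ge0.
have [a1 a2 a3 a4 a5] := Hf t ht; have [b1 b2 b3 b4 b5] := Hg t ht.
have bound (a b : K) : `|a| <= M -> `|b| <= N -> `|a * b| <= M * N.
  by move=> *; rewrite normrM ler_pM.
have boundC (a b : K) : `|a| <= N -> `|b| <= M -> `|a * b| <= M * N.
  by move=> *; rewrite mulrC; exact: bound.
split.
- exact: is_deriveM.
- exact: is_deriveD (is_deriveM _ _) (is_deriveM _ _).
- by apply: le_trans (le4 1%N _); rewrite ?mul1r ?bound.
- apply: le_trans (le4 2%N _) => //; apply: le_trans (ler_normD _ _) _.
  by rewrite mulr_natl mulr2n; apply: lerD; [exact: bound|exact: boundC].
- apply: le_trans (ler_normD _ _) _.
  have -> : 4 * (M * N) = (M * N + M * N) + (M * N + M * N) by ring.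
  apply: lerD; apply: le_trans (ler_normD _ _) _; apply: lerD;
  first [by apply: bound|by apply: boundC].
Qed.

Lemma bounded_C2_sum (I : Type) (r : seq I) (f : I -> K -> K) :
  (forall i, B2 (f i)) -> B2 (fun t => \sum_(i <- r) f i t).
Proof.
move=> Hf; elim: r => [|i r IH].
  have -> : (fun t => \sum_(i <- [::]) f i t) = (fun=> 0).
    by apply/funext => t; rewrite big_nil.
  exact: bounded_C2_cst.
have -> : (fun t => \sum_(j <- i :: r) f j t) = (fun t => f i t + \sum_(j <- r) f j t).
  by apply/funext => t; rewrite big_cons.
exact: bounded_C2D.
Qed.

Lemma bounded_C2_primitive f (c : K) : 0 < rho -> B2 f ->
  exists F, [/\ B2 F, F z = c & forall t, `|t - z| < rho -> is_derive t 1 F (f t)].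
Proof.
move=> rho0 [f1 [f2 [M [M0 H]]]].
have [|F [Fz dF]] := @primitive K archK compK f f1 f2 z rho M M0 rho0.
  by move=> t /H[].
have dcF t : `|t - z| < rho -> is_derive t 1 (fun s => c + F s) (f t).
  by move=> ht; have := dF t ht => *; apply: is_derive_eq; rewrite add0r.
exists (fun t => c + F t); split=> //; last by rewrite Fz addr0.
have zz : `|z - z| < rho by rewrite subrr normr0.
exists f, f1, (`|c| + M * rho + M); split=> [|t ht].
  by rewrite !addr_ge0 ?mulr_ge0 ?(ltW rho0).
have [d1 _ b0 b1 _] := H t ht.
have r1 := ltW rho0.
have leM : M <= `|c| + M * rho + M by rewrite lerDr addr_ge0 ?mulr_ge0.
split; first exact: dcF.
- exact: d1.
- apply: le_trans (ler_normD _ _) _; rewrite -addrA lerD2l.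
  apply: le_trans (_ : M * rho <= _); last by rewrite lerDl.
  have := @mean_value K archK compK F f z rho M M0 dF.
  move=> /(_ _ z t zz ht); rewrite Fz subr0 => mv.
  apply: le_trans (mv _) _; first by move=> u /H[].
  by rewrite ler_wpM2l// ltW.
- exact: le_trans leM.
- exact: le_trans leM.
Qed.

Variables (m : nat) (A : 'I_m -> 'I_m -> K -> K) (M : K).
Hypothesis rho0 : 0 < rho.
Hypothesis M0 : 0 <= M.
Hypothesis Mrho : m%:R * M * rho <= 2^-1.
Hypothesis AM : forall i j t, `|t - z| < rho -> `|A i j t| <= M.

Lemma system_field_bound (d : 'I_m -> K) (B : K) i t : 0 <= B -> `|t - z| < rho ->
  (forall j, `|d j| <= B) -> `|\sum_j A i j t * d j| <= m%:R * M * B.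
Proof.
move=> B0 ht dB; rewrite -mulrA; have := @norm_sum_le K 'I_m (fun j => A i j t * d j) (M * B).
by rewrite card_ord; apply=> j; rewrite normrM ler_pM// AM.
Qed.

(** Since [m * M * rho <= 1/2], one mean value estimate halves any uniform bound on a solution that
    vanishes at [z]. *)
Lemma linear_system_unique (y : 'I_m -> K -> K) (B : K) : 0 <= B ->
  (forall i t, `|t - z| < rho -> `|y i t| <= B) ->
  (forall i t, `|t - z| < rho -> is_derive t 1 (y i) (\sum_j A i j t * y j t)) ->
  (forall i, y i z = 0) ->
  forall i t, `|t - z| < rho -> y i t = 0.
Proof.
move=> B0 yB dy y0 i t ht; have zz : `|z - z| < rho by rewrite subrr normr0.
have r1 := ltW rho0.
suff H n : forall i t, `|t - z| < rho -> `|y i t| <= B / 2 ^+ n.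
  apply/eqP; rewrite -normr_le0.
  apply: (@le_geometric K archK _ _ B); rewrite ?normr_real ?real0//.
  by move=> n; exists n; rewrite // add0r; exact: H.
elim: n => [|n IH] {}i {}t {}ht; first by rewrite expr0 divr1; exact: yB.
have Bn0 : 0 <= B / 2 ^+ n by rewrite divr_ge0 ?exprn_ge0.
have := @mean_value K archK compK (y i) _ z rho (m%:R * M * (B / 2 ^+ n)) _ (dy i) _ z t zz ht.
rewrite y0 subr0 => mv; apply: le_trans (mv _ _) _.
- by rewrite !mulr_ge0 ?invr_ge0 ?exprn_ge0.
- by move=> u hu; apply: system_field_bound => // j; exact: IH.
have -> : B / 2 ^+ n.+1 = 2^-1 * (B / 2 ^+ n) by rewrite exprS invfM; ring.
rewrite mulrAC ler_wpM2r//.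
by apply: le_trans Mrho; rewrite ler_wpM2l ?mulr_ge0// ltW.
Qed.

(** Picard iteration: the same factor 1/2 makes successive iterates differ by D / 2^n, and
    [derive_uniform_limit] carries the equation over to the limit. *)
Lemma linear_system_exists (y0 : 'I_m -> K) : (forall i j, B2 (A i j)) ->
  exists y : 'I_m -> K -> K, forall i, y i z = y0 i /\
    forall t, `|t - z| < rho -> is_derive t 1 (y i) (\sum_j A i j t * y j t).
Proof.
move=> AB2; have zz : `|z - z| < rho by rewrite subrr normr0.
have r1 := ltW rho0.
(* [choice] asks for a step defined on all families; outside the bounded class [y] itself is
   returned. *)
have /choice[Phi HPhi] : forall y : 'I_m -> K -> K, exists y' : 'I_m -> K -> K,
    (forall i, B2 (y i)) -> forall i, [/\ B2 (y' i), y' i z = y0 i &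
      forall t, `|t - z| < rho -> is_derive t 1 (y' i) (\sum_j A i j t * y j t)].
  move=> y; have [yB2|nyB2] := pselect (forall i, B2 (y i)); last by exists y.
  have /choice[y' Hy'] : forall i, exists F, [/\ B2 F, F z = y0 i &
      forall t, `|t - z| < rho -> is_derive t 1 F (\sum_j A i j t * y j t)].
    move=> i; apply: bounded_C2_primitive => //.
    by apply: bounded_C2_sum => j; exact: bounded_C2M.
  by exists y'.
pose y n := iter n Phi (fun i => fun=> y0 i).
have yB2 n i : B2 (y n i).
  elim: n i => [|n IH] i; first exact: bounded_C2_cst.
  by have [] := HPhi (y n) IH i.
have yz n i : y n i z = y0 i.
  by case: n => [//|n]; have [] := HPhi (y n) (yB2 n) i.
have dy n i t : `|t - z| < rho -> is_derive t 1 (y n.+1 i) (\sum_j A i j t * y n j t).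
  by move=> ht; have [_ _] := HPhi (y n) (yB2 n) i; apply.
have [D [D0 HD]] : exists D, 0 <= D /\ forall i t, `|t - z| < rho -> `|y 1%N i t - y 0%N i t| <= D.
  have /choice[N HN] : forall i, exists N, 0 <= N /\ forall t, `|t - z| < rho ->
      `|y 1%N i t - y 0%N i t| <= N.
    move=> i; have [f1 [f2 [N [N0 H1]]]] := yB2 1%N i.
    exists (N + `|y0 i|); split=> [|t ht]; first by rewrite addr_ge0.
    have [_ _ b _ _] := H1 t ht.
    by apply: le_trans (ler_normB _ _) _; rewrite lerD2r.
  exists (\sum_i N i); split=> [|i t ht].
    by apply: sumr_ge0 => i _; case: (HN i).
  apply: le_trans (proj2 (HN i) t ht) _.
  by rewrite (bigD1 i)//= lerDl; apply: sumr_ge0 => j _; case: (HN j).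
have cauchy n : forall i t, `|t - z| < rho -> `|y n.+1 i t - y n i t| <= D / 2 ^+ n.
  elim: n => [|n IH] i t ht; first by rewrite expr0 divr1; exact: HD.
  have Dn0 : 0 <= D / 2 ^+ n by rewrite divr_ge0 ?exprn_ge0.
  have := @mean_value K archK compK (fun t => y n.+2 i t - y n.+1 i t)
    (fun t => \sum_j A i j t * (y n.+1 j t - y n j t)) z rho (m%:R * M * (D / 2 ^+ n)).
  move=> /(_ _ _ _ z t zz ht); rewrite !yz subrr subr0 => mv; apply: le_trans (mv _ _ _) _.
  - by rewrite !mulr_ge0 ?invr_ge0 ?exprn_ge0.
  - move=> u hu; have := dy n.+1 i u hu; have := dy n i u hu => *; apply: is_derive_eq.
    by rewrite -sumrB; apply: eq_bigr => j _; rewrite mulrBr.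
  - by move=> u hu; apply: system_field_bound => // j; exact: IH.
  have -> : D / 2 ^+ n.+1 = 2^-1 * (D / 2 ^+ n) by rewrite exprS invfM; ring.
  rewrite mulrAC ler_wpM2r//.
  by apply: le_trans Mrho; rewrite ler_wpM2l ?mulr_ge0// ltW.
have /choice[Y HY] : forall i, exists Y : K -> K, forall t, `|t - z| < rho ->
    forall n, `|y n i t - Y t| <= 2 * D / 2 ^+ n.
  move=> i; suff /choice[Y HY] : forall t, exists l, `|t - z| < rho ->
    forall n, `|y n i t - l| <= 2 * D / 2 ^+ n by exists Y.
  move=> t.
  have [ht|ht] := pselect (`|t - z| < rho); last by exists 0.
  have [|l Hl] := compK (B := D) (u := fun n => y n i t); last by exists l.
  by move=> n; exact: cauchy.
have DD0 : 0 <= 2 * D by rewrite mulr_ge0.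
have MD0 : 0 <= m%:R * M * (2 * D) by rewrite !mulr_ge0.
exists Y => i; split.
  apply/eqP; rewrite eq_sym -subr_eq0 -normr_le0.
  apply: (@le_geometric K archK _ _ (2 * D)); rewrite ?normr_real ?real0//.
  by move=> n; exists n; rewrite // add0r -(yz n); exact: HY.
apply: (@derive_uniform_limit K archK compK (fun n t => y n.+1 i t)
   (fun n t => \sum_j A i j t * y n j t) (Y i) _ z rho (2 * D + m%:R * M * (2 * D))).
- exact: addr_ge0.
- by move=> n t ht; exact: (dy n i t ht).
- move=> n t ht; apply: le_trans (HY i t ht n.+1) _.
  apply: le_trans (geometric_le DD0 (leqnSn n)) _.
  by rewrite ler_pM2r ?invr_gt0 ?exprn_gt0// lerDl.
- move=> n t ht; rewrite -sumrB (eq_bigr (fun j => A i j t * (y n j t - Y j t))); last first.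
    by move=> j _; rewrite mulrBr.
  apply: le_trans (@system_field_bound _ (2 * D / 2 ^+ n) i t _ ht _) _.
  + by rewrite mulr_ge0 ?invr_ge0 ?exprn_ge0.
  + by move=> j; exact: HY.
  by rewrite mulrA ler_pM2r ?invr_gt0 ?exprn_gt0// lerDr.
Qed.

End LinearSystems.

(** * Local inversion in one variable *)

Section InverseFunction.
Variable K : numFieldType.
Hypothesis archK : archimedean_field K.
Hypothesis compK : geometrically_complete K.

Lemma open_ball_norm (z rho : K) : open [set t : K | `|t - z| < rho].
Proof.
rewrite openE => t /= ht; apply/near0_normP; exists (rho - `|t - z|).
  by rewrite subr_gt0.
move=> s hs /=; have -> : s - z = (s - t) + (t - z) by ring.
by apply: le_lt_trans (ler_normD _ _) _; rewrite -ltrBrDr.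
Qed.

Lemma is_derive_continuous (f : K -> K) (x a : K) :
  is_derive x 1 f a -> {for x, continuous f}.
Proof. by move=> [df _]; apply: differentiable_continuous; exact/derivable1_diffP. Qed.

(** On a small ball [T] differs from the linear map of slope [tau] by a map with Lipschitz constant
    |tau|/2. This gives injectivity with a Lipschitz inverse ([lip]) and makes the iteration that
    solves T u = y contract. *)
Lemma local_inverse (T T1 : K -> K) (t0 d : K) : 0 < d ->
  (\forall t \near t0, is_derive (t : K) (1 : K) T (T1 t)) ->
  {for t0, continuous T1} -> T1 t0 != 0 ->
  exists (U V : set K) (S : K -> K),
    [/\ open U, open V, U t0, forall t, U t -> `|t - t0| < d &
        (forall t, U t -> V (T t) /\ S (T t) = t) /\
        (forall y, V y -> [/\ U (S y), T (S y) = y & is_derive y 1 S (T1 (S y))^-1])].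
Proof.
move=> d0 /near0_normP[d1 d10 dT] cT T0; set tau := T1 t0 in cT T0.
have tau0 : 0 < `|tau| by rewrite normr_gt0.
have /cvgrPdist_le/(_ (`|tau| / 2)) := cT; rewrite divr_gt0// => /(_ isT).
move=> /near0_normP[d2 d20 HT].
have [d3 [d30 d3d d3d1]] := pos_lower_bound d0 d10.
have [d4 [d40 d4d3 d4d2]] := pos_lower_bound d30 d20.
pose rho := d4 / 2; have rho0 : 0 < rho by rewrite divr_gt0.
have rhod : rho < d4 by rewrite ltr_pdivrMr// ltr_pMr// ltr1n.
clearbody rho.
have dTr t : `|t - t0| <= rho -> is_derive t 1 T (T1 t).
  move=> ht; apply: dT; apply: lt_le_trans d3d1; apply: lt_le_trans d4d3.
  exact: le_lt_trans rhod.
have T1r t : `|t - t0| <= rho -> `|T1 t - tau| <= `|tau| / 2.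
  move=> ht; rewrite distrC; apply: HT; apply: lt_le_trans d4d2.
  exact: le_lt_trans rhod.
have T10 t : `|t - t0| <= rho -> `|tau| / 2 <= `|T1 t|.
  move=> ht; have -> : `|tau| / 2 = `|tau| - `|tau| / 2 by field.
  have := lerB_dist tau (tau - T1 t); rewrite subKr => H; apply: le_trans H.
  by rewrite lerD2l lerN2 distrC T1r.
have t2 : 0 <= `|tau| / 2 by rewrite divr_ge0.
have aff u v : `|u - t0| <= rho -> `|v - t0| <= rho ->
    `|T v - T u - tau * (v - u)| <= `|tau| / 2 * `|v - u|.
  by apply: (@mean_value_affine K archK compK T T1) => //; exact: ltW.
have lip u v : `|u - t0| <= rho -> `|v - t0| <= rho ->
    `|v - u| <= 2 / `|tau| * `|T v - T u|.
  move=> hu hv; rewrite mulrAC ler_pdivlMr//.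
  have -> : `|v - u| * `|tau| = 2 * (`|tau * (v - u)| - `|tau| / 2 * `|v - u|).
    by rewrite normrM; field.
  rewrite ler_pM2l// lerBlDr.
  have -> : tau * (v - u) = (T v - T u) - (T v - T u - tau * (v - u)) by ring.
  apply: le_trans (ler_normB _ _) _; rewrite lerD2l; exact: aff.
have up u v : `|u - t0| <= rho -> `|v - t0| <= rho ->
    `|T v - T u| <= 2 * `|tau| * `|v - u|.
  move=> hu hv; have -> : T v - T u = (T v - T u - tau * (v - u)) + tau * (v - u) by ring.
  apply: le_trans (ler_normD _ _) _; rewrite normrM.
  apply: le_trans (lerD (aff _ _ hu hv) (lexx _)) _.
  rewrite -mulrDl ler_wpM2r// mulr_natl mulr2n lerD2r ler_pdivrMr//.
  by rewrite ler_pMr// lerDl.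
(* For [y] in [V] the first correction (y - T t0) / tau is shorter than rho / 4. Corrections are at
   least halved each time, so the iterates and their limit stay within rho / 2 of [t0]. *)
pose V := [set y | `|y - T t0| < `|tau| * rho / 4].
pose U := [set t | `|t - t0| < rho /\ V (T t)].
have t0t0 : `|t0 - t0| <= rho by rewrite subrr normr0 ltW.
have /choice[S HS] : forall y, exists l, V y -> `|l - t0| <= rho / 2 /\ T l = y.
  move=> y; have [Vy|nVy] := pselect (V y); last by exists t0.
  (* Newton iteration with the slope frozen at [tau]; by [aff] each correction is at most half of
     the previous one. *)
  pose step u := u + (y - T u) / tau.
  pose u n := iter n step t0.
  have uS n : u n.+1 = u n + (y - T (u n)) / tau by [].
  have r2 : 0 < rho / 2 by rewrite divr_gt0.
  have inv n : `|u n - t0| <= rho / 2 * (1 - 2 ^- n) /\ `|u n.+1 - u n| <= rho / 4 / 2 ^+ n.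
    elim: n => [|n [h1 h2]].
      rewrite uS /= expr0 invr1 !subrr mulr0 normr0 mulr1; split=> //.
      rewrite addrC addKr normrM normfV ler_pdivrMr//; apply: ltW.
      by have -> : rho / 4 * `|tau| = `|tau| * rho / 4 by ring.
    have h1' : `|u n.+1 - t0| <= rho / 2 * (1 - 2 ^- n.+1).
      have -> : u n.+1 - t0 = (u n.+1 - u n) + (u n - t0) by ring.
      apply: le_trans (ler_normD _ _) _; apply: le_trans (lerD h2 h1) _.
      by rewrite le_eqVlt; apply/orP; left; apply/eqP; rewrite exprS; field; rewrite expf_neq0.
    have hn n' : rho / 2 * (1 - 2 ^- n') <= rho.
      rewrite -[leRHS]mulr1 -mulrA ler_pM2l// ler_pdivrMl//.
      by rewrite mulr1 lerBlDr -[leLHS]addr0 lerD ?ler1n ?invr_ge0 ?exprn_ge0.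
    split=> //; rewrite [u n.+2]uS.
    have -> : u n.+1 + (y - T (u n.+1)) / tau - u n.+1 =
       - ((T (u n.+1) - T (u n) - tau * (u n.+1 - u n)) / tau).
      by rewrite [in tau * _]uS; field.
    rewrite normrN normrM normfV ler_pdivrMr//.
    apply: le_trans (aff _ _ (le_trans h1 (hn n)) (le_trans h1' (hn n.+1))) _.
    have -> : rho / 4 / 2 ^+ n.+1 * `|tau| = `|tau| / 2 * (rho / 4 / 2 ^+ n).
      by rewrite exprS; field; rewrite expf_neq0.
    by rewrite ler_wpM2l.
  have [|l Hl] := compK (B := rho / 4) (u := u); first by move=> n; case: (inv n).
  have hl : `|l - t0| <= rho / 2.
    have := Hl 0%N; rewrite /= expr0 divr1 distrC.
    by have -> : 2 * (rho / 4) = rho / 2 by field.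
  exists l; split=> //; apply/eqP; rewrite -subr_eq0 -normr_le0.
  apply: (@le_geometric K archK _ _ (2 * `|tau| * (2 * (rho / 4)) + `|tau| * (rho / 4)));
    rewrite ?normr_real ?real0//.
    by rewrite addr_ge0 ?mulr_ge0 ?invr_ge0// ltW.
  move=> n; exists n => //; rewrite add0r.
  have [h1 h2] := inv n.
  have hr : rho / 2 <= rho by rewrite ler_pdivrMr// ler_pMr// ler1n.
  have hn : `|u n - t0| <= rho.
    apply: le_trans h1 _; apply: le_trans hr.
    by rewrite ler_piMr ?(ltW r2)// lerBlDr lerDl invr_ge0 exprn_ge0.
  have -> : T l - y = (T l - T (u n)) - (y - T (u n)) by ring.
  apply: le_trans (ler_normB _ _) _; rewrite [leRHS]mulrDl; apply: lerD.
    apply: le_trans (up _ _ hn (le_trans hl hr)) _; rewrite -[leRHS]mulrA distrC.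
    by rewrite ler_wpM2l ?mulr_ge0//; exact: Hl.
  have -> : y - T (u n) = tau * (u n.+1 - u n) by rewrite uS; field.
  by rewrite normrM -mulrA ler_wpM2l.
have hr : rho / 2 < rho by rewrite ltr_pdivrMr// ltr_pMr// ltr1n.
have ST t : U t -> S (T t) = t.
  move=> [ht Vt]; have [h1 h2] := HS _ Vt.
  apply/eqP; rewrite -subr_eq0 -normr_le0.
  apply: le_trans (lip _ _ (ltW ht) (le_trans h1 (ltW hr))) _.
  by rewrite h2 subrr normr0 mulr0.
have US y : V y -> U (S y).
  move=> Vy; have [h1 h2] := HS _ Vy; split; last by rewrite h2.
  exact: le_lt_trans hr.
exists U, V, S; split.
- rewrite openE => t [ht Vt]; apply: filterI.
    exact: (open_nbhs_nbhs (conj (@open_ball_norm t0 rho) ht)).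
  have := is_derive_continuous (dTr t (ltW ht)); apply.
  exact: (open_nbhs_nbhs (conj (@open_ball_norm _ _) Vt)).
- exact: open_ball_norm.
- split; first by rewrite subrr normr0.
  by rewrite /V/= subrr normr0 divr_gt0 ?mulr_gt0.
- move=> t [ht _]; apply: lt_le_trans d3d; apply: lt_le_trans d4d3.
  exact: lt_trans rhod.
split=> [t Ut|y Vy]; first by split; [case: Ut|exact: ST].
have [h1 h2] := HS y Vy; split=> //; first exact: US.
have hS := le_trans h1 (ltW hr).
have T1n : T1 (S y) != 0 by rewrite -normr_gt0; apply: lt_le_trans (T10 _ hS); rewrite divr_gt0.
apply/is_derive1P => e e0.
(* The error is enlarged by 2 / |tau| when increments of [S] are replaced by those of [y], and again
   by 2 / |tau| on dividing by [T1 (S y)]; the factor |tau|^2 / 4 compensates for both. *)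
have e'0 : 0 < e * `|tau| ^+ 2 / 4 by rewrite divr_gt0// mulr_gt0// exprn_gt0.
have /is_derive1P/(_ _ e'0)/near0_normP[d5 d50 Hd5] := dTr _ hS.
have Vy' := open_nbhs_nbhs (conj (@open_ball_norm _ _) Vy).
have d6 : 0 < `|tau| / 2 * d5 by rewrite mulr_gt0 ?divr_gt0.
have near6 : \forall y' \near y, `|y' - y| < `|tau| / 2 * d5.
  by apply/near0_normP; exists (`|tau| / 2 * d5).
near=> y'.
have Vy1 : V y' by near: y'; exact: Vy'.
have [g1 g2] := HS _ Vy1; have gS := le_trans g1 (ltW hr).
have L := lip _ _ hS gS; rewrite g2 h2 in L.
have small : `|S y' - S y| < d5.
  apply: le_lt_trans L _.
  have : `|y' - y| < `|tau| / 2 * d5 by near: y'; exact: near6.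
  rewrite -(ltr_pM2l (_ : 0 < 2 / `|tau|)) ?divr_gt0//.
  by have -> : 2 / `|tau| * (`|tau| / 2 * d5) = d5 by field; rewrite gt_eqF.
have := Hd5 _ small; rewrite g2 h2 => H.
have -> : S y' - S y - (T1 (S y))^-1 * (y' - y) =
  - ((y' - y - T1 (S y) * (S y' - S y)) / T1 (S y)) by field.
rewrite normrN normrM normfV ler_pdivrMr ?normr_gt0//.
apply: le_trans H _.
apply: le_trans (_ : e * `|tau| ^+ 2 / 4 * (2 / `|tau| * `|y' - y|) <= _).
  by rewrite ler_wpM2l// ltW.
have -> : e * `|tau| ^+ 2 / 4 * (2 / `|tau| * `|y' - y|) = e * `|y' - y| * (`|tau| / 2).
  by field; rewrite gt_eqF.
by rewrite ler_wpM2l ?T10// mulr_ge0// ltW.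
Unshelve. all: by end_near. Qed.

End InverseFunction.

(** * Symmetry of second derivatives *)

Section Schwarz.
Variable K : numFieldType.
Hypothesis archK : archimedean_field K.
Hypothesis compK : geometrically_complete K.
Variable V : normedModType K.

Lemma differentiable_eps (g : V -> K) (p : V) (e : K) : differentiable g p -> 0 < e ->
  exists2 d, 0 < d & forall x, `|x| < d -> `|g (p + x) - g p - 'd g p x| <= e * `|x|.
Proof.
move=> /diff_locallyP[_ /eqaddoP H] e0.
have /nbhs_normP[d /= d0 Hd] := H e e0; exists d => // x hx.
have := Hd x; rewrite /= sub0r normrN => /(_ hx).
by rewrite [p + x]addrC !fctE /= opprD addrA.
Qed.

(** With [s] fixed, the second difference is an increment in [u] of f(p + u v + s w) - f(p + u v).
    The derivative of this function is a difference of values of ['D_v f], which differentiability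
    at the single point [p] keeps close to s D_w D_v f. *)
Lemma second_difference (f : V -> K) (p v w : V) :
  (\forall q \near p, differentiable f q) -> differentiable ('D_v f) p ->
  forall e, 0 < e -> exists2 d, 0 < d & forall s : K, `|s| < d ->
    `|f (p + s *: v + s *: w) - f (p + s *: v) - f (p + s *: w) + f p
      - s ^+ 2 * 'D_w ('D_v f) p| <= e * `|s| ^+ 2.
Proof.
move=> /nbhs_normP[d0 /= d00 Hf] dg e e0.
(* The displacements u v + s w and u v with |u| <= |s| have norms adding up to at most (2 |v| + |w|)
   |s|; the 1 keeps [C] positive when both vectors vanish. *)
pose C := 2 * `|v| + `|w| + 1.
have C0 : 0 < C by rewrite ltr_pwDr// addr_ge0// mulr_ge0.
have eC : 0 < e / C by rewrite divr_gt0.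
have [d1 d10 Hd1] := differentiable_eps dg eC.
have [d [d_0 dd0 dd1]] := pos_lower_bound d00 d10.
exists (d / C); first by rewrite divr_gt0.
move=> s; rewrite ltr_pdivlMr// => sC.
have bnd u : `|u| <= `|s| -> `|u *: v| < d /\ `|u *: v + s *: w| < d.
  move=> us; split.
    rewrite normrZ; apply: le_lt_trans sC.
    apply: ler_pM => //; rewrite /C -addrA mulr_natl mulr2n -addrA lerDl.
    by rewrite !addr_ge0.
  apply: le_lt_trans (ler_normD _ _) _; rewrite !normrZ; apply: le_lt_trans sC.
  apply: le_trans (lerD (ler_wpM2r (normr_ge0 v) us) (lexx _)) _.
  rewrite -mulrDr ler_wpM2l// /C mulr_natl mulr2n -!addrA lerD2l.
  rewrite addrCA lerDl.
  by rewrite !addr_ge0.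
have ballf x : `|x| < d -> differentiable f (p + x).
  move=> hx; apply: Hf => /=; rewrite opprD addrA subrr sub0r normrN.
  exact: lt_le_trans dd0.
have phi' u : `|u - 0| <= `|s| -> is_derive u (1 : K)
   (fun u : K => f (p + u *: v + s *: w) - f (p + u *: v))
   ('D_v f (p + u *: v + s *: w) - 'D_v f (p + u *: v)).
  rewrite subr0 => us; have [b1 b2] := bnd u us.
  have line q : differentiable f (q + u *: v) ->
      is_derive u (1 : K) (fun u : K => f (q + u *: v)) ('D_v f (q + u *: v)).
    move=> df; apply/is_derive_lineP.
    have -> : (fun h : K => f (q + (u + h *: (1 : K)) *: v)) =
      (fun h => f ((q + u *: v) + h *: v)).
      by apply/funext => h; rewrite scalerDl addrA [h *: 1]mulr1.
    apply/(is_derive_lineP f (q + u *: v) v).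
    by apply: derivableP; exact: diff_derivable.
  apply: is_deriveB; last by apply: line; exact: ballf.
  have -> : (fun u : K => f (p + u *: v + s *: w)) = (fun u => f ((p + s *: w) + u *: v)).
    by apply/funext => u'; rewrite addrAC.
  rewrite addrAC; apply: line; rewrite addrAC -addrA; exact: ballf.
have := @mean_value_affine K archK compK _ _ (s * 'D_w ('D_v f) p) 0 `|s| (e * `|s|) _ _ phi'.
rewrite mulr_ge0 ?(ltW e0)// => /(_ isT (normr_ge0 s)) H.
have := H _ 0 s; rewrite subrr subr0 normr0 lexx => {}H.
have -> : f (p + s *: v + s *: w) - f (p + s *: v) - f (p + s *: w) + f p
      - s ^+ 2 * 'D_w ('D_v f) p =
  f (p + s *: v + s *: w) - f (p + s *: v) - (f (p + 0 *: v + s *: w) - f (p + 0 *: v))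
  - s * 'D_w ('D_v f) p * (s - 0).
  by rewrite scale0r addr0; ring.
rewrite expr2 mulrA; have -> : e * `|s| * `|s| = e * `|s| * `|s - 0| by rewrite subr0.
rewrite subr0; apply: H => // u; rewrite subr0 => us; have [b1 b2] := bnd u us.
have h1 := Hd1 _ (lt_le_trans b1 dd1).
have h2 := Hd1 _ (lt_le_trans b2 dd1).
have -> : 'D_v f (p + u *: v + s *: w) - 'D_v f (p + u *: v) - s * 'D_w ('D_v f) p =
  ('D_v f (p + (u *: v + s *: w)) - 'D_v f p - 'd ('D_v f) p (u *: v + s *: w))
  - ('D_v f (p + u *: v) - 'D_v f p - 'd ('D_v f) p (u *: v)).
  rewrite linearD/=.
  have -> : 'd ('D_v f) p (s *: w) = s * 'D_w ('D_v f) p by rewrite linearZ/= -deriveE.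
  rewrite (addrA p); move: (s * _) ('d _ _ _) ('D_v f p) ('D_v f (p + u *: v)) => *; ring.
apply: le_trans (ler_normB _ _) _; apply: le_trans (lerD h2 h1) _.
rewrite -mulrDr -mulrA ler_pM2l// ler_pdivrMl//.
apply: le_trans (_ : (2 * `|v| + `|w|) * `|s| <= _); last first.
  by rewrite ler_wpM2r// /C lerDl.
apply: le_trans (lerD (ler_normD _ _) (lexx _)) _; rewrite !normrZ.
have hu := ler_wpM2r (normr_ge0 v) us.
apply: le_trans (lerD (lerD hu (lexx _)) hu) _.
by rewrite le_eqVlt; apply/orP; left; apply/eqP; ring.
Qed.

(** The second difference is symmetric in [v] and [w], so both mixed derivatives approximate the
    same quantity divided by s^2. *)
Lemma derive_commute (f : V -> K) (p v w : V) :
  (\forall q \near p, differentiable f q) ->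
  differentiable ('D_v f) p -> differentiable ('D_w f) p ->
  'D_v ('D_w f) p = 'D_w ('D_v f) p.
Proof.
move=> df dv dw; apply/eqP; rewrite -subr_eq0 -normr_le0.
apply: (@le_geometric K archK _ _ 2); rewrite ?normr_real ?real0//.
move=> n; exists n => //; rewrite add0r.
have e0 : 0 < 2 ^- n :> K by rewrite invr_gt0 exprn_gt0.
have [d1 d10 H1] := second_difference w df dv e0.
have [d2 d20 H2] := second_difference v df dw e0.
have [d3 [d30 d31 d32]] := pos_lower_bound d10 d20.
pose s : K := d3 / 2; have s0 : 0 < s by rewrite divr_gt0.
have sd : `|s| < d3 by rewrite gtr0_norm// /s ltr_pdivrMr// ltr_pMr// ltr1n.
have {}H1 := H1 _ (lt_le_trans sd d31); have {}H2 := H2 _ (lt_le_trans sd d32).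
have s2 : 0 < `|s| ^+ 2 by rewrite exprn_gt0// normr_gt0 gt_eqF.
rewrite -(ler_pM2l s2) -normrX -normrM.
have -> : s ^+ 2 * ('D_v ('D_w f) p - 'D_w ('D_v f) p) =
  (f (p + s *: v + s *: w) - f (p + s *: v) - f (p + s *: w) + f p
      - s ^+ 2 * 'D_w ('D_v f) p) -
  (f (p + s *: w + s *: v) - f (p + s *: w) - f (p + s *: v) + f p
      - s ^+ 2 * 'D_v ('D_w f) p).
  rewrite [p + s *: w + s *: v]addrAC.
  move: (f (p + s *: v + s *: w)) (f (p + s *: v)) (f (p + s *: w)) (f p).
  by move: ('D_v ('D_w f) p) ('D_w ('D_v f) p) => *; ring.
apply: le_trans (ler_normB _ _) _; apply: le_trans (lerD H1 H2) _.
by rewrite normrX le_eqVlt; apply/orP; left; apply/eqP; ring.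
Qed.

End Schwarz.

(** * Smooth functions *)

Section SmoothCalculus.
Variable K : numFieldType.

Section Differentiable.
Variables (V W : normedModType K).

Lemma near_eq_differentiable (f g : V -> W) (p : V) :
  (\forall q \near p, f q = g q) -> differentiable f p -> differentiable g p.
Proof.
move=> fg df; have [cf /eqaddoP Hf] := (diff_locallyP p f).1 df.
have fgp : f p = g p by exact: (nbhs_singleton fg).
have Hg : g \o shift p = cst (g p) + 'd f p +o_ 0 id.
  apply/eqaddoP => e e0; have {}Hf := Hf e e0.
  have fg0 : \forall x \near 0, f (x + p) = g (x + p).
    by have := fg; rewrite (near_shift 0 p) subr0.
  near=> x.
  have : `|(f \o shift p - (cst (f p) + 'd f p)) x| <= e * `|id x| by near: x.
  rewrite !fctE /= fgp.
  by have -> : f (x + p) = g (x + p) by near: x.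
apply/diff_locallyP; have -> : 'd g p = 'd f p :> (V -> W) by exact: diff_unique.
by split.
Unshelve. all: by end_near. Qed.

(** Smoothness graded by order: the Leibniz and chain rules close under induction on [n], and
    solutions of differential equations gain one order at a time. *)
Fixpoint diff_times (n : nat) (U : set V) (f : V -> W) : Prop :=
  (forall p, U p -> differentiable f p) /\
  if n is n'.+1 then forall v, diff_times n' U ('D_v f) else True.

Lemma diff_times_differentiable n U f :
  diff_times n U f -> forall p, U p -> differentiable f p.
Proof. by case: n => [|n] []. Qed.

Lemma smooth_onP U f : smooth_on U f <-> forall n, diff_times n U f.
Proof.
split=> [sf n|sf vs].
  elim: n f sf => [|n IH] f sf; split=> //; try exact: (sf [::]).
  by move=> v; apply: IH => vs p Up; have := sf (rcons vs v) p Up; rewrite foldr_rcons.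
elim/last_ind: vs f sf => [|vs v IH] f sf p Up /=.
  exact: (diff_times_differentiable (sf 0%N)).
rewrite foldr_rcons; apply: IH => // n.
by have [_] := sf n.+1; apply.
Qed.

Lemma smooth_diff_times (U : set V) (f : V -> W) n : smooth_on U f -> diff_times n U f.
Proof. by move/smooth_onP; apply. Qed.

Lemma smooth_derive (U : set V) (f : V -> W) (v : V) : smooth_on U f -> smooth_on U ('D_v f).
Proof. by move=> /smooth_onP sf; apply/smooth_onP => n; have [_] := sf n.+1; apply. Qed.

Lemma diff_timesW n U f : diff_times n.+1 U f -> diff_times n U f.
Proof.
elim: n f => [|n IH] f [df Df]; first by split.
by split=> // v; apply: IH.
Qed.

Lemma diff_times_sub n (U U' : set V) f : U' `<=` U -> diff_times n U f -> diff_times n U' f.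
Proof.
move=> sU; elim: n f => [|n IH] f [df Df]; first by split=> // p /sU; exact: df.
by split=> [p /sU|v]; [exact: df|apply: IH (Df v)].
Qed.

Lemma diff_times_congr n (U : set V) f g : open U -> (forall p, U p -> f p = g p) ->
  diff_times n U f -> diff_times n U g.
Proof.
move=> oU; elim: n f g => [|n IH] f g fg [df Df].
  split=> // p Up; apply: near_eq_differentiable (df p Up).
  by apply: filterS (open_nbhs_nbhs (conj oU Up)) => q /fg.
split=> [p Up|v].
  apply: near_eq_differentiable (df p Up).
  by apply: filterS (open_nbhs_nbhs (conj oU Up)) => q /fg.
apply: IH (Df v) => p Up; apply: near_eq_derive.
by apply: filterS (open_nbhs_nbhs (conj oU Up)) => q /fg.
Qed.

Lemma diff_times_cst n U (c : W) : diff_times n U (fun=> c).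
Proof.
elim: n c => [|n IH] c; split=> // v.
have -> : 'D_v (fun=> c) = (fun=> 0) by apply/funext => p; rewrite derive_cst.
exact: IH.
Qed.

Lemma diff_times_linear n U (L : {linear V -> W}) : continuous L -> diff_times n U L.
Proof.
move=> cL; have dL p : differentiable L p by exact: linear_differentiable.
case: n => [|n]; first by split.
split=> // v.
have -> : 'D_v L = (fun=> L v).
  by apply/funext => p; rewrite deriveE ?diff_lin//; exact: linear_differentiable.
exact: diff_times_cst.
Qed.

Lemma diff_timesD n U f g : open U -> diff_times n U f -> diff_times n U g ->
  diff_times n U (fun p => f p + g p).
Proof.
move=> oU; elim: n f g => [|n IH] f g [df Df] [dg Dg].
  by split=> // p Up; apply: differentiableD; [exact: df|exact: dg].
split=> [p Up|v]; first by apply: differentiableD; [exact: df|exact: dg].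
apply: (@diff_times_congr n U (fun p => 'D_v f p + 'D_v g p)) => //; last first.
  by apply: IH; [exact: Df|exact: Dg].
by move=> p Up; rewrite deriveD//; apply: diff_derivable; first [exact: df|exact: dg].
Qed.

Lemma diff_times_sum n U (I : Type) (r : seq I) (f : I -> V -> W) : open U ->
  (forall i, diff_times n U (f i)) -> diff_times n U (fun p => \sum_(i <- r) f i p).
Proof.
move=> oU Hf; elim: r => [|i r IH].
  have -> : (fun p => \sum_(i <- [::]) f i p) = (fun=> 0).
    by apply/funext => t; rewrite big_nil.
  exact: diff_times_cst.
have -> : (fun p => \sum_(j <- i :: r) f j p) = (fun p => f i p + \sum_(j <- r) f j p).
  by apply/funext => t; rewrite big_cons.
exact: diff_timesD.
Qed.

End Differentiable.

Lemma derive_linear_comp (V W W' : normedModType K) (L : {linear W -> W'}) (f : V -> W)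
    (p v : V) : continuous L -> differentiable f p ->
  differentiable (fun q => L (f q)) p /\ 'D_v (fun q => L (f q)) p = L ('D_v f p).
Proof.
move=> cL df; have dL q : differentiable L q by exact: linear_differentiable.
have dLf : differentiable (fun q => L (f q)) p by exact: (@differentiable_comp _ _ _ _ f L).
by split=> //; rewrite !deriveE// (@diff_comp _ _ _ _ f L)//= diff_lin.
Qed.

Lemma diff_times_linl n (V W W' : normedModType K) (U : set V) (L : {linear W -> W'})
  (f : V -> W) : open U -> continuous L ->
  diff_times n U f -> diff_times n U (fun p => L (f p)).
Proof.
move=> oU cL; elim: n f => [|n IH] f [df Df].
  by split=> // p Up; have [] := derive_linear_comp 0 cL (df p Up).
split=> [p Up|v]; first by have [] := derive_linear_comp 0 cL (df p Up).
apply: (@diff_times_congr _ _ n U (fun p => L ('D_v f p))) => //; last first.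
  by apply: IH; exact: Df.
by move=> p Up; have [_ ->] := derive_linear_comp v cL (df p Up).
Qed.

Lemma diff_timesM n (V : normedModType K) (U : set V) (f g : V -> K) : open U ->
  diff_times n U f -> diff_times n U g -> diff_times n U (fun p => f p * g p).
Proof.
move=> oU; elim: n f g => [|n IH] f g Df Dg.
  split=> // p Up; apply: differentiableM.
    exact: (diff_times_differentiable Df).
  exact: (diff_times_differentiable Dg).
have [df {}Df'] := Df; have [dg {}Dg'] := Dg.
split=> [p Up|v]; first by apply: differentiableM; [exact: df|exact: dg].
apply: (@diff_times_congr _ _ n U (fun p => f p * 'D_v g p + g p * 'D_v f p)) => //.
  by move=> p Up; rewrite deriveM//; apply: diff_derivable; first [exact: df|exact: dg].
by apply: diff_timesD => //; apply: IH => //; first [exact: Df'|exact: Dg'|exact: diff_timesW].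
Qed.

Lemma diff_times_comp n (V : normedModType K) (U : set V) (U' : set K)
  (g : K -> K) (f : V -> K) : open U -> (forall p, U p -> U' (f p)) ->
  diff_times n U' g -> diff_times n U f -> diff_times n U (fun p => g (f p)).
Proof.
move=> oU UU'; elim: n g => [|n IH] g Dg Df.
  split=> // p Up; apply: differentiable_comp.
    exact: (diff_times_differentiable Df).
  by apply: (diff_times_differentiable Dg); exact: (UU' p Up).
have [df {}Df'] := Df; have [dg {}Dg'] := Dg.
split=> [p Up|v].
  by apply: differentiable_comp; [exact: df|exact: (dg _ (UU' p Up))].
apply: (@diff_times_congr _ _ n U (fun p => 'D_v f p * 'D_1 g (f p))) => //.
  move=> p Up; have h1 : is_derive (f p) (1 : K) g ('D_1 g (f p)).
    by apply: derivableP; apply/derivable1_diffP; exact: (dg _ (UU' p Up)).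
  have h2 : is_derive p v f ('D_v f p).
    by apply: derivableP; apply: diff_derivable; exact: df.
  by have [_ ->] := is_derive1_chain h1 h2.
apply: diff_timesM => //; first exact: Df'.
by apply: (IH ('D_1 g)); [exact: Dg'|exact: diff_timesW].
Qed.

(** Serves the projection of jets to the (t, x)-space and the slices with [x] fixed. *)
Lemma diff_times_affine n (V W Z : normedModType K) (U : set V) (U' : set W)
  (L : {linear V -> W}) (a : W) (f : W -> Z) : open U -> continuous L ->
  (forall p, U p -> U' (a + L p)) -> diff_times n U' f ->
  diff_times n U (fun p => f (a + L p)).
Proof.
move=> oU cL UU'.
have dA q : is_diff q (fun p => a + L p) L.
  have dL : is_diff q L L.
    apply: DiffDef; first exact: linear_differentiable.
    by rewrite diff_lin.
  have := @is_diffD _ _ _ (cst a) L 0 L q _ dL.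
  by rewrite add0r; apply.
have dcomp g p : U p -> differentiable g (a + L p) ->
    differentiable (fun p => g (a + L p)) p.
  by move=> Up dg; apply: (@differentiable_comp _ _ _ _ (fun p => a + L p) g).
elim: n f => [|n IH] f Df.
  by split=> // p Up; apply: dcomp => //; apply: (diff_times_differentiable Df); exact: (UU' p Up).
have [df {}Df'] := Df.
split=> [p Up|v]; first by apply: dcomp => //; exact: (df _ (UU' p Up)).
apply: (@diff_times_congr _ _ n U (fun p => 'D_(L v) f (a + L p))) => //; last by apply: (IH ('D_(L v) f)); exact: Df'.
move=> p Up; have dfp := df _ (UU' p Up).
have dcp := dcomp _ f p Up dfp; rewrite !deriveE//.
rewrite (@diff_comp _ _ _ _ (fun p => a + L p) f)//=.
by rewrite (@diff_val _ _ _ _ _ _ _ (dA p)).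
Qed.

Lemma diff_times_inv_id n : diff_times n [set s : K | s != 0] (fun s => s^-1).
Proof.
have dV (s : K) : s != 0 -> differentiable (fun s : K => s^-1) s.
  by move=> s0; apply: differentiableV.
have oU : open [set s : K | s != 0].
  rewrite openE => s /= s0; apply/near0_normP; exists `|s|; first by rewrite normr_gt0.
  by move=> t; apply: contraTneq => ->; rewrite sub0r normrN ltxx.
elim: n => [|n IH]; first by split=> // p; exact: dV.
split=> [p|v]; first exact: dV.
apply: (@diff_times_congr K K n _ (fun s : K => - v * (s^-1 * s^-1))) => //.
  move=> s /= s0; rewrite deriveV// derive_id -exprVn expr2.
  by rewrite /GRing.scale/= mulNr mulNr mulrC.
apply: diff_timesM => //; first exact: diff_times_cst.
exact: diff_timesM.
Qed.

Lemma diff_timesV n (V : normedModType K) (U : set V) (f : V -> K) : open U ->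
  (forall p, U p -> f p != 0) -> diff_times n U f ->
  diff_times n U (fun p => (f p)^-1).
Proof. by move=> oU f0; apply: diff_times_comp (@diff_times_inv_id n). Qed.

Lemma is_derive_div (V : normedModType K) (f g : V -> K) (p v : V) (a b : K) :
  is_derive p v f a -> is_derive p v g b -> g p != 0 ->
  is_derive p v (fun q => f q / g q) ((a - f p * b / g p) / g p).
Proof.
move=> df dg g0.
have dV : is_derive p v (fun q => (g q)^-1) (- (g p) ^- 2 * b).
  have [dg1 <-] := dg.
  have := deriveV g0 dg1; rewrite /GRing.scale/= => <-.
  by apply: derivableP; exact: derivableV.
have := is_deriveM df dV; congr (is_derive _ _ _ _).
by rewrite /GRing.scale/=; field.
Qed.

(** If the right-hand side of an equation is as smooth as its solution, each order of
    differentiability of the solution yields the next. Families are allowed because systems must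
    gain the order jointly. *)
Lemma smooth_bootstrap (I : Type) (U : set K) (y y' : I -> K -> K) : open U ->
  (forall i t, U t -> is_derive t 1 (y i) (y' i t)) ->
  (forall n, (forall i, diff_times n U (y i)) -> forall i, diff_times n U (y' i)) ->
  forall i, smooth_on U (y i).
Proof.
move=> oU dy H i; apply/smooth_onP => n.
have df j t : U t -> differentiable (y j) t.
  by move=> Ut; apply/derivable1_diffP; case: (dy j t Ut).
elim: n i => [|n IH] i; first by split=> // t; exact: df.
split=> [t|v]; first exact: df.
apply: (@diff_times_congr _ _ n U (fun t => v * y' i t)) => //.
  move=> t Ut; rewrite deriveE; last exact: df.
  rewrite -[v in 'd _ _ v]mulr1 -[v * 1]/(v *: (1 : K)) linearZ/= -deriveE; last exact: df.
  by rewrite (@derive_val _ _ _ _ _ _ _ (dy i t Ut)).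
apply: diff_timesM => //; first exact: diff_times_cst.
exact: H.
Qed.

End SmoothCalculus.

(** * Jets and prolongations *)

Section Jets.
Variable K : numFieldType.

Section LinearMaps.
Variables V W : normedModType K.

Definition linear_map (f : V -> W) (lf : linear f) : {linear V -> W} :=
  HB.pack f (GRing.isLinear.Build K V W _ f lf).

Lemma is_derive_linear (f : V -> W) (lf : linear f) (p v : V) :
  continuous f -> is_derive p v f (f v).
Proof.
move=> cf; have df : differentiable (linear_map lf) p by exact: linear_differentiable.
have := is_derive_diff v df; rewrite diff_lin//.
Qed.

Lemma diff_times_linear_fun n U (f : V -> W) : linear f -> continuous f -> diff_times n U f.
Proof. by move=> lf cf; exact: (@diff_times_linear K V W n U (linear_map lf)). Qed.

End LinearMaps.

Lemma fst_linear_continuous (V W : normedModType K) :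
  linear (@fst V W) /\ continuous (@fst V W).
Proof. by split=> [//|p]; exact: cvg_fst. Qed.

Lemma snd_linear_continuous (V W : normedModType K) :
  linear (@snd V W) /\ continuous (@snd V W).
Proof. by split=> [//|p]; exact: cvg_snd. Qed.

Lemma derive_affine_line (V W : normedModType K) (f : V -> W) (p v : V) (z : W) :
  (forall h : K, f (p + h *: v) = f p + h *: z) -> 'D_v f p = z.
Proof.
move=> line; apply: cvg_lim => //.
apply/cvgrPdist_le => e e0; apply/nbhs_normP; exists 1 => //= h _ h0.
by rewrite [h *: v + p]addrC line [f p + _]addrC addrK scalerA mulVf ?scale1r// subrr normr0 ltW.
Qed.

Lemma derive_fst_comp (V W Z : normedModType K) (f : Z -> V * W) (p v : Z) :
  differentiable f p -> ('D_v f p).1 = 'D_v (fun q => (f q).1) p.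
Proof.
have [lf cf] := fst_linear_continuous V W => df.
by have [_ ->] := derive_linear_comp (L := linear_map lf) v cf df.
Qed.

Lemma derive_snd_comp (V W Z : normedModType K) (f : Z -> V * W) (p v : Z) :
  differentiable f p -> ('D_v f p).2 = 'D_v (fun q => (f q).2) p.
Proof.
have [lf cf] := snd_linear_continuous V W => df.
by have [_ ->] := derive_linear_comp (L := linear_map lf) v cf df.
Qed.

Variable r : nat.
Implicit Types j v : jet K r.

Lemma jx_linear k : linear (fun j => jx j k).
Proof. by move=> a i j; rewrite /jx/= !mxE. Qed.

Lemma jx_continuous k : continuous (fun j => jx j k).
Proof.
move=> j; rewrite /jx.
apply: (@continuous_comp _ _ _ snd (fun M : 'rV[K]_r.+1 => M ord0 (inord k))).
  by have [_] := @snd_linear_continuous K 'rV[K]_r.+1; apply.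
exact: coord_continuous.
Qed.

Lemma base_linear : linear (@base K r).
Proof. by move=> a i j; rewrite /base; congr (_, _); rewrite jx_linear. Qed.

Lemma base_continuous : continuous (@base K r).
Proof.
move=> j; have [_ cf] := @fst_linear_continuous K 'rV[K]_r.+1.
exact: (cvg_pair (cf j) (@jx_continuous 0 j)).
Qed.

Lemma open_base_preimage (Om : set (K * K)) : open Om -> open [set j | Om (@base K r j)].
Proof. by move=> oOm; apply: open_comp => // j _; exact: base_continuous. Qed.

Lemma is_derive_jx j v k : is_derive j v (fun i => jx i k) (jx v k).
Proof. exact: is_derive_linear (@jx_linear k) _ _ (@jx_continuous k). Qed.

Lemma is_derive_fst (V W : normedModType K) (p v : V * W) : is_derive p v fst v.1.
Proof.
by have [lf cf] := @fst_linear_continuous V W; exact: is_derive_linear lf _ _ cf.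
Qed.

Lemma is_derive_of_fst (W : normedModType K) (A : K -> K) (a : K) (p v : K * W) :
  is_derive p.1 1 A a -> is_derive p v (fun q : K * W => A q.1) (v.1 * a).
Proof. by move=> dA; exact: is_derive1_chain dA (is_derive_fst p v). Qed.

Definition total_direction j : jet K r :=
  (1, \row_(k < r.+1) (if (k < r)%N then jx j k.+1 else 0)).

Lemma jx_total_direction j k : (k <= r)%N ->
  jx (total_direction j) k = if (k < r)%N then jx j k.+1 else 0.
Proof. by move=> kr; rewrite /jx/= mxE inordK. Qed.

Lemma prolong_xS F k j :
  prolong_x F k.+1 j = total_derivative (prolong_x F k) j / @DtT K r F j.
Proof. by []. Qed.

End Jets.

(** * Prolongation of maps affine in x *)

Section AffineProlongation.
Variable K : numFieldType.

(* For [F (t, x) = (T t, X1 t * (x + phi t))] with [T1 = T'], the [k]-th prolongation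
   is [\sum_m prolong_coef T1 X1 k m t * (x_m + phi^(m) t)]. *)
Fixpoint prolong_coef (T1 X1 : K -> K) (k m : nat) : K -> K :=
  if k is k'.+1 then fun t =>
    ('D_1 (prolong_coef T1 X1 k' m) t +
     (if m is m'.+1 then prolong_coef T1 X1 k' m' t else 0)) / T1 t
  else if m is 0 then X1 else fun=> 0.

Variables (U : set K) (T T1 X1 : K -> K).
Hypothesis oU : open U.
Hypothesis dT : forall t, U t -> is_derive t 1 T (T1 t).
Hypothesis T1_neq0 : forall t, U t -> T1 t != 0.
Hypothesis smooth_T1 : smooth_on U T1.
Hypothesis smooth_X1 : smooth_on U X1.
Local Notation c := (prolong_coef T1 X1).

Lemma smooth_prolong_coef k m : smooth_on U (c k m).
Proof.
elim: k m => [|k IH] [|m] //=; try by apply/smooth_onP => n; exact: diff_times_cst.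
  apply/smooth_onP => n; apply: diff_timesM => //.
    apply: diff_timesD => //; last exact: diff_times_cst.
    exact: smooth_diff_times (smooth_derive _ (IH 0%N)).
  by apply: diff_timesV => //; exact: smooth_diff_times.
apply/smooth_onP => n; apply: diff_timesM => //.
  apply: diff_timesD => //; last exact: smooth_diff_times.
  exact: smooth_diff_times (smooth_derive _ (IH m.+1)).
by apply: diff_timesV => //; exact: smooth_diff_times.
Qed.

Lemma smooth_is_derive1 (f : K -> K) t : smooth_on U f -> U t -> is_derive t 1 f ('D_1 f t).
Proof. by move=> sf Ut; apply: derivableP; apply/derivable1_diffP; exact: (sf [::]). Qed.

Lemma prolong_coef_gt k m : (k < m)%N -> c k m = fun=> 0.
Proof.
elim: k m => [|k IH] [|m]//= km.
by apply/funext => t; rewrite IH 1?ltnW// IH// derive_cst addr0 mul0r.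
Qed.

Lemma prolong_coef_diag k t : c k k t = X1 t / T1 t ^+ k.
Proof.
elim: k t => [|k IH] t /=; first by rewrite expr0 divr1.
by rewrite prolong_coef_gt// derive_cst add0r IH exprSr invfM mulrA.
Qed.

Lemma derive_prolong_coef_diag k t : U t ->
  'D_1 (c k k) t = ('D_1 X1 t - k%:R * X1 t * 'D_1 T1 t / T1 t) / T1 t ^+ k.
Proof.
move=> Ut; have T10 := T1_neq0 Ut.
have dT1 := smooth_is_derive1 smooth_T1 Ut.
elim: k => [|k IH]; first by rewrite /= !mul0r subr0 expr0 divr1.
have dc := smooth_is_derive1 (smooth_prolong_coef k k) Ut.
have -> : c k.+1 k.+1 = (fun s => c k k s / T1 s).
  by apply/funext => s; rewrite !prolong_coef_diag exprSr invfM mulrA.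
have [_ ->] := is_derive_div dc dT1 T10.
by rewrite IH prolong_coef_diag exprS -natr1; field; rewrite expf_neq0// T10.
Qed.

(** Unfolding the recursion adds the derivatives of the diagonal entries X1 / T1^i for i <= k. Each
    contributes X1' - i X1 T1' / T1 over T1^(k+1), and the indices sum to (k + 1) k / 2. *)
Lemma prolong_coef_subdiag k t : U t ->
  c k.+1 k t = (k.+1%:R * 'D_1 X1 t - (k.+1 * k)%:R / 2 * (X1 t * 'D_1 T1 t / T1 t))
               / T1 t ^+ k.+1.
Proof.
move=> Ut; have T10 := T1_neq0 Ut.
elim: k => [|k IH].
  by rewrite /= addr0 muln0 mul0r mul0r subr0 mul1r expr1.
have -> : c k.+2 k.+1 t = ('D_1 (c k.+1 k.+1) t + c k.+1 k t) / T1 t by [].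
rewrite IH derive_prolong_coef_diag// !exprS !natrM -!natr1.
by field; rewrite expf_neq0// T10.
Qed.

Variables (r : nat) (phi : nat -> K -> K).
Hypothesis dphi : forall k t, U t -> is_derive t 1 (phi k) (phi k.+1 t).
Variables (Om : set (K * K)) (F : K * K -> K * K).
Hypothesis oOm : open Om.
Hypothesis OmF : forall q, Om q ->
  U q.1 /\ F q = (T q.1, X1 q.1 * (q.2 + phi 0%N q.1)).

Lemma open_nbhs_base (j : jet K r) : Om (base j) -> \forall i \near j, Om (base i).
Proof. by move=> Oj; exact: (open_nbhs_nbhs (conj (open_base_preimage (r := r) oOm) Oj)). Qed.

Lemma DtT_affine (j : jet K r) : Om (base j) -> DtT F j = T1 j.1.
Proof.
move=> Oj; have [Uj _] := OmF Oj.
rewrite /DtT /total_derivative -/(total_direction j).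
rewrite (@near_eq_derive _ _ _ _ (fun i : jet K r => T i.1)); last first.
  by apply: filterS (open_nbhs_base Oj) => i /OmF[_ ->].
have [_ ->] := is_derive_of_fst (p := j) (total_direction j) (dT Uj).
by rewrite mul1r.
Qed.

Definition affine_jet k (j : jet K r) : K :=
  \sum_(m < r.+1) c k m j.1 * (jx j m + phi m j.1).

Lemma is_derive_affine_jet k (j v : jet K r) : U j.1 ->
  is_derive j v (affine_jet k)
    (\sum_(m < r.+1) (v.1 * 'D_1 (c k m) j.1 * (jx j m + phi m j.1)
                      + c k m j.1 * (jx v m + v.1 * phi m.+1 j.1))).
Proof.
move=> Uj; apply: is_derive_sum_seq => m.
have d1 := is_derive_of_fst (p := j) v (smooth_is_derive1 (smooth_prolong_coef k m) Uj).
have d2 := is_derive_of_fst (p := j) v (dphi m Uj).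
have := is_deriveM d1 (is_deriveD (is_derive_jx j v m) d2).
congr (is_derive _ _ _ _).
by rewrite fctE /GRing.scale/=; ring.
Qed.

(** Stated for every contact vector: the total direction gives the recursion of the prolongation,
    and arbitrary vectors give the contact condition for the lift to the joint space. *)
Lemma derive_affine_jet_contact k (j v : jet K r) : (k < r)%N -> U j.1 ->
  contact_vector j v -> 'D_v (affine_jet k) j = v.1 * (T1 j.1 * affine_jet k.+1 j).
Proof.
move=> kr Uj cv; have [_ ->] := is_derive_affine_jet k v Uj; have T10 := T1_neq0 Uj.
rewrite /affine_jet [in RHS](eq_bigr (fun m : 'I_r.+1 =>
   ('D_1 (c k m) j.1 * (jx j m + phi m j.1) +
    (if nat_of_ord m is m'.+1 then c k m' j.1 else 0) * (jx j m + phi m j.1)) / T1 j.1)); last first.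
  by move=> m _; rewrite /= -mulrDl mulrAC.
rewrite -mulr_suml [T1 _ * (_ / _)]mulrC divfK// !big_split /= mulrDr; congr (_ + _).
  by rewrite mulr_sumr; apply: eq_bigr => m _; rewrite mulrA.
(* The term [m = r], where the contact condition does not determine [jx v r], drops out because
   [c k r = 0] for [k < r]. The remaining terms match after a shift of the index by one. *)
rewrite big_ord_recr [in RHS]big_ord_recl /= mul0r add0r prolong_coef_gt// mul0r addr0.
rewrite mulr_sumr; apply: eq_bigr => m _; rewrite cv// add0n mulrCA; congr (_ * _).
by rewrite mulrDr [v.1 * jx _ _]mulrC.
Qed.

Lemma prolong_x_affine k (j : jet K r) : (k <= r)%N -> Om (base j) ->
  prolong_x F k j = affine_jet k j.
Proof.
elim: k j => [|k IH] j kr Oj.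
  rewrite /affine_jet big_ord_recl big1 ?addr0 => [|m _]; last by rewrite mul0r.
  by rewrite /prolong_x/=; have [_ ->] := OmF Oj.
have [Uj _] := OmF Oj; have T10 := T1_neq0 Uj.
rewrite prolong_xS DtT_affine// /total_derivative -/(total_direction j).
rewrite (@near_eq_derive _ _ _ _ (affine_jet k)); last first.
  by apply: filterS (open_nbhs_base Oj) => i Oi; apply: IH => //; exact: ltnW.
rewrite derive_affine_jet_contact//; first by rewrite mul1r mulrC mulKf.
by move=> m mr; rewrite jx_total_direction ?mr ?mulr1// ltnW.
Qed.

End AffineProlongation.

(** * Smoothness of matrix-valued functions *)

Section SmoothMatrices.
Variable K : numFieldType.

Lemma scale_linear (W : normedModType K) (e : W) :
  linear (fun x : K => x *: e) /\ continuous (fun x : K => x *: e).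
Proof.
split=> [a x y|]; last exact: scalel_continuous.
by rewrite scalerDl scalerA.
Qed.

Variables (V : normedModType K) (U : set V).
Hypothesis oU : open U.

Lemma diff_times_matrix n m p (M : V -> 'M[K]_(m, p)) :
  (forall i j, diff_times n U (fun q => M q i j)) -> diff_times n U M.
Proof.
move=> HM.
have -> : M = (fun q => \sum_i \sum_j M q i j *: delta_mx i j).
  by apply/funext => q; exact: matrix_sum_delta.
apply: diff_times_sum => // i; apply: diff_times_sum => // j.
have [lf cf] := scale_linear (delta_mx i j : 'M[K]_(m, p)).
exact: (diff_times_linl (L := linear_map lf) oU cf).
Qed.

Lemma coord_linear m p i j : linear (fun M : 'M[K]_(m, p) => M i j).
Proof. by move=> a A B; rewrite !mxE. Qed.

Lemma diff_times_coord n m p (M : V -> 'M[K]_(m, p)) i j :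
  diff_times n U M -> diff_times n U (fun q => M q i j).
Proof.
apply: (diff_times_linl (L := linear_map (@coord_linear m p i j)) oU).
exact: coord_continuous.
Qed.

Lemma inl_linear_continuous (W1 W2 : normedModType K) :
  linear (fun x : W1 => (x, 0 : W2)) /\ continuous (fun x : W1 => (x, 0 : W2)).
Proof.
split=> [a x y|x]; first by congr (_, _); rewrite /= scaler0 addr0.
by apply: (cvg_pair (f := id) (g := fun=> 0)); [exact: cvg_id|exact: cvg_cst].
Qed.

Lemma inr_linear_continuous (W1 W2 : normedModType K) :
  linear (fun x : W2 => (0 : W1, x)) /\ continuous (fun x : W2 => (0 : W1, x)).
Proof.
split=> [a x y|x]; first by congr (_, _); rewrite /= scaler0 addr0.
by apply: (cvg_pair (f := fun=> 0) (g := id)); [exact: cvg_cst|exact: cvg_id].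
Qed.

Lemma diff_times_pair n (W1 W2 : normedModType K) (f : V -> W1) (g : V -> W2) :
  diff_times n U f -> diff_times n U g -> diff_times n U (fun q => (f q, g q)).
Proof.
move=> Df Dg; have [l1 c1] := inl_linear_continuous W1 W2.
have [l2 c2] := inr_linear_continuous W1 W2.
have -> : (fun q => (f q, g q)) = (fun q => (f q, 0) + (0, g q)).
  by apply/funext => q; congr (_, _); rewrite ?addr0 ?add0r.
apply: diff_timesD => //.
  exact: (diff_times_linl (L := linear_map l1) oU c1).
exact: (diff_times_linl (L := linear_map l2) oU c2).
Qed.

Lemma diff_times_prod n (I : Type) (s : seq I) (f : I -> V -> K) :
  (forall i, diff_times n U (f i)) -> diff_times n U (fun q => \prod_(i <- s) f i q).
Proof.
move=> Hf; elim: s => [|i s IH].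
  have -> : (fun q => \prod_(i <- [::]) f i q) = (fun=> 1).
    by apply/funext => t; rewrite big_nil.
  exact: diff_times_cst.
have -> : (fun q => \prod_(j <- i :: s) f j q) = (fun q => f i q * \prod_(j <- s) f j q).
  by apply/funext => t; rewrite big_cons.
exact: diff_timesM.
Qed.

Lemma diff_times_det n m (M : V -> 'M[K]_m) :
  (forall i j, diff_times n U (fun q => M q i j)) -> diff_times n U (fun q => \det (M q)).
Proof.
move=> HM; apply: diff_times_sum => // s; apply: diff_timesM => //.
  exact: diff_times_cst.
exact: diff_times_prod.
Qed.

(** Cramer's rule: each entry is a cofactor divided by the determinant. *)
Lemma diff_times_invmx n m (M : V -> 'M[K]_m) i j : (forall q, U q -> M q \in unitmx) ->
  (forall i j, diff_times n U (fun q => M q i j)) ->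
  diff_times n U (fun q => invmx (M q) i j).
Proof.
move=> uM HM.
apply: (@diff_times_congr _ _ _ n U (fun q => (\det (M q))^-1 *
   ((-1) ^+ (j + i) * \det (row' j (col' i (M q)))))) => //.
  by move=> q Uq; rewrite /invmx uM// !mxE.
apply: diff_timesM => //.
  apply: diff_timesV => //; last exact: diff_times_det.
  by move=> q /uM; rewrite unitmxE unitfE.
apply: diff_timesM => //; first exact: diff_times_cst.
apply: diff_times_det => a b.
have -> : (fun q => row' j (col' i (M q)) a b) = (fun q => M q (lift j a) (lift i b)).
  by apply/funext => q; rewrite !mxE.
exact: HM.
Qed.

End SmoothMatrices.

(** * Coefficients of the target equation *)

Section TargetCoefficients.
Variable K : numFieldType.
Variables (U : set K) (T1 X1 : K -> K).
Hypothesis oU : open U.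
Hypothesis T1_neq0 : forall t, U t -> T1 t != 0.
Hypothesis X1_neq0 : forall t, U t -> X1 t != 0.
Hypothesis smooth_T1 : smooth_on U T1.
Hypothesis smooth_X1 : smooth_on U X1.
Local Notation c := (prolong_coef T1 X1).

Definition coef_mx n t : 'M[K]_n := \matrix_(i, j) c i j t.

Lemma coef_mx_unit n t : U t -> coef_mx n t \in unitmx.
Proof.
move=> Ut; rewrite unitmxE unitfE det_trig.
  apply/prodf_neq0 => i _; rewrite mxE prolong_coef_diag mulf_neq0 ?X1_neq0//.
  by rewrite invr_eq0 expf_neq0 ?T1_neq0.
by apply/is_trig_mxP => i j ij; rewrite mxE prolong_coef_gt.
Qed.

Variable r : nat.

(** The row [b] with [b *m coef_mx = c r r *: a - (c r j)_j], obtained by matching the coefficients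
    of x_j, j < r - 1, in the prolonged target equation with [c r r] times those of the source. *)
Definition target_coef (t : K) (a : 'rV[K]_r.-1) : 'rV[K]_r.-1 :=
  (c r r t *: a - \row_j c r j t) *m invmx (coef_mx r.-1 t).

(** Rows below r - 1 reach neither x_(r-1) nor x_r, so the sum over [i] can correct exactly the
    columns below r - 1. The column r - 1 of the top row must vanish by itself; this is the rational
    form. *)
Lemma target_coef_identity t (a : 'rV[K]_r.-1) (z : nat -> K) : (0 < r)%N -> U t ->
  c r r.-1 t = 0 ->
  \sum_(m < r.+1) c r m t * z m +
    \sum_(i < r.-1) target_coef t a ord0 i * \sum_(m < r.+1) c i m t * z m =
  c r r t * (z r + \sum_(i < r.-1) a ord0 i * z i).
Proof.
move=> r0 Ut crr; have uM := coef_mx_unit r.-1 Ut.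
have lower (i : 'I_r.-1) : \sum_(m < r.+1) c i m t * z m =
    \sum_(m < r.-1) coef_mx r.-1 t i m * z m.
  have ir := ltn_ord i.
  move: i ir uM crr; rewrite /coef_mx; case: (r) r0 => //= r' _ i ir uM crr.
  have E1 : c i r' = fun=> 0 by exact: prolong_coef_gt.
  have E2 : c i r'.+1 = fun=> 0 by apply: prolong_coef_gt; exact: ltnW.
  rewrite 2!big_ord_recr /= E1 E2 !mul0r !addr0.
  by apply: eq_bigr => m _; rewrite mxE.
have -> : \sum_(i < r.-1) target_coef t a ord0 i * \sum_(m < r.+1) c i m t * z m =
    \sum_(m < r.-1) (c r r t * a ord0 m - c r m t) * z m.
  under eq_bigr do rewrite lower mulr_sumr.
  rewrite exchange_big /=; apply: eq_bigr => m _.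
  under eq_bigr do rewrite mulrA.
  rewrite -mulr_suml; congr (_ * _).
  have := mulmxKV uM (c r r t *: a - \row_j c r j t).
  by move=> /matrixP/(_ ord0 m); rewrite !mxE => <-.
have -> : \sum_(m < r.+1) c r m t * z m =
    \sum_(m < r.-1) c r m t * z m + c r r t * z r.
  rewrite big_ord_recr /=; congr (_ + _).
  case: (r) r0 crr => //= r' _ crr.
  by rewrite big_ord_recr /= crr mul0r addr0.
rewrite mulrDr mulr_sumr addrAC -big_split /= addrC; congr (_ + _).
by apply: eq_bigr => m _; ring.
Qed.

Lemma target_coef_affine t (a : 'rV[K]_r.-1) (b : 'rV[K]_r.-1) :
  target_coef t (a + b) = target_coef t a + b *m (c r r t *: invmx (coef_mx r.-1 t)).
Proof.
rewrite /target_coef -scalemxAr scalemxAl -mulmxDl scalerDr; congr (_ *m _).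
by rewrite addrAC.
Qed.

Lemma smooth_target_coef (V : normedModType K) (W : set V) n (tau : V -> K)
    (a : V -> 'rV[K]_r.-1) : open W -> (forall q, W q -> U (tau q)) ->
  diff_times n W tau -> diff_times n W a ->
  diff_times n W (fun q => target_coef (tau q) (a q)).
Proof.
move=> oW WU Dtau Da.
have Dc k m : diff_times n W (fun q => c k m (tau q)).
  apply: diff_times_comp Dtau => //; first exact: WU.
  exact: smooth_diff_times (smooth_prolong_coef oU T1_neq0 smooth_T1 smooth_X1 k m).
apply: diff_times_matrix => // i j.
have -> : (fun q => target_coef (tau q) (a q) i j) = (fun q => \sum_(m < r.-1)
   (c r r (tau q) * a q i m + -1 * c r m (tau q)) * invmx (coef_mx r.-1 (tau q)) m j).
  apply/funext => q; rewrite mxE; apply: eq_bigr => m _.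
  by rewrite !mxE mulN1r.
apply: diff_times_sum => // m; apply: diff_timesM => //.
  apply: diff_timesD => //; apply: diff_timesM => //.
    exact: diff_times_coord.
  exact: diff_times_cst.
apply: diff_times_invmx => // [q Wq|k l]; first by apply: coef_mx_unit; exact: WU.
have -> : (fun q => coef_mx r.-1 (tau q) k l) = (fun q => c k l (tau q)).
  by apply/funext => q; rewrite mxE.
exact: Dc.
Qed.

End TargetCoefficients.

(** Of the image [e] of the t-direction only the time component matters, so the t-derivatives of the
    prolongation and of the target coefficients are never computed. *)
Lemma triangular_bijective (K : numFieldType) (Z1 Z2 : normedModType K) (e : K * Z1 * Z2)
    (f : Z1 -> Z1) (g : Z2 -> Z2) (D : K * Z1 * Z2 -> K * Z1 * Z2) : e.1.1 != 0 ->
  bijective f -> bijective g ->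
  (forall v, D v = v.1.1 *: e + ((0, f v.1.2), g v.2)) -> bijective D.
Proof.
case: e => [[e1 e2] e3] /= e0 [f' f'K fK] [g' g'K gK] DE.
exists (fun u => let tau := u.1.1 / e1 in
  ((tau, f' (u.1.2 - tau *: e2)), g' (u.2 - tau *: e3))) => [[[a b] d]|[[a b] d]].
  have E : D (a, b, d) = ((a * e1, a *: e2 + f b), a *: e3 + g d).
    by rewrite DE; congr ((_, _), _); rewrite /= addr0.
  by rewrite E /= mulfK// [_ + f b]addrC addrK f'K [_ + g d]addrC addrK g'K.
rewrite DE /= fK gK; congr ((_, _), _); rewrite /= ?subrKC//.
by rewrite addr0 -[LHS]/(a / e1 * e1) divfK.
Qed.

(** * The target equation and the lift to the joint space *)

Section TransformedEquation.
Variable K : numFieldType.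
Variables (U V : set K) (S T T1 X1 : K -> K) (r : nat).
Hypothesis oU : open U.
Hypothesis oV : open V.
Hypothesis dT : forall t, U t -> is_derive t 1 T (T1 t).
Hypothesis T1_neq0 : forall t, U t -> T1 t != 0.
Hypothesis X1_neq0 : forall t, U t -> X1 t != 0.
Hypothesis smooth_T1 : smooth_on U T1.
Hypothesis smooth_X1 : smooth_on U X1.
Hypothesis UV : forall t, U t -> V (T t) /\ S (T t) = t.
Hypothesis VU : forall y, V y -> [/\ U (S y), T (S y) = y & is_derive y 1 S (T1 (S y))^-1].
Hypothesis r0 : (0 < r)%N.
Local Notation c := (prolong_coef T1 X1).
Hypothesis rational_form : forall t, U t -> c r r.-1 t = 0.

Lemma smooth_T : smooth_on U T.
Proof.
apply: (@smooth_bootstrap K unit U (fun=> T) (fun=> T1) oU _ _ tt) => // n _ _.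
exact: smooth_diff_times.
Qed.

Lemma smooth_S : smooth_on V S.
Proof.
apply: (@smooth_bootstrap K unit V (fun=> S) (fun _ y => (T1 (S y))^-1) oV _ _ tt).
  by move=> _ t /VU[].
move=> n /(_ tt) DS _; apply: diff_timesV => // [y /VU[Uy _ _]|]; first exact: T1_neq0.
apply: (@diff_times_comp _ _ _ V U T1 S) => // [y /VU[]//|].
exact: smooth_diff_times.
Qed.

Section Target.
Variable E : equation K r.

Definition target_dom := [set y | V y /\ dom E (S y)].

Lemma open_target_dom : open target_dom.
Proof.
rewrite openE => y [Vy Ey]; apply: filterI; first exact: (open_nbhs_nbhs (conj oV Vy)).
have [_ _ /is_derive_continuous cS] := VU Vy.
exact: (cS _ (open_nbhs_nbhs (conj (@open_dom _ _ E) Ey))).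
Qed.

Lemma smooth_target : smooth_on target_dom
  (fun y => target_coef T1 X1 (S y) (coef E (S y))).
Proof.
apply/smooth_onP => n; have oD := open_target_dom.
have DS : diff_times n target_dom S.
  by apply: diff_times_sub (smooth_diff_times n smooth_S) => y [].
apply: (smooth_target_coef oU T1_neq0 X1_neq0 smooth_T1 smooth_X1) => // [y [/VU[]]//|].
apply: diff_times_matrix => // i j.
apply: (@diff_times_comp _ _ _ _ (dom E) (fun t => coef E t i j) S) => // [y []//|].
apply: diff_times_coord; first exact: open_dom.
exact: (smooth_diff_times n (@smooth_coef _ _ E)).
Qed.

Definition target_equation : equation K r := Equation open_target_dom smooth_target.

Lemma target_coefE t : U t -> coef target_equation (T t) = target_coef T1 X1 t (coef E t).
Proof. by move=> /UV[_ /= ->]. Qed.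

(** The free sequence [z] serves twice: as x_m + phi^(m) for an admissible transformation, and as
    x_m for the lift to the joint space. *)
Lemma target_equation_iff t (z : nat -> K) (J : jet K r) : U t -> J.1 = T t ->
  (forall k, (k <= r)%N -> jx J k = \sum_(m < r.+1) c k m t * z m) ->
  holds target_equation J <-> z r + \sum_(i < r.-1) coef E t ord0 i * z i = 0.
Proof.
move=> Ut J1 Jz; rewrite /holds J1 target_coefE//.
have kr (i : 'I_r.-1) : (i <= r)%N.
  by apply: leq_trans (leq_pred r); exact: ltnW.
under eq_bigr => i _ do rewrite Jz//.
rewrite Jz//.
rewrite (target_coef_identity T1_neq0 X1_neq0)//; last exact: rational_form.
have cn0 : c r r t != 0.
  by rewrite prolong_coef_diag mulf_neq0 ?X1_neq0// invr_eq0 expf_neq0 ?T1_neq0.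
split=> [/eqP|->]; last by rewrite mulr0.
by rewrite mulf_eq0 (negPf cn0) => /eqP.
Qed.

End Target.

Section Admissible.
Variables (E : equation K r) (phi : nat -> K -> K).
Variables (Om : set (K * K)) (F : K * K -> K * K).
Hypothesis dphi : forall k t, U t -> is_derive t 1 (phi k) (phi k.+1 t).
Hypothesis oOm : open Om.
Hypothesis OmF : forall q, Om q ->
  U q.1 /\ F q = (T q.1, X1 q.1 * (q.2 + phi 0%N q.1)).

Lemma smooth_phi k : smooth_on U (phi k).
Proof.
by apply: (@smooth_bootstrap K nat U phi (fun k => phi k.+1)).
Qed.

Lemma affine_point_transformation : point_transformation Om F.
Proof.
have fstOm q : Om q -> U q.1 by case/OmF.
have D1 n : diff_times n Om (@fst K K).
  by have [lf cf] := @fst_linear_continuous K K K; exact: diff_times_linear_fun.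
have D2 n : diff_times n Om (@snd K K).
  by have [lf cf] := @snd_linear_continuous K K K; exact: diff_times_linear_fun.
have DA n (A : K -> K) : smooth_on U A -> diff_times n Om (fun q => A q.1).
  by move=> sA; exact: (@diff_times_comp K n _ Om U A fst oOm fstOm (smooth_diff_times n sA) (D1 n)).
have sF : smooth_on Om F.
  apply/smooth_onP => n.
  apply: (@diff_times_congr _ _ _ n Om (fun q => (T q.1, X1 q.1 * (q.2 + phi 0%N q.1)))) => //.
    by move=> q /OmF[].
  apply: diff_times_pair => //; first exact: DA smooth_T.
  apply: diff_timesM => //; first exact: DA.
  by apply: diff_timesD => //; exact: DA (smooth_phi 0).
split=> // p Op; have [Up _] := OmF Op.
have dF : differentiable F p by exact: (sF [::]).
have comp1 v : ('D_v F p).1 = v.1 * T1 p.1.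
  rewrite derive_fst_comp//.
  rewrite (@near_eq_derive _ _ _ _ (fun q : K * K => T q.1)); last first.
    by apply: filterS (open_nbhs_nbhs (conj oOm Op)) => q /OmF[_ ->].
  by have [_ ->] := is_derive_of_fst (p := p) v (dT Up).
have comp2 : ('D_((0, 1) : K * K) F p).2 = X1 p.1.
  have [l2 c2] := @snd_linear_continuous K K K.
  rewrite derive_snd_comp//.
  rewrite (@near_eq_derive _ _ _ _ (fun q : K * K => X1 q.1 * (q.2 + phi 0%N q.1))); last first.
    by apply: filterS (open_nbhs_nbhs (conj oOm Op)) => q /OmF[_ ->].
  have d1 := is_derive_of_fst (p := p) ((0, 1) : K * K) (smooth_is_derive1 smooth_X1 Up).
  have d2 := is_derive_of_fst (p := p) ((0, 1) : K * K) (dphi 0 Up).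
  have d3 : is_derive p ((0, 1) : K * K) snd 1 by exact: is_derive_linear l2 _ _ c2.
  have [_ ->] := is_deriveM d1 (is_deriveD d3 d2).
  by rewrite /= !mul0r scaler0 !addr0 /GRing.scale/= mulr1.
have e1 : ('D_((1, 0) : K * K) F p).1 = T1 p.1 by rewrite comp1 mul1r.
have e2 : ('D_((0, 1) : K * K) F p).1 = 0 by rewrite comp1 mul0r.
move: e1 e2 comp2; rewrite /jacobian2.
move: ('D_((1, 0) : K * K) F p) ('D_((0, 1) : K * K) F p) => [a b] [a' b'] /= -> -> ->.
by rewrite mul0r subr0 mulf_neq0 ?T1_neq0 ?X1_neq0.
Qed.

Hypothesis OmE : forall q, Om q -> dom E q.1.
Hypothesis solves_phi : forall t, U t -> dom E t ->
  phi r t + \sum_(i < r.-1) coef E t ord0 i * phi i t = 0.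

(** As phi solves [E], replacing x_m by x_m + phi^(m) leaves the left-hand side of [E] unchanged. *)
Lemma affine_admissible : admissible E (target_equation E) Om F.
Proof.
split; first exact: affine_point_transformation.
  move=> q Oq; have [Uq ->] := OmF Oq; split; first exact: OmE.
  have [Vq Sq] := UV Uq; split=> //=; rewrite Sq; exact: OmE.
move=> j Oj _; have [Uj Fj] := OmF Oj; have Ej := OmE Oj.
rewrite (@target_equation_iff E j.1 (fun m => jx j m + phi m j.1) (prolong F j) Uj).
- rewrite /holds; under [X in _ <-> _ + X = 0]eq_bigr do rewrite mulrDr.
  rewrite big_split /= addrACA solves_phi// addr0.
  by [].
- by rewrite /= Fj.
- move=> k kr; rewrite /jx /= mxE inordK//.
  exact: (prolong_x_affine oU dT T1_neq0 smooth_T1 smooth_X1 dphi oOm OmF kr Oj).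
Qed.

End Admissible.

Section Equivalence.

Definition fiber_linear (q : K * K) : K * K := (T q.1, X1 q.1 * q.2).

Definition fiber_dom : set (K * K) := [set q | U q.1].

Local Notation zero_family := (fun (_ : nat) (_ : K) => 0 : K).

(** The closed formula stands in for [prolong]: it is smooth on all jets over [U] and visibly linear
    along the fibres. *)
Definition lifted_jet (w : joint K r) : jet K r :=
  (T w.1.1, \row_(k < r.+1) affine_jet T1 X1 zero_family k w.1).

Definition lifted (w : joint K r) : joint K r :=
  (lifted_jet w, target_coef T1 X1 w.1.1 w.2).

Let D : set (joint K r) := [set w | U w.1.1].

Lemma derive_zero_family (k : nat) (t : K) : U t ->
  is_derive t 1 (zero_family k) (zero_family k.+1 t).
Proof. by move=> _; exact: is_derive_cst. Qed.

Lemma open_fiber_dom : open fiber_dom.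
Proof.
apply: open_comp => // q _; have [_ cf] := @fst_linear_continuous K K K.
exact: cf.
Qed.

Lemma fiber_linearE q : fiber_dom q ->
  U q.1 /\ fiber_linear q = (T q.1, X1 q.1 * (q.2 + zero_family 0%N q.1)).
Proof. by move=> Uq; rewrite addr0. Qed.

Let tcoord (w : joint K r) : K := w.1.1.

Lemma linear_continuous_time : linear tcoord /\ continuous tcoord.
Proof.
split=> // w; apply: (@continuous_comp _ _ _ fst fst).
  by have [_] := @fst_linear_continuous K (jet K r) 'rV[K]_r.-1; apply.
by have [_] := @fst_linear_continuous K K 'rV[K]_r.+1; apply.
Qed.

Lemma open_D : open D.
Proof. by apply: open_comp => // w _; case: linear_continuous_time => _; apply. Qed.

Lemma diff_times_lifted_jet n : diff_times n D lifted_jet.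
Proof.
have oD := open_D; have [lt ct] := linear_continuous_time.
have Dt : diff_times n D tcoord by exact: diff_times_linear_fun.
have DA (A : K -> K) : smooth_on U A -> diff_times n D (fun w => A w.1.1).
  by move=> sA; exact: (@diff_times_comp K n _ D U A tcoord oD (fun _ => id) (smooth_diff_times n sA) Dt).
apply: diff_times_pair => //; first exact: DA smooth_T.
apply: diff_times_matrix => // i j.
have -> : (fun w : joint K r => (\row_(k < r.+1) affine_jet T1 X1 zero_family k w.1) i j) =
  (fun w => \sum_(m < r.+1) c j m w.1.1 * (jx w.1 m + 0)).
  by apply/funext => w; rewrite mxE.
apply: diff_times_sum => // m; apply: diff_timesM => //.
  by apply: DA; exact: smooth_prolong_coef.
apply: diff_timesD => //; last exact: diff_times_cst.
have [lf cf] := @fst_linear_continuous K (jet K r) 'rV[K]_r.-1.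
apply: (@diff_times_linl K n _ _ _ D (linear_map (@jx_linear K r m)) fst) => //.
  exact: jx_continuous.
exact: diff_times_linear_fun.
Qed.

Lemma smooth_lifted : smooth_on D lifted.
Proof.
have oD := open_D; have [lt ct] := linear_continuous_time.
apply/smooth_onP => n; apply: diff_times_pair => //; first exact: diff_times_lifted_jet.
apply: (smooth_target_coef oU T1_neq0 X1_neq0 smooth_T1 smooth_X1) => //.
  exact: (diff_times_linear_fun n D lt ct).
have [lf cf] := @snd_linear_continuous K (jet K r) 'rV[K]_r.-1.
exact: diff_times_linear_fun.
Qed.

Lemma differentiable_lifted w : D w -> differentiable lifted w.
Proof. exact: (smooth_lifted [::]). Qed.

Lemma derive_lifted_time w v : D w -> ('D_v lifted w).1.1 = v.1.1 * T1 w.1.1.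
Proof.
move=> Dw; have dl := differentiable_lifted Dw.
have dj := diff_times_differentiable (diff_times_lifted_jet 0) Dw.
rewrite derive_fst_comp// derive_fst_comp//.
have [lt ct] := linear_continuous_time.
have dt : is_derive w v tcoord v.1.1 by exact: is_derive_linear lt _ _ ct.
by have [_ ->] := is_derive1_chain (dT Dw : is_derive (tcoord w) 1 T _) dt.
Qed.

Lemma derive_lifted_jx w v k : D w -> (k <= r)%N ->
  jx ('D_v lifted w).1 k = 'D_(v.1) (affine_jet T1 X1 zero_family k) w.1.
Proof.
move=> Dw kr; have dl := differentiable_lifted Dw.
have dj := diff_times_differentiable (diff_times_lifted_jet 0) Dw.
rewrite derive_fst_comp//.
have [_ E] := derive_linear_comp (L := linear_map (@jx_linear K r k)) v (@jx_continuous K r k) dj.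
have -> : jx ('D_v (fun q => (lifted q).1) w) k = 'D_v (fun q => jx (lifted_jet q) k) w.
  exact: esym E.
have -> : (fun q => jx (lifted_jet q) k) = (fun w => affine_jet T1 X1 zero_family k w.1).
  by apply/funext => q; rewrite /= /jx/= mxE inordK.
have dA := is_derive_affine_jet oU T1_neq0 smooth_T1 smooth_X1 derive_zero_family k v.1 Dw.
have [_ ->] := dA.
by move/is_derive_lineP: dA => /(is_derive_lineP (fun w => affine_jet T1 X1 zero_family k w.1) w v)[].
Qed.

Lemma derive_lifted_fiber w (xi : 'rV[K]_r.+1) (al : 'rV[K]_r.-1) : D w ->
  'D_(((0, xi), al) : joint K r) lifted w =
  ((0, xi *m (coef_mx T1 X1 r.+1 w.1.1)^T),
   al *m (c r r w.1.1 *: invmx (coef_mx T1 X1 r.-1 w.1.1))).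
Proof.
move=> Dw; set z := (X in _ = X); set v : joint K r := ((0, xi), al).
have line h : lifted (w + h *: v) = lifted w + h *: z.
  have th : (w + h *: v).1.1 = w.1.1 by rewrite /= [h *: _]mulr0 addr0.
  rewrite /lifted /lifted_jet th; congr ((_, _), _).
  - by rewrite /= [h *: _]mulr0 addr0.
  - apply/rowP => k; rewrite !mxE /affine_jet th mulr_sumr -big_split/=.
    apply: eq_bigr => m _; rewrite !addr0 !mxE /jx/= !mxE inord_val.
    by rewrite /GRing.scale/=; ring.
  - by rewrite /= target_coef_affine scalemxAl.
exact: derive_affine_line.
Qed.

Lemma bijective_diff_lifted w : D w -> bijective ('d lifted w).
Proof.
move=> Dw; have dl := differentiable_lifted Dw.
set A := (coef_mx T1 X1 r.+1 w.1.1)^T.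
set B := c r r w.1.1 *: invmx (coef_mx T1 X1 r.-1 w.1.1).
have uc n : coef_mx T1 X1 n w.1.1 \in unitmx by exact: (coef_mx_unit T1_neq0 X1_neq0 n (t := w.1.1) Dw).
have uA : A \in unitmx by rewrite unitmx_tr.
have uB : B \in unitmx.
  rewrite unitmxZ ?unitmx_inv// unitfE prolong_coef_diag.
  by rewrite mulf_neq0 ?X1_neq0// invr_eq0 expf_neq0 ?T1_neq0.
pose e : joint K r := 'd lifted w ((1, 0), 0).
have e0 : e.1.1 != 0.
  by rewrite /e -deriveE// derive_lifted_time// mul1r T1_neq0.
have dE v : 'd lifted w v = v.1.1 *: e + ((0, v.1.2 *m A), v.2 *m B).
  have vE : v = v.1.1 *: ((1, 0), 0) + ((0, v.1.2), v.2) :> joint K r.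
    move: v => [[a b] d]; congr ((_, _), _); rewrite /= ?addr0 ?scaler0 ?add0r//.
    by rewrite [a *: _]mulr1.
  by rewrite [in LHS]vE linearD linearZ/= -/e -(derive_lifted_fiber _ _ Dw) deriveE.
apply: (triangular_bijective e0 _ _ dE).
  by exists (mulmxr (invmx A)) => x; [exact: mulmxK|exact: mulmxKV].
by exists (mulmxr (invmx B)) => x; [exact: mulmxK|exact: mulmxKV].
Qed.

Lemma equivalence_lifted : equivalence_transformation fiber_dom fiber_linear lifted.
Proof.
have FE := fiber_linearE; have oF := open_fiber_dom.
have WD w : joint_dom fiber_dom fiber_linear w -> D w by case.
split.
- exact: affine_point_transformation derive_zero_family oF FE.
- split=> [|w /WD]; last exact: bijective_diff_lifted.
  by move=> vs w /WD; exact: smooth_lifted.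
- move=> w /WD Dw; rewrite /base /= /fiber_linear /=; congr (_, _).
  rewrite /jx /= mxE inordK// /affine_jet big_ord_recl big1 ?addr0//.
  by move=> m _; rewrite mul0r.
- move=> w v /WD Dw cv k kr.
  rewrite -!deriveE; try exact: differentiable_lifted.
  rewrite derive_lifted_jx// 1?ltnW// derive_lifted_time//.
  rewrite (derive_affine_jet_contact oU T1_neq0 smooth_T1 smooth_X1 derive_zero_family)//.
  by rewrite [jx (lifted w).1 _]/jx /= mxE inordK// mulrA mulrC.
- move=> E; exists (target_equation E) => w /WD Dw Ew w2.
  have [VT ST] := UV Dw; split.
  + by split=> //=; rewrite ST.
  + by rewrite [RHS](target_coefE E Dw) /= w2.
  rewrite (@target_equation_iff E w.1.1 (fun m => jx w.1 m + 0) _ Dw)//; last first.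
    by move=> k kr; rewrite /jx /= mxE inordK.
  by rewrite /holds; under [X in _ <-> _ + X = 0]eq_bigr do rewrite addr0; rewrite addr0.
Qed.

End Equivalence.

End TransformedEquation.

(** * Solution spaces *)

Section HomogeneousEquations.
Variable K : numFieldType.
Hypothesis archK : archimedean_field K.
Hypothesis compK : geometrically_complete K.

Local Notation nball z rho := [set t : K | `|t - z| < rho].

Lemma finite_lower_bound (I : finType) (P : I -> K -> Prop) :
  (forall i d d', 0 < d' -> d' <= d -> P i d -> P i d') ->
  (forall i, exists2 d, 0 < d & P i d) -> exists2 d, 0 < d & forall i, P i d.
Proof.
move=> mono H; suff [d d0 Hd] : exists2 d, 0 < d & forall i, i \in enum I -> P i d.
  by exists d => // i; apply: Hd; rewrite mem_enum.
elim: (enum I) => [|i s [d d0 Hd]]; first by exists 1.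
have [d1 d10 Hd1] := H i; have [d2 [d20 d2d d2d1]] := pos_lower_bound d0 d10.
exists d2 => // j; rewrite inE => /orP[/eqP ->|js]; first exact: mono Hd1.
by apply: mono (Hd j js).
Qed.

Lemma open_contains_ball (U : set K) z : open U -> U z ->
  exists2 d, 0 < d & nball z d `<=` U.
Proof.
move=> oU Uz; have /near0_normP[d d0 Hd] := open_nbhs_nbhs (conj oU Uz).
by exists d.
Qed.

Lemma smooth_nearP z (f : K -> K) :
  smooth_near z f <-> exists2 d, 0 < d & smooth_on (nball z d) f.
Proof.
split=> [[U [oU Uz] sU]|[d d0 sf]].
  have [d d0 dU] := open_contains_ball oU Uz.
  by exists d => // vs p pd; apply: sU; exact: dU.
exists (nball z d) => //; split; first exact: open_ball_norm.
by rewrite /= subrr normr0.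
Qed.

Lemma smooth_on_sub (V W : normedModType K) (U U' : set V) (f : V -> W) :
  U' `<=` U -> smooth_on U f -> smooth_on U' f.
Proof. by move=> sU sf vs p /sU; exact: sf. Qed.

Lemma derive1_D1 (f : K -> K) : derive1 f = 'D_1 f.
Proof. by apply/funext => t; rewrite derive1E. Qed.

Lemma smooth_derive1n U (f : K -> K) k : smooth_on U f -> smooth_on U (derive1n k f).
Proof.
move=> sf; elim: k => [|k IH]; first by rewrite derive1n0.
by rewrite derive1nS derive1_D1; exact: smooth_derive.
Qed.

Lemma is_derive_derive1n (U : set K) (f : K -> K) k t : smooth_on U f -> U t ->
  is_derive t 1 (derive1n k f) (derive1n k.+1 f t).
Proof.
move=> sf Ut; rewrite derive1nS derive1_D1.
exact: smooth_is_derive1 (smooth_derive1n k sf) Ut.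
Qed.

Lemma derive1n_eq_on (U : set K) (f : K -> K) (y : nat -> K -> K) k : open U ->
  (forall t, U t -> f t = y 0%N t) ->
  (forall m t, (m < k)%N -> U t -> is_derive t 1 (y m) (y m.+1 t)) ->
  forall t, U t -> derive1n k f t = y k t.
Proof.
move=> oU f0; elim: k => [|k IH] dy t Ut; first by rewrite derive1n0 f0.
rewrite derive1nS derive1E (@near_eq_derive _ _ _ _ (y k)).
  by have [_ ->] := dy k t (ltnSn k) Ut.
apply: filterS (open_nbhs_nbhs (conj oU Ut)) => s Us.
by apply: IH => // m u mk; apply: dy; exact: ltnW.
Qed.

Lemma smooth_bounded_C2 (U : set K) (f : K -> K) z : open U -> U z -> smooth_on U f ->
  exists2 d, 0 < d & bounded_C2 z d f.
Proof.
move=> oU Uz sf; have [d d0 dU] := open_contains_ball oU Uz.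
have bnd k : exists2 e, 0 < e & forall t, `|t - z| < e ->
    `|derive1n k f t| <= `|derive1n k f z| + 1.
  have /is_derive_continuous cf := is_derive_derive1n k sf Uz.
  have /cvgrPdist_le/(_ 1 ltr01)/near0_normP[e e0 He] := cf.
  exists e => // t /He; rewrite distrC => H.
  have -> : derive1n k f t = derive1n k f z + (derive1n k f t - derive1n k f z) by ring.
  by apply: le_trans (ler_normD _ _) _; rewrite lerD2l.
have [e e0 He] : exists2 e, 0 < e & forall k : 'I_3, forall t, `|t - z| < e ->
    `|derive1n k f t| <= `|derive1n k f z| + 1.
  apply: (@finite_lower_bound _ (fun (k : 'I_3) e => forall t, `|t - z| < e ->
    `|derive1n k f t| <= `|derive1n k f z| + 1)) => [k e e' _ e'e H t te|k]; last exact: bnd.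
  by apply: H; exact: lt_le_trans e'e.
have [d1 [d10 d1d d1e]] := pos_lower_bound d0 e0.
pose M := \sum_(k < 3) (`|derive1n k f z| + 1).
have leM (k : 'I_3) t : `|t - z| < d1 -> `|derive1n k f t| <= M.
  move=> td; apply: le_trans (He k t (lt_le_trans td d1e)) _.
  by rewrite /M (bigD1 k)//= lerDl; apply: sumr_ge0 => i _; rewrite addr_ge0.
exists d1 => //; exists (derive1n 1 f), (derive1n 2 f), M; split.
  by apply: sumr_ge0 => i _; rewrite addr_ge0.
move=> t td; have Ut := dU _ (lt_le_trans td d1d).
split; first exact: (is_derive_derive1n 0 sf Ut).
- exact: (is_derive_derive1n 1 sf Ut).
- exact: (leM (@Ordinal 3 0 isT)).
- exact: (leM (@Ordinal 3 1 isT)).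
- exact: (leM (@Ordinal 3 2 isT)).
Qed.

Lemma bounded_C2_sub (z d d' : K) (f : K -> K) : d' <= d -> bounded_C2 z d f -> bounded_C2 z d' f.
Proof.
move=> d'd [f1 [f2 [M [M0 H]]]]; exists f1, f2, M; split=> // t td.
by apply: H; exact: lt_le_trans d'd.
Qed.

Lemma derive1n_lincomb (U : set K) (I : finType) (a : I -> K) (f : I -> K -> K) k t :
  open U -> (forall i, smooth_on U (f i)) -> U t ->
  derive1n k (fun s => \sum_i a i * f i s) t = \sum_i a i * derive1n k (f i) t.
Proof.
move=> oU sf Ut.
apply: (@derive1n_eq_on U _ (fun k s => \sum_i a i * derive1n k (f i) s)) => // m s _ Us.
apply: is_derive_sum_seq => i.
have d := is_derive_derive1n m (sf i) Us.
have := is_deriveZ (a i) d.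
by congr (is_derive _ _ _ _).
Qed.

Lemma smooth_lincomb (U : set K) (I : finType) (a : I -> K) (f : I -> K -> K) :
  open U -> (forall i, smooth_on U (f i)) -> smooth_on U (fun s => \sum_i a i * f i s).
Proof.
move=> oU sf; apply/smooth_onP => n; apply: diff_times_sum => // i.
by apply: diff_timesM => //; [exact: diff_times_cst|exact: smooth_diff_times].
Qed.

Variable n : nat.
Variable E : equation K n.+1.

Lemma local_solutionP z f : local_solution E z f <->
  exists2 d, 0 < d & smooth_on (nball z d) f /\
    forall t, `|t - z| < d -> dom E t /\ solves E f t.
Proof.
split=> [[/smooth_nearP[d d0 sf] /near0_normP[e e0 He]]|[d d0 [sf Hf]]].
  have [d1 [d10 d1d d1e]] := pos_lower_bound d0 e0; exists d1 => //; split.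
    by apply: smooth_on_sub sf => t /= td; exact: lt_le_trans d1d.
  by move=> t td; apply: He; exact: lt_le_trans d1e.
split; first by apply/smooth_nearP; exists d.
by apply/near0_normP; exists d.
Qed.

(** Here r = n + 1. In the last row [insub] fails exactly at [j = n], where the rational form has no
    coefficient of x^(r-1). *)
Definition companion (i j : 'I_n.+1) (t : K) : K :=
  if i == n :> nat then
    if insub (j : nat) is Some k then - coef E t ord0 (k : 'I_n) else 0
  else (j == i.+1 :> nat)%:R.

Lemma companion_last t (y : 'I_n.+1 -> K) :
  \sum_j companion ord_max j t * y j =
  - \sum_(k < n) coef E t ord0 k * y (widen_ord (leqnSn n) k).
Proof.
rewrite big_ord_recr /= /companion /= eqxx.
rewrite insubF ?ltnn// mul0r addr0 -sumrN; apply: eq_bigr => k _ /=.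
by rewrite valK mulNr.
Qed.

Lemma companion_lt t (y : nat -> K) (i : 'I_n.+1) : (i < n)%N ->
  \sum_j companion i j t * y j = y i.+1.
Proof.
move=> ilt; have i1 : (i.+1 < n.+1)%N by [].
rewrite (bigD1 (Ordinal i1))//= /companion (ltn_eqF ilt) eqxx mul1r.
rewrite big1 ?addr0// => j; rewrite -val_eqE /= => /negPf ->.
by rewrite mul0r.
Qed.

Lemma smooth_companion i j : smooth_on (dom E) (companion i j).
Proof.
apply/smooth_onP => m; rewrite /companion; case: (nat_of_ord i == n); last exact: diff_times_cst.
case: (insub _) => [k|]; last exact: diff_times_cst.
have oE := @open_dom _ _ E.
have -> : (fun t => - coef E t ord0 k) = (fun t => -1 * coef E t ord0 k).
  by apply/funext => t; rewrite mulN1r.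
apply: diff_timesM => //; first exact: diff_times_cst.
apply: diff_times_coord => //; exact: (smooth_diff_times m (@smooth_coef _ _ E)).
Qed.

Lemma companion_ball z : dom E z -> exists d M, [/\ 0 < d, 0 <= M,
  n.+1%:R * M * d <= 2^-1, nball z d `<=` dom E &
  forall i j, bounded_C2 z d (companion i j) /\
              forall t, `|t - z| < d -> `|companion i j t| <= M].
Proof.
move=> Ez; have oE := @open_dom _ _ E.
have [d0 d00 d0E] := open_contains_ball oE Ez.
have [d1 d10 H] : exists2 d, 0 < d & forall p : 'I_n.+1 * 'I_n.+1, bounded_C2 z d (companion p.1 p.2).
  apply: finite_lower_bound => [p d d' _ d'd|p]; first exact: bounded_C2_sub.
  exact: smooth_bounded_C2 (smooth_companion p.1 p.2).
have /choice[Mf HM] : forall p : 'I_n.+1 * 'I_n.+1, exists M, 0 <= M /\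
    forall t, `|t - z| < d1 -> `|companion p.1 p.2 t| <= M.
  move=> p; have [f1 [f2 [M [M0 HM]]]] := H p; exists M; split=> // t /HM[] //.
pose M := \sum_p Mf p.
have M0 : 0 <= M by apply: sumr_ge0 => p _; case: (HM p).
(* This bound on the radius yields the contraction factor 1/2; the added 1 covers [M = 0]. *)
have e0 : 0 < (2 * (n.+1%:R * M + 1))^-1.
  by rewrite invr_gt0 mulr_gt0// ltr_pwDr// mulr_ge0.
have [d2 [d20 d2d0 d2d1]] := pos_lower_bound d00 d10.
have [d [d_0 dd2 de]] := pos_lower_bound d20 e0.
exists d, M; split=> //.
- apply: le_trans (ler_wpM2l _ de) _; first exact: mulr_ge0.
  rewrite invfM mulrA ler_pdivrMr; last by rewrite ltr_pwDr// mulr_ge0.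
  by rewrite mulrC ler_wpM2l ?invr_ge0// lerDl.
- by move=> t /= td; apply: d0E => /=; apply: lt_le_trans td (le_trans dd2 d2d0).
move=> i j; split; first exact: bounded_C2_sub (le_trans dd2 d2d1) (H (i, j)).
move=> t td; apply: le_trans (proj2 (HM (i, j)) t (lt_le_trans td (le_trans dd2 d2d1))) _.
by rewrite /M (bigD1 (i, j))//= lerDl; apply: sumr_ge0 => p _; case: (HM p).
Qed.

Lemma solution_exists z (y0 : 'I_n.+1 -> K) : dom E z ->
  exists f, local_solution E z f /\ forall k : 'I_n.+1, derive1n k f z = y0 k.
Proof.
move=> Ez; have [d [M [d0 M0 Md dE HA]]] := companion_ball Ez.
have [||y Hy] := @linear_system_exists K archK compK z d n.+1 companion M d0 M0 Md _ y0.
- by move=> i j t td; have [_] := HA i j; apply.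
- by move=> i j; have [] := HA i j.
have oB : open (nball z d) by exact: open_ball_norm.
have sy i : smooth_on (nball z d) (y i).
  apply: (@smooth_bootstrap K 'I_n.+1 _ y (fun i t => \sum_j companion i j t * y j t) oB).
    by move=> k t td; have [_] := Hy k; apply.
  move=> m Dy k; apply: diff_times_sum => // j; apply: diff_timesM => //.
  by apply: diff_times_sub dE _; exact: smooth_diff_times (smooth_companion k j).
pose yy (k : nat) t := y (inord k) t.
have yyE (k : 'I_n.+1) t : yy k t = y k t by rewrite /yy inord_val.
have dyy k t : (k < n)%N -> `|t - z| < d -> is_derive t 1 (yy k) (yy k.+1 t).
  move=> kn td; have [_ /(_ t td)] := Hy (inord k).
  have -> : \sum_j companion (inord k) j t * y j t = yy k.+1 t.
    under eq_bigr do rewrite -yyE.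
    rewrite (companion_lt t (fun k => yy k t)) ?inordK//; exact: ltnW.
  by [].
have df k t : (k <= n)%N -> `|t - z| < d -> derive1n k (yy 0%N) t = yy k t.
  move=> kn td; apply: (derive1n_eq_on oB) => // m u mk ud.
  by apply: dyy => //; exact: leq_trans kn.
exists (yy 0%N); split.
  apply/local_solutionP; exists d => //; split=> [|t td]; first exact: sy.
  split; first exact: dE.
  rewrite /solves derive1nS derive1E (@near_eq_derive _ _ _ _ (yy n)); last first.
    by apply: filterS (open_nbhs_nbhs (conj oB td)) => s sd; exact: df.
  have -> : yy n = y ord_max.
    by apply/funext => s; rewrite /yy; congr (y _ _); apply: val_inj; rewrite /= inordK.
  have [_ /(_ t td)[_ ->]] := Hy ord_max.
  rewrite companion_last addrC; apply/eqP; rewrite subr_eq0; apply/eqP.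
  apply: eq_bigr => k _; rewrite df ?(ltnW (ltn_ord k))// -yyE//.
move=> k; rewrite df ?subrr ?normr0// -1?ltnS//.
by rewrite yyE; case: (Hy k).
Qed.

Lemma solution_unique z f : local_solution E z f ->
  (forall k : 'I_n.+1, derive1n k f z = 0) -> \forall t \near z, f t = 0.
Proof.
move=> /local_solutionP[e e0 [sf Hf]] f0.
have zz : `|z - z| < e by rewrite subrr normr0.
have Ez : dom E z by case: (Hf z zz).
have oB : open (nball z e) by exact: open_ball_norm.
have [d1 d10 H1] : exists2 d, 0 < d & forall k : 'I_n.+1, bounded_C2 z d (derive1n k f).
  apply: finite_lower_bound => [p d d' _ d'd|p]; first exact: bounded_C2_sub.
  exact: (smooth_bounded_C2 oB zz (smooth_derive1n p sf)).
have /choice[Bf HB] : forall k : 'I_n.+1, exists B, 0 <= B /\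
    forall t, `|t - z| < d1 -> `|derive1n k f t| <= B.
  by move=> p; have [f1 [f2 [M [M0 HM]]]] := H1 p; exists M; split=> // t /HM[].
have [d2 [M [d20 M0 Md dE HA]]] := companion_ball Ez.
have [d3 [d30 d3d1 d3d2]] := pos_lower_bound d10 d20.
have [d [d0 dd3 de]] := pos_lower_bound d30 e0.
pose B := \sum_k Bf k.
have := @linear_system_unique K archK compK z d n.+1 companion M d0 M0 _ _
  (fun k => derive1n k f) B.
have Md' : n.+1%:R * M * d <= 2^-1.
  by apply: le_trans Md; rewrite ler_wpM2l ?mulr_ge0// (le_trans dd3).
have AM i j t : `|t - z| < d -> `|companion i j t| <= M.
  by move=> td; have [_] := HA i j; apply; apply: lt_le_trans td (le_trans dd3 d3d2).
move=> /(_ Md' AM); have B0 : 0 <= B by apply: sumr_ge0 => k _; case: (HB k).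
move=> /(_ B0); have Bb (i : 'I_n.+1) t : `|t - z| < d -> `|derive1n i f t| <= B.
  move=> td; apply: le_trans (proj2 (HB i) t (lt_le_trans td (le_trans dd3 d3d1))) _.
  by rewrite /B (bigD1 i)//= lerDl; apply: sumr_ge0 => p _; case: (HB p).
move=> /(_ Bb); have dy (i : 'I_n.+1) t : `|t - z| < d ->
    is_derive t 1 (derive1n i f) (\sum_j companion i j t * derive1n j f t).
  move=> td; have te := lt_le_trans td de.
  have := is_derive_derive1n i sf te; congr (is_derive _ _ _ _).
  have [ilt|] := ltnP i n; first by rewrite (companion_lt t (fun k => derive1n k f t)).
  move=> nle; have -> : i = ord_max.
    by apply: val_inj; apply/eqP; rewrite eqn_leq nle -ltnS ltn_ord.
  rewrite companion_last; apply/eqP; rewrite -addr_eq0; apply/eqP.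
  by have [_] := Hf t te.
move=> /(_ dy f0) H; apply/near0_normP; exists d => // t td.
by have := H ord0 t td; rewrite derive1n0.
Qed.

Lemma solution_lincomb z (I : finType) (a : I -> K) (f : I -> K -> K) :
  dom E z -> (forall i, local_solution E z (f i)) ->
  local_solution E z (fun t => \sum_i a i * f i t) /\
  forall k, derive1n k (fun t => \sum_i a i * f i t) z = \sum_i a i * derive1n k (f i) z.
Proof.
move=> Ez sf; have oE := @open_dom _ _ E.
have [d0 d00 d0E] := open_contains_ball oE Ez.
have [d1 d10 H1] : exists2 d, 0 < d & forall i, smooth_on (nball z d) (f i) /\
    forall t, `|t - z| < d -> dom E t /\ solves E (f i) t.
  apply: finite_lower_bound => [i d d' _ d'd [sfi Hi]|i]; last exact/local_solutionP.
  split; first by apply: smooth_on_sub sfi => t /= td; exact: lt_le_trans d'd.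
  by move=> t td; apply: Hi; exact: lt_le_trans d'd.
have [d [d_0 dd0 dd1]] := pos_lower_bound d00 d10.
have oB : open (nball z d) by exact: open_ball_norm.
have sfB i : smooth_on (nball z d) (f i).
  by have [s _] := H1 i; apply: smooth_on_sub s => t /= td; exact: lt_le_trans dd1.
have zd : `|z - z| < d by rewrite subrr normr0.
split; last by move=> k; exact: (derive1n_lincomb a k oB sfB zd).
apply/local_solutionP; exists d => //; split; first exact: smooth_lincomb.
move=> t td; split; first by apply: d0E; exact: lt_le_trans dd0.
rewrite /solves (derive1n_lincomb a _ oB sfB td).
under [X in _ + X]eq_bigr do rewrite (derive1n_lincomb a _ oB sfB td) mulr_sumr.
rewrite [X in _ + X]exchange_big -big_split /= big1// => i _.
under eq_bigr do rewrite mulrCA.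
rewrite -mulr_sumr -mulrDr; have [_ /(_ t (lt_le_trans td dd1))[_ ->]] := H1 i.
by rewrite mulr0.
Qed.

(** The [psi i] have unit Cauchy data at [z], so [c] is the vector of initial values of the
    combination; its existence and uniqueness are those of Cauchy data. *)
Lemma superposition_group z : dom E z -> superposition_group_dim E z.
Proof.
move=> Ez; have /choice[psi Hpsi] : forall i : 'I_n.+1, exists f, local_solution E z f /\
    forall k : 'I_n.+1, derive1n k f z = (k == i)%:R.
  by move=> i; exact: solution_exists.
have spsi i := (Hpsi i).1.
have lin c := solution_lincomb c Ez spsi.
have der (c : 'rV[K]_n.+1) (k : 'I_n.+1) :
    derive1n k (fun t => \sum_i c ord0 i * psi i t) z = c ord0 k.
  have [_ ->] := lin (fun i => c ord0 i).
  rewrite (bigD1 k)//= (Hpsi k).2 eqxx mulr1 big1 ?addr0// => i ik.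
  by rewrite (Hpsi i).2 eq_sym (negPf ik) mulr0.
exists psi; split.
- move=> c; exists (fun t => \sum_i c ord0 i * psi i t) => //.
  by have [] := lin (fun i => c ord0 i).
- move=> c d; apply/funext => p; rewrite /superposition /=; congr (_, _).
  rewrite -addrA -big_split /=; congr (_ + _); apply: eq_bigr => i _.
  by rewrite mxE; ring.
move=> _ [phi sphi ->]; pose c := \row_i derive1n (i : 'I_n.+1) phi z.
(* The difference of [phi] and the combination is itself a linear combination indexed by [bool],
   which makes it a solution with zero Cauchy data. *)
pose g (b : bool) : K -> K := if b then phi else fun t => \sum_i c ord0 i * psi i t.
have sg b : local_solution E z (g b).
  by case: b => //=; have [] := lin (fun i => c ord0 i).
have [sd dd] := solution_lincomb (fun b : bool => if b then 1 else -1) Ez sg.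
exists c; split.
  have d0 (k : 'I_n.+1) : derive1n k (fun t => \sum_i (if i then 1 else -1) * g i t) z = 0.
    by rewrite dd big_bool /= der mxE; ring.
  apply: filterS (solution_unique sd d0) => t; rewrite big_bool /= mul1r mulN1r => /eqP; rewrite subr_eq0 => /eqP E0 x.
  by rewrite /superposition /= E0.
move=> c' Hc'; apply/rowP => k; rewrite mxE.
rewrite -(der c' k).
have /near0_normP[e e0 He] := Hc'.
have oB : open (nball z e) by exact: open_ball_norm.
have near_eq : forall t, `|t - z| < e -> phi t = \sum_i c' ord0 i * psi i t.
  by move=> t te; have := He t te 0; rewrite /superposition /= !add0r => -[].
move: (nat_of_ord k) => m; have zz : `|z - z| < e by rewrite subrr normr0.
suff H : forall t, `|t - z| < e ->
  derive1n m phi t = derive1n m (fun t => \sum_i c' ord0 i * psi i t) t by exact: H.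
elim: m => [|m IH] t te; first by rewrite !derive1n0; exact: near_eq.
rewrite !derive1nS !derive1E; apply: near_eq_derive.
by apply: filterS (open_nbhs_nbhs (conj oB te)) => s; exact: IH.
Qed.

End HomogeneousEquations.

(** * Determining equations *)

Section JetCalculus.
Variable K : numFieldType.
Hypothesis archK : archimedean_field K.
Hypothesis compK : geometrically_complete K.
Variable r : nat.
Local Notation J := (jet K r).

Definition dir_t : J := (1, 0).
Definition dir_x (k : nat) : J := (0, delta_mx ord0 (inord k)).

Lemma jx_dir_x k m : (k <= r)%N -> (m <= r)%N -> jx (dir_x k) m = (m == k)%:R.
Proof.
move=> kr mr; rewrite /jx /= mxE eqxx /=; congr (nat_of_bool _)%:R.
by rewrite -val_eqE /= !inordK.
Qed.

Lemma total_direction_sum (j : J) :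
  total_direction j = dir_t + \sum_(k < r) jx j k.+1 *: dir_x k.
Proof.
have [l1 _] := fst_linear_continuous K 'rV[K]_r.+1.
have [l2 _] := snd_linear_continuous K 'rV[K]_r.+1.
rewrite [RHS]surjective_pairing; congr (_, _).
  rewrite /= -[X in 1 + X]/(linear_map l1 (\sum_(k < r) jx j k.+1 *: dir_x k)).
  rewrite linear_sum big1 ?addr0//= => k _.
  exact: mulr0.
rewrite /= -[X in 0 + X]/(linear_map l2 (\sum_(k < r) jx j k.+1 *: dir_x k)).
rewrite linear_sum add0r; apply/rowP => m; rewrite summxE mxE /=.
case: ltnP => mr.
  rewrite (bigD1 (Ordinal mr))//= !mxE eqxx /= inord_val eqxx mulr1 big1 ?addr0//.
  move=> k km; rewrite !mxE eqxx /=.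
  have -> : m == inord k = false.
    apply/negbTE; apply: contra km => /eqP E; apply/eqP/val_inj => /=.
    by rewrite E inordK// ltnW// ltnS.
  exact: mulr0.
rewrite big1// => k _; rewrite !mxE eqxx /=.
have -> : m == inord k = false.
  apply/negbTE/eqP => E; have kr := ltn_ord k.
  have : m = k :> nat by rewrite E inordK// ltnS ltnW.
  by move=> mk; move: mr; rewrite mk leqNgt kr.
exact: mulr0.
Qed.

Variable O : set J.
Hypothesis oO : open O.

Lemma total_derivativeE (G : J -> K) j : differentiable G j ->
  total_derivative G j =
  'D_dir_t G j + \sum_(k < r) jx j k.+1 * 'D_(dir_x k) G j.
Proof.
move=> dG; rewrite /total_derivative -/(total_direction j) total_direction_sum.
rewrite deriveE// linearD linear_sum -deriveE//; congr (_ + _).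
by apply: eq_bigr => k _; rewrite linearZ /= -deriveE.
Qed.

Lemma diff_times_jx n k : diff_times n O (fun j => jx j k).
Proof. exact: diff_times_linear_fun (@jx_linear K r k) (@jx_continuous K r k). Qed.

Lemma total_derivative_eq (G H : J -> K) j : (forall i, O i -> G i = H i) -> O j ->
  total_derivative G j = total_derivative H j.
Proof.
move=> GH Oj; apply: near_eq_derive.
by apply: filterS (open_nbhs_nbhs (conj oO Oj)) => i; exact: GH.
Qed.

Lemma smooth_total_derivative (G : J -> K) :
  smooth_on O G -> smooth_on O (total_derivative G).
Proof.
move=> sG; apply/smooth_onP => n.
apply: (@diff_times_congr _ _ _ n O (fun j => 'D_dir_t G j +
   \sum_(k < r) jx j k.+1 * 'D_(dir_x k) G j)) => //.
  by move=> j Oj; rewrite total_derivativeE//; exact: (sG [::]).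
apply: diff_timesD => //; first exact: smooth_diff_times (smooth_derive _ sG).
apply: diff_times_sum => // k; apply: diff_timesM => //; first exact: diff_times_jx.
exact: smooth_diff_times (smooth_derive _ sG).
Qed.

Lemma derive_commute_on (V : normedModType K) (U : set V) (f : V -> K) v w p :
  open U -> smooth_on U f -> U p -> 'D_v ('D_w f) p = 'D_w ('D_v f) p.
Proof.
move=> oU sf Up; apply: (derive_commute archK compK).
- by apply: filterS (open_nbhs_nbhs (conj oU Up)) => q; exact: (sf [::]).
- exact: (sf [:: v]).
- exact: (sf [:: w]).
Qed.

Lemma derive_is_derive (V : normedModType K) (U : set V) (f : V -> K) v p :
  smooth_on U f -> U p -> is_derive p v f ('D_v f p).
Proof.
by move=> sf Up; apply: derivableP; apply: diff_derivable; exact: (sf [::]).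
Qed.

(** The commutator of d/dx_m with D_t is d/dx_(m-1); it rests on the symmetry of second
    derivatives. *)
Lemma derive_total_derivative (G : J -> K) m j : (m <= r)%N -> smooth_on O G -> O j ->
  'D_(dir_x m) (total_derivative G) j =
  total_derivative ('D_(dir_x m) G) j + (if m is m'.+1 then 'D_(dir_x m') G j else 0).
Proof.
move=> mr sG Oj; have sDG v := smooth_derive v sG.
have -> : 'D_(dir_x m) (total_derivative G) j = 'D_(dir_x m) (fun j => 'D_dir_t G j +
   \sum_(k < r) jx j k.+1 * 'D_(dir_x k) G j) j.
  apply: near_eq_derive; apply: filterS (open_nbhs_nbhs (conj oO Oj)) => i Oi.
  by rewrite total_derivativeE//; exact: (sG [::]).
have dd : is_derive j (dir_x m) (fun j => 'D_dir_t G j +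
   \sum_(k < r) jx j k.+1 * 'D_(dir_x k) G j)
   ('D_(dir_x m) ('D_dir_t G) j + \sum_(k < r)
     (jx j k.+1 * 'D_(dir_x m) ('D_(dir_x k) G) j + 'D_(dir_x k) G j * (k.+1 == m)%:R)).
  apply: is_deriveD; first exact: derive_is_derive Oj.
  apply: is_derive_sum_seq => k; have := is_derive_jx j (dir_x m) k.+1.
  rewrite jx_dir_x// => d1; exact: is_deriveM d1 (derive_is_derive (dir_x m) (sDG (dir_x k)) Oj).
have [_ ->] := dd.
rewrite total_derivativeE; last exact: (sDG _ [::]).
rewrite (derive_commute_on (dir_x m) dir_t oO sG Oj) -addrA.
apply: (congr1 (fun x => _ + x)).
rewrite big_split /=; apply: (congr2 (fun x y => x + y)).
  by apply: eq_bigr => k _; rewrite (derive_commute_on (dir_x m) (dir_x k) oO sG Oj).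
case: m mr {dd} => [|m] mr; first by rewrite big1// => k _; rewrite mulr0.
rewrite (bigD1 (Ordinal mr))//= eqxx mulr1 big1 ?addr0// => k km.
by rewrite eqSS -[_ == m]/(k == Ordinal mr) (negPf km) mulr0.
Qed.

End JetCalculus.

Section BaseFunctions.
Variable K : numFieldType.
Variable r : nat.
Variable Om : set (K * K).
Hypothesis oOm : open Om.

Definition jets_over : set (jet K r) := [set j | Om (base j)].

Lemma open_jets_over : open jets_over.
Proof. exact: open_base_preimage. Qed.

Lemma smooth_base (f : K * K -> K) :
  smooth_on Om f -> smooth_on jets_over (fun j => f (base j)).
Proof.
move=> sf; apply/smooth_onP => n.
have := @diff_times_affine K n _ _ _ jets_over Om (linear_map (@base_linear K r)) 0 f
  open_jets_over (@base_continuous K r).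
have -> : (fun p => f (0 + linear_map (@base_linear K r) p)) = (fun j => f (base j)).
  by apply/funext => j; rewrite add0r.
by apply; [move=> p; rewrite add0r|exact: smooth_diff_times].
Qed.

Lemma derive_base (f : K * K -> K) (j v : jet K r) : smooth_on Om f -> Om (base j) ->
  'D_v (fun i => f (base i)) j = 'D_(base v) f (base j).
Proof.
move=> sf Oj; have dfp : differentiable f (base j) by exact: (sf [::]).
have := @is_derive_diff K _ _ f (base j) (base v) dfp => /is_derive_lineP d1.
have [_ ->] : is_derive j v (fun i => f (base i)) ('d f (base j) (base v)).
  apply/is_derive_lineP; move: d1; congr (is_derive _ _ _ _).
  by apply/funext => h; rewrite [j + _]addrC base_linear addrC.
by rewrite deriveE.
Qed.

Hypothesis r1 : (1 < r)%N.

Lemma total_derivative_base (f : K * K -> K) (j : jet K r) : smooth_on Om f -> Om (base j) ->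
  total_derivative (fun i => f (base i)) j =
  'D_((1, 0) : K * K) f (base j) + jx j 1 * 'D_((0, 1) : K * K) f (base j).
Proof.
move=> sf Oj; rewrite /total_derivative -/(total_direction j) derive_base//.
have dfp : differentiable f (base j) by exact: (sf [::]).
have -> : base (total_direction j) = (1, 0) + jx j 1 *: (0, 1) :> K * K.
  rewrite /base jx_total_direction// (ltnW r1); congr (_, _); rewrite /= ?add0r.
    by rewrite [_ *: 0]mulr0 addr0.
  by rewrite [_ *: 1]mulr1.
by rewrite !deriveE// linearD linearZ.
Qed.

Lemma is_derive_total_base (f : K * K -> K) (j : jet K r) : smooth_on Om f -> Om (base j) ->
  is_derive j (total_direction j) (fun i => f (base i))
    ('D_((1, 0) : K * K) f (base j) + jx j 1 * 'D_((0, 1) : K * K) f (base j)).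
Proof.
move=> sf Oj; rewrite -(total_derivative_base sf Oj).
exact (derive_is_derive (total_direction j) (smooth_base sf) Oj).
Qed.

End BaseFunctions.

(** * Necessity: vanishing of T_x and the determining equations *)

Section Necessity.
Variable K : numFieldType.
Hypothesis archK : archimedean_field K.
Hypothesis compK : geometrically_complete K.
Variable r : nat.
Hypothesis hr : (3 <= r)%N.
Variables (E E' : equation K r) (Om : set (K * K)) (F : K * K -> K * K).
Hypothesis adm : admissible E E' Om F.

Let r1 : (1 < r)%N := ltnW hr.

Let oOm : open Om. Proof. by case: adm => -[]. Qed.
Let smooth_F : smooth_on Om F. Proof. by case: adm => -[]. Qed.

Local Notation T := (fun q => (F q).1).
Local Notation X := (fun q => (F q).2).
Local Notation Dt f := ('D_((1, 0) : K * K) f).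
Local Notation Dx f := ('D_((0, 1) : K * K) f).

Lemma smooth_fst_F : smooth_on Om T.
Proof.
have [lf cf] := fst_linear_continuous K K; apply/smooth_onP => n.
exact: (diff_times_linl (L := linear_map lf) oOm cf (smooth_diff_times n smooth_F)).
Qed.

Lemma smooth_snd_F : smooth_on Om X.
Proof.
have [lf cf] := snd_linear_continuous K K; apply/smooth_onP => n.
exact: (diff_times_linl (L := linear_map lf) oOm cf (smooth_diff_times n smooth_F)).
Qed.

Lemma jacobian_neq0 p : Om p -> Dt T p * Dx X p - Dx T p * Dt X p != 0.
Proof.
move=> Op; case: adm => -[_ sF /(_ p Op)] + _ _; rewrite /jacobian2.
have dF : differentiable F p by exact: (sF [::]).
have e1 v : 'D_v T p = ('D_v F p).1 by rewrite (derive_fst_comp v dF).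
have e2 v : 'D_v X p = ('D_v F p).2 by rewrite (derive_snd_comp v dF).
by rewrite !e1 !e2.
Qed.

Local Notation O := (jets_over (r := r) Om).
Let oO : open O. Proof. exact: open_jets_over. Qed.

Definition mkjet (t : K) (xs : nat -> K) : jet K r := (t, \row_(k < r.+1) xs k).

Lemma jx_mkjet t xs k : (k <= r)%N -> jx (mkjet t xs) k = xs k.
Proof. by move=> kr; rewrite /jx /= mxE inordK. Qed.

(** Parametrises the jets satisfying [E]: the coordinates of order below [r] are free and the top
    one is solved for. *)
Definition solution_jet (t : K) (xs : nat -> K) : jet K r :=
  mkjet t (fun k => if k == r then - \sum_(i < r.-1) coef E t ord0 i * xs i else xs k).

Lemma coef_index_ltn (i : 'I_r.-1) : (i < r)%N.
Proof. by apply: leq_trans (ltn_ord i) (leq_pred r). Qed.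

Lemma jx_solution_jet t xs k : (k < r)%N -> jx (solution_jet t xs) k = xs k.
Proof. by move=> kr; rewrite jx_mkjet ?(ltn_eqF kr)// ltnW. Qed.

Lemma holds_solution_jet t xs : holds E (solution_jet t xs).
Proof.
rewrite /holds jx_mkjet// eqxx /= addrC; apply/eqP; rewrite subr_eq0; apply/eqP.
apply: eq_bigr => i _; rewrite jx_solution_jet//; exact: coef_index_ltn.
Qed.

Lemma base_solution_jet t xs : base (solution_jet t xs) = (t, xs 0%N).
Proof. by rewrite /base jx_solution_jet//; exact: ltn_trans r1. Qed.

Lemma DtTE j : O j -> DtT F j = Dt T (base j) + jx j 1 * Dx T (base j).
Proof. by move=> Oj; rewrite /DtT (total_derivative_base r1 smooth_fst_F Oj). Qed.

Lemma smooth_DtT : smooth_on O (@DtT K r F).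
Proof. exact (smooth_total_derivative oO (smooth_base oOm smooth_fst_F)). Qed.

Lemma near_DtT_neq0 j : O j -> DtT F j != 0 -> \forall i \near j, O i /\ DtT F i != 0.
Proof.
move=> Oj q0; have dq : differentiable (@DtT K r F) j by exact: (smooth_DtT [::]).
apply: filterI; first exact: (open_nbhs_nbhs (conj oO Oj)).
have cq := differentiable_continuous dq.
by apply: (cq [set y | y != 0]); exact: near_neq0.
Qed.

(* Numerators: the prolongation of order k + 1 is [numer k / DtT ^ (2 k + 1)]. *)
Fixpoint numer (k : nat) (j : jet K r) : K :=
  if k is k'.+1 then
    DtT F j * total_derivative (numer k') j
    - (2 * k' + 1)%:R * numer k' j * total_derivative (@DtT K r F) j
  else total_derivative (fun i => X (base i)) j.

Lemma smooth_numer k : smooth_on O (numer k).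
Proof.
elim: k => [|k IH].
  exact (smooth_total_derivative oO (smooth_base oOm smooth_snd_F)).
have sq := smooth_DtT; have sD := smooth_total_derivative oO IH.
have sDq := smooth_total_derivative oO sq.
have -> : numer k.+1 = fun j => DtT F j * total_derivative (numer k) j
    + (- (2 * k + 1)%:R) * (numer k j * total_derivative (@DtT K r F) j).
  by apply/funext => j /=; ring.
apply/smooth_onP => n; apply: diff_timesD => //; apply: diff_timesM => //;
  try exact: smooth_diff_times; first exact: diff_times_cst.
by apply: diff_timesM => //; exact: smooth_diff_times.
Qed.

(** The quotient rule for N / D^(2k+1) followed by a division by D raises the exponent by two and
    produces the recursion of [numer]. *)
Lemma prolong_x_numer k j : O j -> DtT F j != 0 ->
  prolong_x F k.+1 j = numer k j / DtT F j ^+ (2 * k + 1).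
Proof.
elim: k j => [|k IH] j Oj q0; first by rewrite prolong_xS muln0 add0n expr1.
rewrite prolong_xS.
have -> : total_derivative (prolong_x F k.+1) j =
    total_derivative (fun i => numer k i / DtT F i ^+ (2 * k + 1)) j.
  apply: near_eq_derive; apply: filterS (near_DtT_neq0 Oj q0) => i [Oi qi].
  exact: IH.
have dN := derive_is_derive (total_direction j) (smooth_numer k) Oj.
have dq := derive_is_derive (total_direction j) smooth_DtT Oj.
have qn0 : DtT F j ^+ (2 * k + 1) != 0 by rewrite expf_neq0.
have dqX := @is_deriveX _ _ (@DtT K r F) (2 * k).+1 j _ _ dq.
have qE : (@DtT K r F) ^+ (2 * k).+1 = (fun i => DtT F i ^+ (2 * k + 1)).
  by apply/funext => i; rewrite addn1 fctE.
rewrite qE in dqX; have [_ E0] := is_derive_div dN dqX qn0.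
rewrite /total_derivative -/(total_direction j) E0.
have -> : numer k.+1 j = DtT F j * 'D_(total_direction j) (numer k) j
    - (2 * k + 1)%:R * numer k j * 'D_(total_direction j) (@DtT K r F) j by [].
move: ('D_ _ (numer k) j) ('D_ _ (@DtT K r F) j) (numer k j) (DtT F j) q0 {E0 dN dq qn0 dqX qE IH}.
move=> dN dq N q q0; rewrite [_.+1.-1]/= /GRing.scale /=.
have -> : (2 * k.+1 + 1 = 2 * k + 1 + 2)%N by lia.
have -> : ((2 * k).+1 = 2 * k + 1)%N by lia.
rewrite !exprD expr1; field; rewrite q0 expf_neq0//.
Qed.

Lemma total_derivative_DtT j : O j -> total_derivative (@DtT K r F) j =
  (Dt (Dt T) (base j) + jx j 1 * Dx (Dt T) (base j))
  + jx j 1 * (Dt (Dx T) (base j) + jx j 1 * Dx (Dx T) (base j))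
  + Dx T (base j) * jx j 2.
Proof.
move=> Oj; have st := smooth_derive ((1, 0) : K * K) smooth_fst_F.
have sx := smooth_derive ((0, 1) : K * K) smooth_fst_F.
rewrite (total_derivative_eq oO (H := fun j => Dt T (base j) + jx j 1 * Dx T (base j)))//;
  last by move=> i; exact: DtTE.
have d1 := is_derive_total_base oOm r1 st Oj.
have d2 := is_derive_total_base oOm r1 sx Oj.
have := is_derive_jx j (total_direction j) 1.
rewrite jx_total_direction ?(ltnW r1)// r1 => d3.
have [_ E0] := is_deriveD d1 (is_deriveM d3 d2).
by rewrite /total_derivative -/(total_direction j) E0 addrA.
Qed.

(** Continuity along a line; it reaches the jets with D_t T = 0, where admissibility imposes
    nothing. *)
Lemma smooth_eq0_limit (G : jet K r -> K) (j w : jet K r) : smooth_on O G -> O j ->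
  (forall s : K, s != 0 -> G (j + s *: w) = 0) -> G j = 0.
Proof.
move=> sG Oj G0; apply/eqP; rewrite -normr_le0 real_leNgt ?real0//; apply/negP => Gj.
have /is_derive_dirP/(_ 1 ltr01)/near0_normP[d d0 Hd] := derive_is_derive w sG Oj.
set a := 'D_w G j in Hd.
have c0 : 0 < `|a| + 1 by rewrite ltr_pwDr.
have e0 : 0 < `|G j| / (`|a| + 1) by rewrite divr_gt0.
have [h [h0 hd he]] := pos_lower_bound d0 e0.
have h2 : 0 < h / 2 by rewrite divr_gt0.
have hh : h / 2 < h by rewrite ltr_pdivrMr// ltr_pMr// ltr1n.
have := Hd (h / 2); rewrite subr0 (gtr0_norm h2) => /(_ (lt_le_trans hh hd)).
rewrite G0 ?gt_eqF// sub0r mul1r => H.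
have : `|G j| <= h / 2 * (`|a| + 1).
  have -> : G j = - ((- G j - h / 2 * a) + h / 2 * a) by ring.
  rewrite normrN; apply: le_trans (ler_normD _ _) _.
  by rewrite normrM (gtr0_norm h2) mulrDr mulr1 addrC lerD2l.
rewrite -ler_pdivrMr// => H2.
by have := lt_le_trans (le_lt_trans H2 hh) he; rewrite ltxx.
Qed.

Lemma diff_timesX n (G : jet K r -> K) k :
  diff_times n O G -> diff_times n O (fun j => G j ^+ k).
Proof.
move=> DG; elim: k => [|k IH].
  have -> : (fun j => G j ^+ 0) = (fun=> 1) by apply/funext => j; rewrite expr0.
  exact: diff_times_cst.
have -> : (fun j => G j ^+ k.+1) = (fun j => G j * G j ^+ k).
  by apply/funext => j; rewrite exprS.
exact: diff_timesM.
Qed.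

(* [prolong_x F i * DtT ^ (2 r - 1)] is divisible by [DtT] for [i < r - 1]. *)
Definition lower_numer (i : nat) (j : jet K r) : K :=
  if i is k.+1 then numer k j * DtT F j ^+ (2 * (r.-1 - k)).-1
  else (F (base j)).2 * DtT F j ^+ (2 * r.-1).

Lemma smooth_lower_numer i : smooth_on O (lower_numer i).
Proof.
apply/smooth_onP => n; case: i => [|k] /=; apply: diff_timesM => //.
- exact (smooth_diff_times n (smooth_base oOm smooth_snd_F)).
- by apply: diff_timesX; exact: smooth_diff_times smooth_DtT.
- exact: smooth_diff_times (smooth_numer k).
- by apply: diff_timesX; exact: smooth_diff_times smooth_DtT.
Qed.

Lemma lower_numerE i j : (i < r.-1)%N -> O j -> DtT F j != 0 ->
  prolong_x F i j * DtT F j ^+ (2 * r.-1 + 1) = lower_numer i j * DtT F j.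
Proof.
move=> ir Oj q0; rewrite /lower_numer; case: i ir => [|k] kr.
  by rewrite exprD expr1 mulrA.
rewrite prolong_x_numer//.
have -> : (2 * r.-1 + 1 = (2 * k + 1) + ((2 * (r.-1 - k)).-1 + 1))%N by lia.
rewrite !exprD expr1; field; rewrite q0 expf_neq0//.
Qed.

Lemma prolong_holds j : O j -> DtT F j != 0 -> holds E j ->
  prolong_x F r j + \sum_(i < r.-1) coef E' (F (base j)).1 ord0 i * prolong_x F i j = 0.
Proof.
move=> Oj q0 Ej; case: adm => _ _ /(_ j Oj q0)[/(_ Ej) H _].
rewrite /holds /= in H; rewrite -[RHS]H.
by rewrite /jx /= mxE inordK//; congr (_ + _); apply: eq_bigr => i _; rewrite mxE inordK// ltnS ltnW// coef_index_ltn.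
Qed.

(* If [T_x != 0], choose a jet over [p] where [DtT] vanishes while its total
   derivative is 1.  Approaching it along a line of jets of solutions, the
   prolonged equation times [DtT ^ (2 r - 1)] leaves [numer r.-1 = 0]; but at that
   jet [numer k] is a nonzero multiple of the Jacobian. *)
Lemma Dx_fst_eq0 p : Om p -> Dx T p = 0.
Proof.
move=> Op; apply/eqP; apply: contraT => b0.
pose b := Dx T p; pose a := Dt T p; pose x1 := - a / b.
have bn0 : b != 0 by [].
pose stuff := (Dt (Dt T) p + x1 * Dx (Dt T) p) + x1 * (Dt (Dx T) p + x1 * Dx (Dx T) p).
(* [x1] makes D_t T vanish. In D_t (D_t T) the coordinate x_2 has coefficient [b], so this value of
   x_2 makes the total derivative 1; it is at our disposal because 2 < r. *)
pose xs (k : nat) := if k is 0 then p.2 else if k == 1%N then x1 else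
  if k == 2 then (1 - stuff) / b else 0.
pose js := solution_jet p.1 xs.
(* Moves x_1 and lets the top coordinate compensate, so the line stays within [E]; along it D_t T
   equals s b. *)
pose w := mkjet 0 (fun k => if k == r then - \sum_(i < r.-1) coef E p.1 ord0 i * (i == 1%N :> nat)%:R
  else (k == 1%N)%:R).
pose path s := js + s *: w.
have bjs : base js = p by rewrite base_solution_jet /=; case: (p).
have jxp s k : (k <= r)%N -> jx (path s) k = jx js k + s * jx w k.
  by move=> kr; rewrite /path /jx /= !mxE.
have r_gt0 : (0 < r)%N by exact: ltn_trans r1.
have path1 s : (path s).1 = p.1 by rewrite /path /= [s *: 0]mulr0 addr0.
have bpath s : base (path s) = p.
  rewrite /base path1 jxp// [jx w 0]jx_mkjet//.
  rewrite (ltn_eqF r_gt0) /= mulr0 addr0.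
  by rewrite jx_solution_jet//=; case: (p).
have Opath s : O (path s) by rewrite /jets_over /= bpath.
have Ojs : O js by rewrite /jets_over /= bjs.
have jx1 s : jx (path s) 1 = x1 + s.
  rewrite jxp ?(ltnW r1)// jx_solution_jet//= [jx w 1]jx_mkjet ?(ltnW r1)//.
  by rewrite (ltn_eqF r1) eqxx mulr1.
have q_path s : DtT F (path s) = s * b.
  by rewrite DtTE// bpath jx1 -/a -/b /x1 mulrDl divfK// addrA subrr add0r.
have q_js : DtT F js = 0.
  by rewrite DtTE// bjs jx_solution_jet//= -/a -/b /x1 divfK// subrr.
have Dq_js : total_derivative (@DtT K r F) js = 1.
  rewrite total_derivative_DtT// bjs !jx_solution_jet//=.
  by rewrite -/stuff -/b; field.
have Epath s : holds E (path s).
  rewrite /holds path1 jxp// [jx w r]jx_mkjet// eqxx.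
  rewrite [X in _ + X](eq_bigr (fun i : 'I_r.-1 => coef E p.1 ord0 i * jx js i +
     s * (coef E p.1 ord0 i * (i == 1%N :> nat)%:R))); last first.
    move=> i _; have ir := coef_index_ltn i.
    by rewrite jxp 1?ltnW// [jx w i]jx_mkjet ?(ltn_eqF ir) 1?ltnW//; ring.
  rewrite big_split /= -mulr_sumr addrACA mulrN addNr addr0.
  exact: holds_solution_jet.
pose H j := numer r.-1 j + \sum_(i < r.-1) coef E' (F p).1 ord0 i * (lower_numer i j * DtT F j).
have sH : smooth_on O H.
  apply/smooth_onP => n; apply: diff_timesD => //; first exact: smooth_diff_times (smooth_numer _).
  apply: diff_times_sum => // i; apply: diff_timesM => //; first exact: diff_times_cst.
  apply: diff_timesM => //; first exact: smooth_diff_times (smooth_lower_numer i).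
  exact: smooth_diff_times smooth_DtT.
have H0 : H js = 0.
  apply: (@smooth_eq0_limit H js w) => // s s0.
  rewrite -/(path s).
  have q0 : DtT F (path s) != 0 by rewrite q_path mulf_neq0.
  have := prolong_holds (Opath s) q0 (Epath s); rewrite bpath => H1.
  have := congr1 (fun x => x * DtT F (path s) ^+ (2 * r.-1 + 1)) H1.
  rewrite mul0r mulrDl mulr_suml => <-; rewrite /H; congr (_ + _).
    have := @prolong_x_numer r.-1 (path s) (Opath s) q0; rewrite prednK// => ->.
    by rewrite divfK// expf_neq0.
  by apply: eq_bigr => i _; rewrite -mulrA lower_numerE.
(* At [js] the recursion reads N_(k+1) = -(2k + 1) N_k, and N_0 = X_t - (T_t / T_x) X_x is minus the
   Jacobian divided by T_x. *)
have N0 k : numer k js != 0.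
  elim: k => [|k IH].
    rewrite /= (total_derivative_base r1 smooth_snd_F Ojs) bjs jx_solution_jet//=.
    have := jacobian_neq0 Op; apply: contraNneq => E0.
    have -> : Dt T p = - x1 * b by rewrite /x1 /a; field.
    rewrite -/b; have -> : Dt X p = - (x1 * Dx X p) by apply/eqP; rewrite -addr_eq0 E0.
    by apply/eqP; ring.
  have -> : numer k.+1 js = DtT F js * total_derivative (numer k) js
    - (2 * k + 1)%:R * numer k js * total_derivative (@DtT K r F) js by [].
  rewrite q_js Dq_js mul0r sub0r mulr1 oppr_eq0.
  by rewrite mulf_neq0// addn1 pnatr_eq0.
have := N0 r.-1; apply: contraNT => _; apply/eqP; rewrite -H0 /H big1 ?addr0// => i _.
by rewrite q_js !mulr0.
Qed.

Lemma DtT_base j : O j -> DtT F j = Dt T (base j).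
Proof. by move=> Oj; rewrite DtTE// Dx_fst_eq0// mulr0 addr0. Qed.

Lemma Dt_fst_neq0 p : Om p -> Dt T p != 0.
Proof.
move=> Op; have := jacobian_neq0 Op; rewrite Dx_fst_eq0// mul0r subr0.
by rewrite mulf_eq0 negb_or => /andP[].
Qed.

Lemma Dx_snd_neq0 p : Om p -> Dx X p != 0.
Proof.
move=> Op; have := jacobian_neq0 Op; rewrite Dx_fst_eq0// mul0r subr0.
by rewrite mulf_eq0 negb_or => /andP[].
Qed.

Lemma DtT_neq0 j : O j -> DtT F j != 0.
Proof. by move=> Oj; rewrite DtT_base// Dt_fst_neq0. Qed.

Lemma Dx_Dt_fst p : Om p -> Dx (Dt T) p = 0.
Proof.
move=> Op; transitivity (Dt (Dx T) p).
  exact (derive_commute_on archK compK ((0, 1) : K * K) ((1, 0) : K * K) oOm smooth_fst_F Op).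
rewrite (@near_eq_derive _ _ _ _ (fun=> 0)) ?derive_cst//.
by apply: filterS (open_nbhs_nbhs (conj oOm Op)) => q; exact: Dx_fst_eq0.
Qed.

Lemma base_dir_x m : (m <= r)%N -> base (dir_x K r m) = (m == 0%N)%:R *: (0, 1) :> K * K.
Proof.
move=> mr; rewrite /base jx_dir_x// eq_sym; congr (_, _); first by rewrite /= [_ *: 0]mulr0.
by rewrite /= [_ *: 1]mulr1.
Qed.

Lemma derive_dir_x_base (f : K * K -> K) m j : smooth_on Om f -> O j -> (m <= r)%N ->
  'D_(dir_x K r m) (fun i => f (base i)) j = (m == 0%N)%:R * Dx f (base j).
Proof.
move=> sf Oj mr; rewrite (derive_base _ sf Oj) base_dir_x//.
have dfp : differentiable f (base j) by exact: (sf [::]).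
by rewrite !deriveE// linearZ.
Qed.

Lemma derive_DtT m j : O j -> (m <= r)%N -> 'D_(dir_x K r m) (@DtT K r F) j = 0.
Proof.
move=> Oj mr; rewrite (@near_eq_derive _ _ _ _ (fun j : jet K r => Dt T (base j))).
  by rewrite (derive_dir_x_base (smooth_derive _ smooth_fst_F) Oj mr) Dx_Dt_fst// mulr0.
by apply: filterS (open_nbhs_nbhs (conj oO Oj)) => i; exact: DtT_base.
Qed.

Lemma smooth_prolong_x k : smooth_on O (prolong_x F k).
Proof.
elim: k => [|k IH]; first exact (smooth_base oOm smooth_snd_F).
apply/smooth_onP => n.
apply: (@diff_timesM _ n _ O (total_derivative (prolong_x F k)) (fun j => (DtT F j)^-1)) => //.
  exact: smooth_diff_times (smooth_total_derivative oO IH).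
apply: diff_timesV => //; first by move=> j; exact: DtT_neq0.
exact: smooth_diff_times smooth_DtT.
Qed.

(** D_t T is now constant along every x_m, so only the commutator of d/dx_m with D_t acts. The
    recursion of [prolong_coef] reappears although X is not yet known to be affine in x. *)
Lemma derive_prolong_xS k m j : O j -> (m <= r)%N ->
  'D_(dir_x K r m) (prolong_x F k.+1) j =
  (total_derivative ('D_(dir_x K r m) (prolong_x F k)) j +
    (if m is m'.+1 then 'D_(dir_x K r m') (prolong_x F k) j else 0)) / DtT F j.
Proof.
move=> Oj mr; have q0 := DtT_neq0 Oj.
have sD := smooth_total_derivative oO (smooth_prolong_x k).
have d1 := derive_is_derive (dir_x K r m) sD Oj.
have d2 := derive_is_derive (dir_x K r m) smooth_DtT Oj; rewrite derive_DtT// in d2.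
have [_ E0] := is_derive_div d1 d2 q0.
rewrite -(derive_total_derivative archK compK oO mr (smooth_prolong_x k) Oj).
transitivity (('D_(dir_x K r m) (total_derivative (prolong_x F k)) j
  - total_derivative (prolong_x F k) j * 0 / DtT F j) / DtT F j); first exact E0.
move: (total_derivative _ j) ('D_ _ _ j) => N D1.
by rewrite mulr0 mul0r subr0.
Qed.

Lemma total_derivative_eq0 (G : jet K r -> K) j : (forall i, O i -> G i = 0) -> O j ->
  total_derivative G j = 0.
Proof.
move=> G0 Oj; rewrite (total_derivative_eq oO (H := fun=> 0))//.
by rewrite /total_derivative derive_cst.
Qed.

Lemma derive_prolong_x_gt k m j : O j -> (k < m <= r)%N ->
  'D_(dir_x K r m) (prolong_x F k) j = 0.
Proof.
elim: k m j => [|k IH] [|m] j Oj // /andP[km mr].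
  have -> : prolong_x F 0 = (fun i : jet K r => (F (base i)).2) by [].
  by rewrite (derive_dir_x_base smooth_snd_F Oj mr) mul0r.
rewrite derive_prolong_xS// IH// ?(ltnW mr) ?andbT//.
rewrite total_derivative_eq0 ?addr0 ?mul0r// => i Oi.
by apply: IH => //; rewrite mr (ltnW km).
Qed.

Lemma derive_prolong_x_diag k j : O j -> (k <= r)%N ->
  'D_(dir_x K r k) (prolong_x F k) j = Dx X (base j) / DtT F j ^+ k.
Proof.
move=> Oj; elim: k => [|k IH] kr.
  have -> : prolong_x F 0 = (fun i : jet K r => (F (base i)).2) by [].
  by rewrite (derive_dir_x_base smooth_snd_F Oj kr) eqxx mul1r expr0 divr1.
rewrite derive_prolong_xS// IH 1?ltnW//.
rewrite total_derivative_eq0 ?add0r ?exprS ?invfM; first by rewrite mulrAC mulrA.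
  by move=> i Oi; rewrite derive_prolong_x_gt// ltnSn.
exact: Oj.
Qed.

Let u := fun j : jet K r => Dx X (base j).

(** The summation of [prolong_coef_subdiag], with total derivatives because X_x may still depend on
    x. *)
Lemma derive_prolong_x_subdiag k j : O j -> (k < r)%N ->
  'D_(dir_x K r k) (prolong_x F k.+1) j =
  (k.+1%:R * total_derivative u j
   - (k.+1 * k)%:R / 2 * (u j * total_derivative (@DtT K r F) j / DtT F j))
  / DtT F j ^+ k.+1.
Proof.
move=> Oj; have q0 := DtT_neq0 Oj.
have su : smooth_on O u := smooth_base oOm (smooth_derive _ smooth_snd_F).
have step m : (m <= r)%N -> total_derivative ('D_(dir_x K r m) (prolong_x F m)) j =
   (total_derivative u j - m%:R * u j * total_derivative (@DtT K r F) j / DtT F j)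
   / DtT F j ^+ m.
  move=> mr; rewrite (total_derivative_eq oO (H := fun i => u i / DtT F i ^+ m)); last first.
  - exact: Oj.
  - by move=> i Oi; rewrite derive_prolong_x_diag.
  have d1 := derive_is_derive (total_direction j) su Oj.
  have d2 := derive_is_derive (total_direction j) smooth_DtT Oj.
  case: m mr => [|m] mr.
    rewrite !mul0r subr0 expr0 divr1; congr (total_derivative _ _).
    by apply/funext => i; rewrite expr0 divr1.
  have dqX := @is_deriveX _ _ (@DtT K r F) m.+1 j _ _ d2.
  have qE : (@DtT K r F) ^+ m.+1 = (fun i => DtT F i ^+ m.+1).
    by apply/funext => i; rewrite fctE.
  have qn0 : DtT F j ^+ m.+1 != 0 by rewrite expf_neq0.
  rewrite qE in dqX; have [_ E0] := is_derive_div d1 dqX qn0.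
  rewrite /total_derivative -/(total_direction j) E0.
  move: ('D_ _ u j) ('D_ _ (@DtT K r F) j) (u j) (DtT F j) q0 => du dq u0 q q0.
  by rewrite /GRing.scale /= exprS; field; rewrite q0 expf_neq0.
elim: k => [|k IH] kr.
  rewrite derive_prolong_xS// step// addr0 muln0 !mul0r subr0 expr0 divr1 mul1r expr1.
  by rewrite subr0.
rewrite derive_prolong_xS ?(ltnW kr)// step ?(ltnW kr)// IH 1?ltnW//.
move: (total_derivative u j) (total_derivative (@DtT K r F) j) (u j) (DtT F j) q0 => du dq u0 q q0.
rewrite !exprS !natrM -!natr1; field; rewrite q0 expf_neq0//.
Qed.

(* The direction [x_(r - 1)] is tangent to the source equation, so the derivative
   of the prolonged equation along it vanishes; only [prolong_x F r] contributes. *)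
Lemma total_derivative_Dx_snd j : O j -> holds E j ->
  total_derivative u j = r.-1%:R / 2 * (u j * total_derivative (@DtT K r F) j / DtT F j).
Proof.
move=> Oj Ej; have q0 := DtT_neq0 Oj.
have r_gt0 : (0 < r)%N by exact: ltn_trans r1.
have r1r : (r.-1 < r)%N by rewrite prednK.
pose v := dir_x K r r.-1.
have jv s k : (k <= r)%N -> jx (j + s *: v) k = jx j k + s * (k == r.-1)%:R.
  by move=> kr; rewrite -(jx_dir_x K (ltnW r1r) kr) /jx /= !mxE.
have v1 s : (j + s *: v).1 = j.1 by rewrite /= [s *: 0]mulr0 addr0.
have basev s : base (j + s *: v) = base j.
  rewrite /base v1 jv//; congr (_, _).
  have -> : (0%N == r.-1) = false by apply/eqP; lia.
  by rewrite mulr0 addr0.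
have Ov s : O (j + s *: v) by rewrite /jets_over /= basev.
have Ev s : holds E (j + s *: v).
  rewrite /holds v1 jv// gtn_eqF// mulr0 addr0.
  rewrite -[RHS]Ej; congr (_ + _); apply: eq_bigr => i _.
  by rewrite jv ?(ltnW (coef_index_ltn i))// (ltn_eqF (ltn_ord i)) mulr0 addr0.
pose G (i : jet K r) := prolong_x F r i + \sum_(k < r.-1) coef E' (F (base j)).1 ord0 k * prolong_x F k i.
have G0 s : G (j + s *: v) = 0.
  by have := prolong_holds (Ov s) (DtT_neq0 (Ov s)) (Ev s); rewrite basev.
have d0 : 'D_v G j = 0.
  apply: derive_affine_line => s; rewrite G0.
  by have := G0 0; rewrite scale0r addr0 => ->; rewrite scaler0 addr0.
have dG : is_derive j v G ('D_v (prolong_x F r) j +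
    \sum_(k < r.-1) coef E' (F (base j)).1 ord0 k * 'D_v (prolong_x F k) j).
  apply: is_deriveD; first exact (derive_is_derive v (smooth_prolong_x r) Oj).
  apply: is_derive_sum_seq => k.
  exact: is_deriveZ (derive_is_derive v (smooth_prolong_x k) Oj).
move: d0; have [_ ->] := dG.
rewrite big1 ?addr0; last first.
  move=> k _; rewrite derive_prolong_x_gt ?mulr0//.
  by rewrite ltn_ord ltnW.
have := derive_prolong_x_subdiag Oj r1r; rewrite -/v prednK// => ->.
move/eqP; rewrite mulf_eq0 invr_eq0 expf_eq0 (negPf q0) andbF orbF subr_eq0 => /eqP H.
have rn0 : r%:R != 0 :> K by rewrite pnatr_eq0 -lt0n.
apply: (mulfI rn0); rewrite H natrM.
by ring.
Qed.

Lemma total_derivative_DtT_base j : O j ->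
  total_derivative (@DtT K r F) j = Dt (Dt T) (base j).
Proof.
move=> Oj; have E0 := total_derivative_base r1 (smooth_derive ((1, 0) : K * K) smooth_fst_F) Oj.
rewrite (Dx_Dt_fst Oj) (mulr0 (jx j 1)) addr0 in E0.
rewrite -E0; exact (total_derivative_eq oO (fun i Oi => DtT_base Oi) Oj).
Qed.

(** Both equations sit in one identity that is affine in x_1, and x_1 is free on jets satisfying
    [E]: the values 0 and 1 separate them. *)
Lemma determining_equations p : Om p ->
  Dx (Dx X) p = 0 /\ Dt (Dx X) p = r.-1%:R / 2 * (Dx X p * Dt (Dt T) p / Dt T p).
Proof.
move=> Op; have su := smooth_derive ((0, 1) : K * K) smooth_snd_F.
have key x1 : Dt (Dx X) p + x1 * Dx (Dx X) p = r.-1%:R / 2 * (Dx X p * Dt (Dt T) p / Dt T p).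
  pose j := solution_jet p.1 (fun k => if k is 0 then p.2 else x1).
  have bj : base j = p by rewrite base_solution_jet /=; case: (p).
  have Oj : O j by rewrite /jets_over /= bj.
  have := total_derivative_Dx_snd Oj (holds_solution_jet _ _).
  have -> : total_derivative u j = Dt (Dx X) (base j) + jx j 1 * Dx (Dx X) (base j).
    exact (total_derivative_base r1 su Oj).
  rewrite total_derivative_DtT_base// DtT_base// /u bj jx_solution_jet//.
move: (Dt (Dx X) p) (Dx (Dx X) p) (_ * _) key => A B C key.
have k0 := key 0; rewrite mul0r addr0 in k0; split; last exact: k0.
have := key 1; rewrite -k0 mul1r => /eqP; rewrite -subr_eq0 addrAC subrr add0r.
by move/eqP.
Qed.

End Necessity.

(** * Local form of admissible transformations *)

Section LocalForm.
Variable K : numFieldType.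
Hypothesis archK : archimedean_field K.
Hypothesis compK : geometrically_complete K.

Local Notation nball z rho := [set t : K | `|t - z| < rho].

Lemma smooth_slice (Om : set (K * K)) (U : set K) (f : K * K -> K) (x : K) :
  open U -> (forall t, U t -> Om (t, x)) -> smooth_on Om f ->
  smooth_on U (fun t => f (t, x)) /\
  forall t, U t -> 'D_1 (fun t => f (t, x)) t = 'D_((1, 0) : K * K) f (t, x).
Proof.
move=> oU UOm sf; have [li ci] := inl_linear_continuous K K.
have sliceE t : (0, x) + linear_map li t = (t, x).
  by congr (_, _); rewrite /= ?add0r ?addr0.
split=> [|t Ut].
  apply/smooth_onP => n.
  have := @diff_times_affine K n _ _ _ U Om (linear_map li) (0, x) f oU ci.
  have -> : (fun p => f ((0, x) + linear_map li p)) = (fun t => f (t, x)).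
    by apply/funext => t; rewrite sliceE.
  by apply; [move=> t Ut; rewrite sliceE; exact: UOm|exact: smooth_diff_times].
have d1 := derive_is_derive ((1, 0) : K * K) sf (UOm t Ut).
have : is_derive t (1 : K) (fun t => f (t, x)) ('D_((1, 0) : K * K) f (t, x)).
  apply/is_derive_lineP; move/is_derive_lineP: d1; congr (is_derive _ _ _ _).
  apply/funext => h; congr (f _); congr (_, _).
  by rewrite /= [h *: 0]mulr0 addr0.
by case=> _ ->.
Qed.

Lemma is_derive_fiber (Om : set (K * K)) (f : K * K -> K) (t x : K) :
  smooth_on Om f -> Om (t, x) ->
  is_derive x (1 : K) (fun x => f (t, x)) ('D_((0, 1) : K * K) f (t, x)).
Proof.
move=> sf Otx; have d1 := derive_is_derive ((0, 1) : K * K) sf Otx.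
apply/is_derive_lineP; move/is_derive_lineP: d1; congr (is_derive _ _ _ _).
apply/funext => h; congr (f _); congr (_, _).
by rewrite /= [h *: 0]mulr0 addr0.
Qed.

Lemma prolong_coef_rational (U : set K) (T1 X1 : K -> K) r t : open U ->
  (forall s, U s -> T1 s != 0) -> smooth_on U T1 -> smooth_on U X1 -> (0 < r)%N -> U t ->
  'D_1 X1 t = r.-1%:R / 2 * (X1 t * 'D_1 T1 t / T1 t) -> prolong_coef T1 X1 r r.-1 t = 0.
Proof.
move=> oU T10 sT sX r0 Ut DX.
have := prolong_coef_subdiag oU T10 sT sX r.-1 Ut; rewrite prednK// => ->.
rewrite DX natrM; move: (X1 t * _ / _) => a.
by apply/eqP; rewrite mulf_eq0; apply/orP; left; apply/eqP; ring.
Qed.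

Variable r : nat.
Hypothesis hr : (3 <= r)%N.

Definition affine_form (E : equation K r) (F : K * K -> K * K) (p : K * K) (d : K)
    (T X1 X0 : K -> K) : Prop :=
  let U := nball p.1 d in
  [/\ smooth_on U T, smooth_on U X1, smooth_on U X0,
      forall t, U t -> [/\ dom E t, 'D_1 T t != 0, X1 t != 0 &
        'D_1 X1 t = r.-1%:R / 2 * (X1 t * 'D_1 ('D_1 T) t / 'D_1 T t)] &
      forall q, `|q.1 - p.1| < d -> `|q.2 - p.2| < d ->
        F q = (T q.1, X1 q.1 * q.2 + X0 q.1)].

(** On a product of balls inside [Om], T_x = 0 and X_xx = 0 are integrated along [x] with [t] fixed.
    [X0] is the value of X at [p.2] less the linear term there. *)
Lemma admissible_affine_form (E E' : equation K r) Om F p : admissible E E' Om F -> Om p ->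
  exists d T X1 X0, [/\ 0 < d, affine_form E F p d T X1 X0 &
    forall q, `|q.1 - p.1| < d -> `|q.2 - p.2| < d -> Om q].
Proof.
move=> adm Op; have oOm : open Om by case: adm => -[].
have /nbhs_ballP[d /= d0 Hd] := open_nbhs_nbhs (conj oOm Op).
have box q : `|q.1 - p.1| < d -> `|q.2 - p.2| < d -> Om q.
  move=> h1 h2; apply: Hd; split; rewrite -ball_normE /= distrC//.
have p2 : `|p.2 - p.2| < d by rewrite subrr normr0.
pose U := nball p.1 d; have oU : open U by exact: open_ball_norm.
have UOm t : U t -> Om (t, p.2) by move=> Ut; exact: box.
have sT := smooth_fst_F adm; have sX := smooth_snd_F adm.
have sXx := smooth_derive ((0, 1) : K * K) sX.
have sTt := smooth_derive ((1, 0) : K * K) sT.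
have [s1 D1] := smooth_slice oU UOm sT.
have [s2 D2] := smooth_slice oU UOm sX.
have [s3 D3] := smooth_slice oU UOm sXx.
have [s4 D4] := smooth_slice oU UOm sTt.
pose T t := (F (t, p.2)).1; pose X1 t := 'D_((0, 1) : K * K) (fun q => (F q).2) (t, p.2).
pose X0 t := (F (t, p.2)).2 + - p.2 * X1 t.
have DDT t : U t -> 'D_1 ('D_1 T) t =
    'D_((1, 0) : K * K) ('D_((1, 0) : K * K) (fun q => (F q).1)) (t, p.2).
  move=> Ut; rewrite -(D4 t Ut); apply: near_eq_derive.
  by apply: filterS (open_nbhs_nbhs (conj oU Ut)) => s Us; exact: D1.
exists d, T, X1, X0; split=> //; split=> //.
- apply/smooth_onP => n; apply: diff_timesD => //; first exact: smooth_diff_times.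
  by apply: diff_timesM => //; [exact: diff_times_cst|exact: smooth_diff_times].
- move=> t Ut; have Otp := UOm t Ut.
  have [_ eq2] := determining_equations archK compK hr adm Otp.
  split.
  + by case: adm => _ /(_ _ Otp)[].
  + rewrite D1//; exact (Dt_fst_neq0 hr adm Otp).
  + exact (Dx_snd_neq0 hr adm Otp).
  by rewrite (D3 t Ut) (DDT t Ut) (D1 t Ut).
move=> [t x] /= ht hx.
have fiber0 (f : K * K -> K) (x' : K) : smooth_on Om f ->
    (forall x, `|x - p.2| < d -> 'D_((0, 1) : K * K) f (t, x) = 0) ->
    `|x' - p.2| < d -> f (t, x') = f (t, p.2).
  move=> sf f0 hx'; apply: (@derive0_constant K archK compK (fun x => f (t, x)) p.2 d) => // y hy.
  by rewrite -(f0 y hy); apply: is_derive_fiber sf _; exact: box.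
have eT : (F (t, x)).1 = T t.
  apply: (fiber0 (fun q => (F q).1)) => // y hy.
  by rewrite (Dx_fst_eq0 hr adm)//; exact: box.
have eX1 y : `|y - p.2| < d -> 'D_((0, 1) : K * K) (fun q => (F q).2) (t, y) = X1 t.
  apply: (fiber0 ('D_((0, 1) : K * K) (fun q => (F q).2))) => // y' hy'.
  have Oty : Om (t, y') by exact: box.
  by have [] := determining_equations archK compK hr adm Oty.
have eX : (F (t, x)).2 - X1 t * x = (F (t, p.2)).2 - X1 t * p.2.
  apply: (@derive0_constant K archK compK (fun x => (F (t, x)).2 - X1 t * x) p.2 d) => // y hy.
  have := is_derive_fiber sX (box (t, y) ht hy); rewrite eX1// => d1.
  by apply: is_derive_eq; rewrite [X1 t *: 1]mulr1 subrr.
rewrite [LHS]surjective_pairing eT; congr (_, _).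
by rewrite /X0 mulNr [p.2 * _]mulrC -eX addrC subrK.
Qed.

End LocalForm.

(** * The inhomogeneous part as a solution of the source equation *)

Section LocalSolutions.
Variable K : numFieldType.
Hypothesis archK : archimedean_field K.
Hypothesis compK : geometrically_complete K.
Variable n : nat.
Local Notation r := n.+1.
Hypothesis hr : (3 <= r)%N.
Local Notation nball z rho := [set t : K | `|t - z| < rho].

Lemma smooth_congr (V W : normedModType K) (U : set V) (f g : V -> W) : open U ->
  (forall p, U p -> f p = g p) -> smooth_on U f -> smooth_on U g.
Proof.
move=> oU fg sf; apply/smooth_onP => m.
by apply: diff_times_congr fg _ => //; exact: smooth_diff_times.
Qed.

Lemma local_solution_congr (E : equation K r) z (f g : K -> K) :
  (\forall t \near z, f t = g t) -> local_solution E z f -> local_solution E z g.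
Proof.
move=> /near0_normP[d d0 fg] /local_solutionP[e e0 [sf Hf]].
have [c [c0 cd ce]] := pos_lower_bound d0 e0.
have oB : open (nball z c) by exact: open_ball_norm.
have sfc : smooth_on (nball z c) f.
  by apply: smooth_on_sub sf => t /= tc; exact: lt_le_trans ce.
have gf t : nball z c t -> g t = f t by move=> tc; rewrite fg//; exact: lt_le_trans cd.
have Dg k t : nball z c t -> derive1n k g t = derive1n k f t.
  apply: (derive1n_eq_on oB (y := fun k => derive1n k f)) => // m s _ sc.
  exact: is_derive_derive1n sfc sc.
apply/local_solutionP; exists c => //; split.
  by apply: smooth_congr oB _ sfc => t tc; rewrite gf.
move=> t tc; have [Et st] := Hf t (lt_le_trans tc ce); split=> //.
rewrite /solves Dg//; under eq_bigr do rewrite Dg//.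
exact: st.
Qed.

Lemma local_solutionZ (E : equation K r) z (a : K) (f : K -> K) : dom E z ->
  local_solution E z f -> local_solution E z (fun t => a * f t).
Proof.
move=> Ez sf; have [H _] := solution_lincomb (fun _ : unit => a) Ez (fun _ => sf).
apply: local_solution_congr H; near=> t.
by rewrite big_const card_unit /= addr0.
Unshelve. all: by end_near. Qed.

(** The jet of -X0 / X1, which is mapped to zero, may lie outside the box around [p]. At fixed [t]
    the prolonged target equation is therefore read as an affine condition on solution jets: holding
    for x near [p.2], it has zero linear part and zero constant term [ell (phi^~ t)]. *)
Lemma affine_form_solution (E E' : equation K r) Om F p d T X1 X0 :
  admissible E E' Om F -> 0 < d -> affine_form E F p d T X1 X0 ->
  (forall q, `|q.1 - p.1| < d -> `|q.2 - p.2| < d -> Om q) ->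
  local_solution E p.1 (fun t => X0 t / X1 t).
Proof.
move=> adm d0 [sT sX1 sX0 ode Fq] box.
set U := nball p.1 d in sT sX1 sX0 ode *.
have oU : open U by exact: open_ball_norm.
have X1n t : U t -> X1 t != 0 by case/ode.
have T1n t : U t -> 'D_1 T t != 0 by case/ode.
have sT1 := smooth_derive (1 : K) sT.
have sphi : smooth_on U (fun t => X0 t / X1 t).
  apply/smooth_onP => m; apply: diff_timesM => //; first exact: smooth_diff_times.
  by apply: diff_timesV => //; exact: smooth_diff_times.
pose phi k := derive1n k (fun t => X0 t / X1 t).
have dphi k t : U t -> is_derive t 1 (phi k) (phi k.+1 t).
  exact: is_derive_derive1n sphi.
have dT t : U t -> is_derive t 1 T ('D_1 T t) by exact: smooth_is_derive1.
pose Om' := [set q : K * K | `|q.1 - p.1| < d /\ `|q.2 - p.2| < d].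
have oOm' : open Om'.
  rewrite openE => q [h1 h2].
  have n1 := open_nbhs_nbhs (conj (@open_ball_norm K p.1 d) h1).
  have n2 := open_nbhs_nbhs (conj (@open_ball_norm K p.2 d) h2).
  by exists (nball p.1 d, nball p.2 d).
have Om'F q : Om' q -> U q.1 /\ F q = (T q.1, X1 q.1 * (q.2 + phi 0%N q.1)).
  move=> [h1 h2]; split=> //; rewrite Fq//; congr (_, _).
  by rewrite mulrDr /phi derive1n0; congr (_ + _); rewrite mulrC divfK// X1n.
apply/local_solutionP; exists d => //; split=> // t Ut; split; first by case: (ode t Ut).
have crr : prolong_coef ('D_1 T) X1 r r t != 0.
  by rewrite prolong_coef_diag mulf_neq0 ?X1n// invr_eq0 expf_neq0// T1n.
pose row k (z : nat -> K) := \sum_(m < r.+1) prolong_coef ('D_1 T) X1 k m t * z m.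
have rowD k z z' a : row k (fun m => z m + a * z' m) = row k z + a * row k z'.
  by rewrite /row mulr_sumr -big_split /=; apply: eq_bigr => m _; ring.
pose ell (z : nat -> K) := row r z + \sum_(i < n) coef E' (T t) ord0 i * row i z.
have ellD z z' a : ell (fun m => z m + a * z' m) = ell z + a * ell z'.
  rewrite /ell rowD; under eq_bigr do rewrite rowD mulrDr mulrCA.
  by rewrite big_split /= -mulr_sumr mulrDr addrACA.
pose zs (xs : nat -> K) k := if k == r then - \sum_(i < n) coef E t ord0 i * xs i else xs k.
have zsD xs ys a k : zs (fun m => xs m + a * ys m) k = zs xs k + a * zs ys k.
  rewrite /zs; case: ifP => // _; rewrite -!sumrN mulr_sumr -big_split /=.
  by apply: eq_bigr => i _; ring.
have key xs : `|xs 0%N - p.2| < d -> ell (zs xs) + ell (phi^~ t) = 0.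
  move=> hx; pose j := solution_jet E t xs.
  have bj : base j = (t, xs 0%N) by exact: base_solution_jet.
  have O'j : Om' (base j) by rewrite bj.
  have Oj : Om (base j) by rewrite bj; apply: box.
  have H := prolong_holds adm Oj (DtT_neq0 hr adm Oj) (holds_solution_jet E t xs).
  have px k : (k <= r)%N -> prolong_x F k j =
      \sum_(m < r.+1) prolong_coef ('D_1 T) X1 k m t * (zs xs m + phi m t).
    move=> kr; rewrite (prolong_x_affine oU dT T1n sT1 sX1 dphi oOm' Om'F kr O'j) /affine_jet.
    apply: eq_bigr => m _; congr (_ * (_ + _)).
    by rewrite jx_mkjet// -ltnS.
  rewrite px// in H.
  have F1 : (F (base j)).1 = T t by have [_ ->] := Om'F _ O'j; rewrite bj.
  rewrite F1 in H.
  have := ellD (zs xs) (phi^~ t) 1; rewrite mul1r => <-.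
  rewrite -[RHS]H /ell; congr (_ + _).
    by apply: eq_bigr => m _; rewrite mul1r.
  apply: eq_bigr => i _; rewrite px; last by apply: ltnW; exact: (@coef_index_ltn r i).
  by congr (_ * _); apply: eq_bigr => m _; rewrite mul1r.
pose xs0 (k : nat) := if k is 0 then p.2 else 0.
have k0 : ell (zs xs0) + ell (phi^~ t) = 0 by apply: key; rewrite subrr normr0.
(* The factor [e] keeps x_0 within [d] of [p.2]; subtracting the case [xs0] leaves e times the value
   sought. *)
have ell0 ys : ell (zs ys) = 0.
  have c0 : 0 < `|ys 0%N| + 1 by rewrite ltr_pwDr.
  pose e := d / (`|ys 0%N| + 1); have e0 : 0 < e by rewrite divr_gt0.
  have := key (fun m => xs0 m + e * ys m).
  have -> : ell (zs (fun m => xs0 m + e * ys m)) = ell (zs xs0) + e * ell (zs ys).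
    by rewrite -ellD; congr ell; apply/funext => m; exact: zsD.
  rewrite [ell (zs xs0) + _ + _]addrAC k0 add0r /= [p.2 + _]addrC addrK normrM (gtr0_norm e0).
  have -> : e * `|ys 0%N| < d by rewrite /e mulrAC ltr_pdivrMr// ltr_pM2l// ltrDl.
  by move=> /(_ isT)/eqP; rewrite mulf_eq0 gt_eqF// => /eqP.
have ellphi : ell (phi^~ t) = 0 by move: k0; rewrite ell0 add0r.
(* The jet of phi and the solution jet with the same lower coordinates differ only at order [r],
   which row [r] alone detects, with the nonzero factor [c r r]. *)
have split_top : ell (phi^~ t) = ell (zs (phi^~ t)) + prolong_coef ('D_1 T) X1 r r t * (phi r t - zs (phi^~ t) r).
  have low k m : (k < r)%N -> (m <= r)%N -> prolong_coef ('D_1 T) X1 k m t * phi m t =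
      prolong_coef ('D_1 T) X1 k m t * zs (phi^~ t) m.
    move=> kr mr; rewrite /zs; case: eqP => [->|//].
    by rewrite prolong_coef_gt// !mul0r.
  rewrite {1 2}/ell [in RHS]addrAC; congr (_ + _).
    rewrite /row big_ord_recr [in RHS]big_ord_recr /= -addrA -mulrDr subrKC; congr (_ + _).
    by apply: eq_bigr => m _; rewrite /zs ltn_eqF.
  apply: eq_bigr => i _; congr (_ * _); apply: eq_bigr => m _; apply: low.
    exact: (@coef_index_ltn r i).
  by rewrite -ltnS.
move: split_top; rewrite ellphi ell0 add0r => /esym/eqP.
rewrite mulf_eq0 (negPf crr) /= /zs eqxx opprK => /eqP.
by [].
Qed.

End LocalSolutions.

(** * Classification of admissible transformations *)

Section GenericClassification.
Variable K : numFieldType.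
Hypothesis archK : archimedean_field K.
Hypothesis compK : geometrically_complete K.
Variable n : nat.
Local Notation r := n.+1.
Hypothesis hr : (3 <= r)%N.
Local Notation nball z rho := [set t : K | `|t - z| < rho].

Lemma local_chart (T : K -> K) (z d : K) : 0 < d -> smooth_on (nball z d) T ->
  'D_1 T z != 0 ->
  exists (U V : set K) (S : K -> K),
    [/\ open U, open V, U z, forall t, U t -> `|t - z| < d &
        (forall t, U t -> V (T t) /\ S (T t) = t) /\
        (forall y, V y -> [/\ U (S y), T (S y) = y & is_derive y 1 S ('D_1 T (S y))^-1])].
Proof.
move=> d0 sT T10; have zz : nball z d z by rewrite /= subrr normr0.
apply: (local_inverse archK compK (T := T) (T1 := 'D_1 T) d0 _ _ T10).
  apply/near0_normP; exists d => // t td; exact: smooth_is_derive1 sT td.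
exact: is_derive_continuous (smooth_is_derive1 (smooth_derive (1 : K) sT) zz).
Qed.

Lemma near_prod_ball (p : K * K) (d : K) (A : set K) : 0 < d -> (\forall t \near p.1, A t) ->
  \forall q \near p, A q.1 /\ `|q.2 - p.2| < d.
Proof.
move=> d0 nA; exists (A, nball p.2 d) => //; split=> //=.
by apply/near0_normP; exists d.
Qed.

(** X1 x + X0 = X1 (x + X0 / X1): the superposition by X0 / X1 comes first, and the remaining
    fibre-linear map is the projection of [lifted]. *)
Lemma uniform_semi_normalization : uniformly_semi_normalized K r.
Proof.
split; last by move=> E t0 Et0; exact: superposition_group.
move=> E E' Om F adm p Op.
have [d [T [X1 [X0 [d0 af box]]]]] := admissible_affine_form archK compK hr adm Op.
have sol := affine_form_solution hr adm d0 af box.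
have [sT sX1 sX0 ode Fq] := af.
have pd : nball p.1 d p.1 by rewrite /= subrr normr0.
have [_ T10 _ _] := ode _ pd.
have [U [V [S [oU oV Up Ud [UV VU]]]]] := local_chart d0 sT T10.
have T1n t : U t -> 'D_1 T t != 0 by move=> /Ud/ode[].
have X1n t : U t -> X1 t != 0 by move=> /Ud/ode[].
have sT1 : smooth_on U ('D_1 T) := smooth_on_sub Ud (smooth_derive (1 : K) sT).
have sX1U := smooth_on_sub Ud sX1.
exists (fun t => X0 t / X1 t), (fiber_dom U), (fiber_linear T X1), (lifted T ('D_1 T) X1 (r := r)).
split=> //.
  apply: (equivalence_lifted oU oV _ T1n X1n sT1 sX1U UV VU (ltn0Sn n)) => t Ut.
    exact: smooth_is_derive1 sT (Ud t Ut).
  have [_ _ _ e] := ode t (Ud t Ut).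
  exact (prolong_coef_rational oU T1n sT1 sX1U (ltn0Sn n) Ut e).
have := near_prod_ball d0 (open_nbhs_nbhs (conj oU Up)).
apply: filterS => q [Uq q2]; split=> //.
rewrite Fq//; last exact: Ud.
by rewrite /fiber_linear /superposition /= mulrDr [X1 _ * (_ / _)]mulrC divfK ?X1n.
Qed.

(* [half] stands for the real or complex reading of [s ^ ((r - 1) / 2)]; only
   its logarithmic derivative matters, by uniqueness for a linear ODE. *)
Variable half : K -> (K -> K) -> Prop.
Hypothesis half_exists : forall tau, tau != 0 -> exists h, half tau h.
Hypothesis half_ode : forall tau h, tau != 0 -> half tau h ->
  \forall s \near tau, h s != 0 /\ is_derive (s : K) (1 : K) h (r.-1%:R / 2 * h s / s).

Lemma half_power_chain (T h : K -> K) z d : 0 < d -> smooth_on (nball z d) T ->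
  'D_1 T z != 0 -> half ('D_1 T z) h ->
  exists e, [/\ 0 < e, e <= d & forall t, `|t - z| < e -> [/\ 'D_1 T t != 0,
     h ('D_1 T t) != 0 & is_derive t 1 (fun t => h ('D_1 T t))
       (r.-1%:R / 2 * (h ('D_1 T t) * 'D_1 ('D_1 T) t / 'D_1 T t))]].
Proof.
move=> d0 sT T10 Hh; have sT1 := smooth_derive (1 : K) sT.
have zz : nball z d z by rewrite /= subrr normr0.
have cT : {for z, continuous ('D_1 T)}.
  exact: is_derive_continuous (smooth_is_derive1 sT1 zz).
have : \forall t \near z, 'D_1 T t != 0 /\ (h ('D_1 T t) != 0 /\
    is_derive ('D_1 T t : K) (1 : K) h (r.-1%:R / 2 * h ('D_1 T t) / 'D_1 T t)).
  exact: (cT _ (filterI (near_neq0 T10) (half_ode T10 Hh))).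
move=> /near0_normP[e e0 He].
have [c [c0 cd ce]] := pos_lower_bound d0 e0.
exists c; split=> // t tc; have [t0 [ht dh]] := He t (lt_le_trans tc ce).
have td : nball z d t by exact: lt_le_trans cd.
split=> //; have d2 := smooth_is_derive1 sT1 td.
have := is_derive1_chain (f := 'D_1 T) (x := t) dh d2; congr (is_derive _ _ _ _).
by field.
Qed.

Lemma normal_form_necessary (E : equation K r) p F : 
  transformational_part E p F -> of_normal_form half E p F.
Proof.
move=> [Om [E' [Op adm]]].
have [d [T [X1 [X0 [d0 af box]]]]] := admissible_affine_form archK compK hr adm Op.
have sol := affine_form_solution hr adm d0 af box.
have [sT sX1 sX0 ode Fq] := af.
have pd : nball p.1 d p.1 by rewrite /= subrr normr0.
have [Ep T10 X10 _] := ode _ pd.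
have [h Hh] := half_exists T10.
have [e [e0 ed He]] := half_power_chain d0 sT T10 Hh.
have pe : `|p.1 - p.1| < e by rewrite subrr normr0.
have [_ h0 _] := He _ pe.
(* [X1] and [h ('D_1 T)] satisfy the same homogeneous linear equation of first order, so their
   quotient keeps its value at [p.1]. *)
pose C := X1 p.1 / h ('D_1 T p.1).
have C0 : C != 0 by rewrite mulf_neq0// invr_eq0.
have X1E t : `|t - p.1| < e -> X1 t = C * h ('D_1 T t).
  move=> te; have [T1t ht _] := He t te.
  have : X1 t / h ('D_1 T t) = C.
    apply: (@derive0_constant K archK compK (fun t => X1 t / h ('D_1 T t)) p.1 e) => // s se.
    have [T1s hs dh] := He s se; have sd := lt_le_trans se ed.
    have [_ _ X1s es] := ode s sd.
    have dX : is_derive s 1 X1 ('D_1 X1 s) by exact: smooth_is_derive1 sX1 sd.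
    have := is_derive_div dX dh hs; congr (is_derive _ _ _ _).
    by rewrite es; field; rewrite hs T1s.
  by move=> <-; rewrite divfK.
exists T, X0, C, h; rewrite derive1_D1; split; [split=> //|split].
- by apply/smooth_nearP; exists d.
- by apply/smooth_nearP; exists d.
- by apply/near0_normP; exists e => // t /He[].
- apply: local_solution_congr (local_solutionZ C Ep sol).
  apply/near0_normP; exists e => // t te; have [_ ht _] := He t te.
  by rewrite X1E//; field; rewrite ht C0.
have ne : \forall t \near p.1, `|t - p.1| < e by apply/near0_normP; exists e.
apply: filterS (near_prod_ball (p := p) d0 ne) => q [q1 q2].
rewrite Fq//; last exact: lt_le_trans ed.
by rewrite X1E.
Qed.

Lemma normal_form_sufficient (E : equation K r) p F : dom E p.1 ->
  of_normal_form half E p F -> transformational_part E p F.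
Proof.
move=> Ep [T [X0 [C [h]]]]; rewrite derive1_D1.
move=> [[/smooth_nearP[d1 d10 sT] _ nT C0 Hh] [sol nF]].
have T10 : 'D_1 T p.1 != 0 by exact: nbhs_singleton nT.
have [e [e0 ed1 He]] := half_power_chain d10 sT T10 Hh.
have solC := local_solutionZ C^-1 Ep sol.
have /local_solutionP[c c0 [sphi Hphi]] := solC.
have [d [d0 de dc]] := pos_lower_bound e0 c0.
have sTd : smooth_on (nball p.1 d) T.
  by apply: smooth_on_sub sT => t /= td; apply: lt_le_trans td (le_trans de ed1).
have [U [V [S [oU oV Up Ud [UV VU]]]]] := local_chart d0 sTd T10.
have Ue t : U t -> `|t - p.1| < e by move=> /Ud td; exact: lt_le_trans de.
have Uc t : U t -> `|t - p.1| < c by move=> /Ud td; exact: lt_le_trans dc.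
have sTU : smooth_on U T := smooth_on_sub Ud sTd.
have sT1 := smooth_derive (1 : K) sTU.
have T1n t : U t -> 'D_1 T t != 0 by move=> /Ue/He[].
pose X1 t := C * h ('D_1 T t).
have X1n t : U t -> X1 t != 0 by move=> /Ue/He[_ ht _]; exact: mulf_neq0.
have dX1 t : U t -> is_derive t 1 X1 (r.-1%:R / 2 * (X1 t * 'D_1 ('D_1 T) t / 'D_1 T t)).
  move=> Ut; have [_ _ dh] := He t (Ue t Ut).
  have := is_deriveZ C dh; congr (is_derive _ _ _ _).
  by rewrite /X1 /GRing.scale/=; ring.
(* [h] is known only through its first-order equation; smoothness of the composite is bootstrapped
   from the equation for [X1]. *)
have sX1 : smooth_on U X1.
  apply: (@smooth_bootstrap K unit U (fun=> X1) (fun _ t =>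
    r.-1%:R / 2 * (X1 t * 'D_1 ('D_1 T) t / 'D_1 T t)) oU _ _ tt) => // m /(_ tt) DX _.
  apply: diff_timesM => //; first exact: diff_times_cst.
  apply: diff_timesM => //; last by apply: diff_timesV => //; exact: smooth_diff_times.
  by apply: diff_timesM => //; exact: smooth_diff_times (smooth_derive _ sT1).
pose phi k := derive1n k (fun t => C^-1 * ((h ('D_1 T t))^-1 * X0 t)).
have dphi k t : U t -> is_derive t 1 (phi k) (phi k.+1 t).
  by move=> /Uc tc; exact: is_derive_derive1n sphi tc.
have rat t : U t -> prolong_coef ('D_1 T) X1 r r.-1 t = 0.
  move=> Ut; have [_ DX] := dX1 t Ut.
  exact (prolong_coef_rational oU T1n sT1 sX1 (ltn0Sn n) Ut DX).
(* The formula for [F] is given only near [p]; intersecting with the interior of the set where it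
   holds yields an open domain. *)
pose NF := [set q : K * K | F q = (T q.1, C * h ('D_1 T q.1) * q.2 + X0 q.1)].
pose Om := fiber_dom U `&` interior NF.
have oOm : open Om by apply: openI; [exact: open_fiber_dom|exact: open_interior].
have OmF q : Om q -> U q.1 /\ F q = (T q.1, X1 q.1 * (q.2 + phi 0%N q.1)).
  move=> [Uq /interior_subset Fq]; split=> //; rewrite Fq; congr (_, _).
  rewrite mulrDr /phi derive1n0 /X1; congr (_ + _).
  have [_ hq _] := He _ (Ue _ Uq).
  by field; rewrite hq C0.
exists Om, (target_equation oU oV T1n X1n sT1 sX1 VU E); split; first by split.
apply: (affine_admissible oU oV _ T1n X1n sT1 sX1 UV VU (ltn0Sn n) rat dphi oOm OmF).
- by move=> t Ut; exact: smooth_is_derive1 sTU Ut.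
- by move=> q [/Uc/Hphi[]].
- by move=> t /Uc/Hphi[].
Qed.

Lemma normal_form_classification (E : equation K r) p F : dom E p.1 ->
  transformational_part E p F <-> of_normal_form half E p F.
Proof.
by move=> Ep; split; [exact: normal_form_necessary|exact: normal_form_sufficient].
Qed.

End GenericClassification.

(** * The real and complex fields *)

Section GeometricTails.
Variable K : numFieldType.

Lemma geometric_tail (B : K) (u : nat -> K) n k :
  (forall n, `|u n.+1 - u n| <= B / 2 ^+ n) ->
  `|u (n + k)%N - u n| <= 2 * B / 2 ^+ n - 2 * B / 2 ^+ (n + k).
Proof.
move=> Hu; elim: k => [|k IH]; first by rewrite addn0 !subrr normr0.
rewrite addnS; have -> : u (n + k).+1 - u n = (u (n + k).+1 - u (n + k)%N) + (u (n + k)%N - u n).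
  by ring.
apply: le_trans (ler_normD _ _) _; apply: le_trans (lerD (Hu _) IH) _.
rewrite le_eqVlt; apply/orP; left; apply/eqP; rewrite exprS.
by field; rewrite !expf_neq0.
Qed.

End GeometricTails.

Section Completeness.
Variable R : realType.

Lemma realType_archimedean : archimedean_field R.
Proof. by move=> x; exists (Num.bound `|x|); apply: ltW; exact: archi_boundP. Qed.

(** Nested intervals: every u n - 2 B / 2^n lies below every u m + 2 B / 2^m, and the limit is the
    supremum of the left ends. *)
Lemma realType_complete : geometrically_complete R.
Proof.
move=> B u Hu; have B0 : 0 <= B.
  by have := Hu 0%N; rewrite expr0 divr1; apply: le_trans.
have B2 m : 0 <= 2 * B / 2 ^+ m :> R by rewrite divr_ge0 ?exprn_ge0 ?mulr_ge0.
have cross n m : u n - 2 * B / 2 ^+ n <= u m + 2 * B / 2 ^+ m.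
  have [nm|/ltnW mn] := leqP n m.
    have := @geometric_tail R B u n (m - n) Hu; rewrite subnKC// ler_norml => /andP[H _].
    have := B2 m; lra.
  have := @geometric_tail R B u m (n - m) Hu; rewrite subnKC// ler_norml => /andP[_ H].
  have := B2 n; lra.
pose A := [set u n - 2 * B / 2 ^+ n | n in [set: nat]].
exists (sup A) => n; rewrite ler_norml; apply/andP; split.
  have : sup A <= u n + 2 * B / 2 ^+ n.
    apply: ge_sup; first by exists (u 0%N - 2 * B / 2 ^+ 0); exists 0%N.
    by move=> _ [m _ <-]; exact: cross.
  lra.
have : u n - 2 * B / 2 ^+ n <= sup A.
  apply: ub_le_sup; last by exists n.
  by exists (u 0%N + 2 * B / 2 ^+ 0) => _ [m _ <-]; exact: cross.
lra.
Qed.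

Lemma complex_archimedean : archimedean_field R[i].
Proof.
move=> x; have [m Hm] := realType_archimedean (complex.Re `|x|).
exists m; have nr : (complex.Re `|x|)%:C%C = `|x| by rewrite RRe_real// normr_real.
rewrite -nr -(rmorph_nat (real_complex R)) lecR.
by apply: le_trans Hm; exact: ler_norm.
Qed.

Lemma normc_le_ReIm (z : R[i]) : `|z| <= (`|complex.Re z| + `|complex.Im z|)%:C%C.
Proof.
have {1}-> : z = (complex.Re z)%:C%C + 'i%C * (complex.Im z)%:C%C by exact: complexE.
apply: le_trans (ler_normD _ _) _; rewrite normrM.
have ni : `|'i%C : R[i]| = 1 by rewrite normc_def /= expr0n/= add0r expr1n sqrtr1.
have nC (a : R) : `|a%:C%C| = `|a|%:C%C by rewrite normc_def /= expr0n/= addr0 sqrtr_sqr.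
by rewrite ni mul1r !nC rmorphD.
Qed.

Lemma normc_ge_Im (z : R[i]) : `|complex.Im z|%:C%C <= `|z|.
Proof.
rewrite normc_def lecR -sqrtr_sqr ler_sqrt ?addr_ge0 ?sqr_ge0//.
by rewrite lerDr sqr_ge0.
Qed.

Lemma complex_complete : geometrically_complete R[i].
Proof.
move=> B u Hu; have B0 : 0 <= B.
  by have := Hu 0%N; rewrite expr0 divr1; apply: le_trans.
have BE : B = (complex.Re B)%:C%C by rewrite RRe_real// ger0_real.
have boundE m : B / 2 ^+ m = (complex.Re B / 2 ^+ m)%:C%C.
  by rewrite {1}BE rmorphM fmorphV rmorphXn rmorph_nat.
have [|a Ha] := realType_complete (B := complex.Re B) (u := fun n => complex.Re (u n)).
  move=> m; rewrite -lecR -boundE; apply: le_trans (Hu m).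
  have -> : complex.Re (u m.+1) - complex.Re (u m) = complex.Re (u m.+1 - u m).
    by case: (u m.+1) => ? ?; case: (u m).
  exact: normc_ge_Re.
have [|b Hb] := realType_complete (B := complex.Re B) (u := fun n => complex.Im (u n)).
  move=> m; rewrite -lecR -boundE; apply: le_trans (Hu m).
  have -> : complex.Im (u m.+1) - complex.Im (u m) = complex.Im (u m.+1 - u m).
    by case: (u m.+1) => ? ?; case: (u m).
  exact: normc_ge_Im.
exists (a +i* b)%C => m.
(* Passing through real and imaginary parts costs a factor 2. The constant 2 is recovered by
   comparing [u m] with [u (m + k)], whose distance [geometric_tail] bounds, for large [k]. *)
have near_lim k : `|u k - (a +i* b)%C| <= 4 * B / 2 ^+ k.
  apply: le_trans (normc_le_ReIm _) _.
  have -> : 4 * B / 2 ^+ k = (2 * complex.Re B / 2 ^+ k + 2 * complex.Re B / 2 ^+ k)%:C%C.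
    have -> : 2 * complex.Re B / 2 ^+ k + 2 * complex.Re B / 2 ^+ k = 4 * (complex.Re B / 2 ^+ k) by ring.
    have -> : (4 * (complex.Re B / 2 ^+ k))%:C%C = 4 * (complex.Re B / 2 ^+ k)%:C%C :> R[i].
      by rewrite rmorphM /= rmorph_nat.
    by rewrite -boundE mulrA.
  rewrite lecR; apply: lerD; last first.
    by have := Hb k; case: (u k).
  by have := Ha k; case: (u k).
apply: (@le_geometric R[i] complex_archimedean _ _ (4 * B)).
- exact: normr_real.
- by rewrite ger0_real// divr_ge0 ?exprn_ge0 ?mulr_ge0.
- by rewrite mulr_ge0.
move=> k; exists (m + k)%N; first exact: leq_addl.
have -> : u m - (a +i* b)%C = (u (m + k)%N - (a +i* b)%C) - (u (m + k)%N - u m) by ring.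
apply: le_trans (ler_normB _ _) _.
apply: le_trans (lerD (near_lim _) (geometric_tail m k Hu)) _.
rewrite addrC lerD2r lerBlDr lerDl.
by rewrite divr_ge0 ?exprn_ge0 ?mulr_ge0.
Qed.

End Completeness.

(** * Half powers and their differential equation *)

Section HalfPowers.
Variable K : numFieldType.

Lemma is_derive_exp (k : nat) (s : K) :
  is_derive s 1 (fun s : K => s ^+ k) (k%:R * s ^+ k.-1).
Proof.
case: k => [|k].
  rewrite mul0r; have -> : (fun s : K => s ^+ 0) = cst 1 by apply/funext => t; rewrite expr0.
  exact: is_derive_cst.
have H := @is_deriveX K K (id : K -> K) k.+1 s 1 1 (is_derive_id s 1).
have E : (id : K -> K) ^+ k.+1 = (fun s : K => s ^+ k.+1) by apply/funext => t; rewrite fctE.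
rewrite E /GRing.scale/= mulr1 in H.
exact: H.
Qed.

Lemma odd_half_power_ode (r : nat) (tau : K) : odd r -> tau != 0 ->
  \forall s \near tau, s ^+ r.-1./2 != 0 /\
    is_derive (s : K) (1 : K) (fun s : K => s ^+ r.-1./2) (r.-1%:R / 2 * s ^+ r.-1./2 / s).
Proof.
move=> oddr tau0; apply: filterS (near_neq0 tau0) => s s0; split; first exact: expf_neq0.
have := is_derive_exp r.-1./2 s; congr (is_derive _ _ _ _).
have -> : r.-1%:R / 2 = (r.-1./2)%:R :> K.
  have {1}-> : r.-1 = (r.-1./2 * 2)%N.
    by rewrite muln2 halfK; case: (r) oddr => //= m /negPf ->; rewrite subn0.
  by rewrite natrM mulfK.
case: (r.-1./2) => [|k]; first by rewrite !mul0r.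
by rewrite exprS; field.
Qed.

(** Factor w - z = (rho w - rho z)(rho w + rho z): continuity of the branch keeps the second factor
    at least |rho z| in norm, and this already gives the derivative. *)
Lemma sqrt_branch_derive (tau : K) (rho : K -> K) : tau != 0 -> sqrt_branch tau rho ->
  \forall s \near tau, rho s != 0 /\ is_derive (s : K) (1 : K) rho (2 * rho s)^-1.
Proof.
move=> tau0 /near0_normP[d d0 Hd]; have /near0_normP[e e0 He] := near_neq0 tau0.
have [c [c0 cd ce]] := pos_lower_bound d0 e0.
apply/near0_normP; exists c => // z zc.
have [cr rz] := Hd z (lt_le_trans zc cd); have z0 := He z (lt_le_trans zc ce).
have rz0 : rho z != 0 by apply: contraNneq z0 => E; rewrite -rz E expr0n.
split=> //; apply/is_derive1P => eps eps0.
have rp : 0 < `|rho z| by rewrite normr_gt0.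
have ep : 0 < eps * 2 * `|rho z| ^+ 2 by rewrite !mulr_gt0// exprn_gt0.
have [dl [dl0 dl1 dl2]] := pos_lower_bound rp ep.
have dl20 : 0 < dl / 2 by rewrite divr_gt0.
have H1 : \forall w \near z, `|rho z - rho w| <= dl / 2.
  by have /cvgrPdist_le/(_ _ dl20) := cr.
have H2 : \forall w \near z, rho w ^+ 2 = w.
  apply/near0_normP; exists (d - `|z - tau|); first by rewrite subr_gt0 (lt_le_trans zc cd).
  move=> w wz; have [] // := Hd w.
  have -> : w - tau = (w - z) + (z - tau) by ring.
  by apply: le_lt_trans (ler_normD _ _) _; rewrite -ltrBrDr.
near=> w; have h1 : `|rho z - rho w| <= dl / 2 by near: w.
have h2 : rho w ^+ 2 = w by near: w.
have sum_ge : `|rho z| <= `|rho w + rho z|.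
  have -> : rho w + rho z = 2 * rho z - (rho z - rho w) by ring.
  apply: le_trans (lerB_dist _ _); rewrite normrM ger0_norm//.
  rewrite mulr_natl mulr2n -addrA lerDl subr_ge0.
  apply: le_trans h1 _; apply: le_trans dl1; rewrite ler_pdivrMr//.
  by rewrite ler_pMr// ler1n.
have s0 : rho w + rho z != 0 by rewrite -normr_gt0; exact: lt_le_trans sum_ge.
have -> : rho w - rho z - (2 * rho z)^-1 * (w - z) =
   (w - z) * ((rho z - rho w) / ((rho w + rho z) * (2 * rho z))).
  have wz : w - z = (rho w - rho z) * (rho w + rho z) by rewrite -{1}h2 -{1}rz; ring.
  by rewrite wz; field; rewrite s0 rz0.
rewrite normrM mulrC ler_wpM2r// normrM normfV normrM.
rewrite ler_pdivrMr ?mulr_gt0 ?normr_gt0//; last by rewrite mulf_neq0.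
apply: le_trans h1 _; apply: le_trans (_ : dl <= _).
  by rewrite ler_pdivrMr// ler_pMr ?ler1n.
apply: le_trans dl2 _.
have -> : eps * 2 * `|rho z| ^+ 2 = eps * (`|rho z| * `|2 * rho z|).
  by rewrite normrM [`|2|]ger0_norm//; ring.
by rewrite ler_wpM2l ?(ltW eps0)// ler_wpM2r.
Unshelve. all: by end_near. Qed.

End HalfPowers.

Section RealHalfPower.
Variable R : realType.

(** For even [r] the absolute value is harmless: |s|^a has logarithmic derivative a / s for either
    sign of [s]. *)
Lemma real_half_power_ode (r : nat) (tau : R) (h : R -> R) : tau != 0 ->
  real_half_power r tau h ->
  \forall s \near tau, h s != 0 /\ is_derive (s : R) (1 : R) h (r.-1%:R / 2 * h s / s).
Proof.
move=> tau0 ->; have [oddr|_] := boolP (odd r); first exact: odd_half_power_ode.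
apply: filterS (near_neq0 tau0) => s s0; set k := r.-1%:R / 2.
have ns : 0 < `|s| by rewrite normr_gt0.
split; first by rewrite gt_eqF// powR_gt0.
have dp := is_derive1_powR k ns.
have kE : `|s| `^ (k - 1) = `|s| `^ k / `|s|.
  rewrite powRB; last by rewrite (gt_eqF ns) implybT.
  by rewrite powRr1// ltW.
have dn : is_derive s 1 (fun s : R => `|s|) (Num.sg s).
  have [sp|sn|E] := ltgtP 0 s; last by rewrite -E eqxx in s0.
    rewrite gtr0_sg//; apply: (@near_eq_is_derive _ _ _ id) => //.
    apply/near0_normP; exists s => // t; rewrite ltr_norml ltrBrDl => /andP[+ _].
    by rewrite subrr => /ltW t0; rewrite ger0_norm.
  rewrite ltr0_sg//; apply: (@near_eq_is_derive _ _ _ -%R) => //.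
  apply/near0_normP; exists (- s); first by rewrite oppr_gt0.
  move=> t; rewrite ltr_norml ltrBlDr => /andP[_]; rewrite addNr => /ltW t0.
  by rewrite ler0_norm.
have := is_derive1_chain dp dn; congr (is_derive _ _ _ _).
have sgE : Num.sg s / `|s| = s^-1.
  by rewrite normrEsg invfM mulrA divff ?mul1r// sgr_eq0.
by rewrite kE -sgE; ring.
Qed.

End RealHalfPower.

Section SquareRootBranches.
Variable K : numFieldType.

Lemma sqrt_branch_power_ode (r : nat) (tau : K) (rho : K -> K) : tau != 0 ->
  sqrt_branch tau rho ->
  \forall s \near tau, rho s ^+ r.-1 != 0 /\
    is_derive (s : K) (1 : K) (fun s => rho s ^+ r.-1) (r.-1%:R / 2 * rho s ^+ r.-1 / s).
Proof.
move=> tau0 Hrho; have sq : \forall s \near tau, rho s ^+ 2 = s.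
  by apply: filterS Hrho => s [].
near=> s; have [rs0 drho] : rho s != 0 /\ is_derive (s : K) (1 : K) rho (2 * rho s)^-1.
  by near: s; exact: sqrt_branch_derive.
have rs : rho s ^+ 2 = s by near: s.
split; first exact: expf_neq0.
have := is_derive1_chain (is_derive_exp r.-1 (rho s)) drho; congr (is_derive _ _ _ _).
move: (rho s) rs rs0 => z <- z0; case: (r.-1) => [|k]; first by rewrite !mul0r mulr0.
by rewrite exprS /=; field.
Unshelve. all: by end_near. Qed.

(** The branch is the local inverse of squaring at [sigma], where the derivative 2 sigma is
    nonzero. *)
Lemma sqrt_branch_exists (sigma : K) : archimedean_field K -> geometrically_complete K ->
  sigma != 0 -> exists rho, sqrt_branch (sigma ^+ 2) rho.
Proof.
move=> archK compK s0.
have dsq (t : K) : is_derive t 1 (fun s : K => s ^+ 2) (2 * t).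
  by have := is_derive_exp 2 t; rewrite expr1.
have T10 : 2 * sigma != 0 by rewrite mulf_neq0.
have cT : {for sigma, continuous (fun s : K => 2 * s)}.
  apply: (@is_derive_continuous _ _ _ 2).
  have := is_deriveZ (2 : K) (is_derive_id sigma (1 : K)).
  by rewrite /GRing.scale/= mulr1.
have nT : \forall t \near sigma, is_derive (t : K) (1 : K) (fun s => s ^+ 2) (2 * t).
  by apply/near0_normP; exists 1.
have [U [V [S [oU oV Up _ [UV VU]]]]] := local_inverse archK compK ltr01 nT cT T10.
exists S; have [Vs _] := UV _ Up.
apply: filterS (open_nbhs_nbhs (conj oV Vs)) => z Vz.
have [_ Sz dS] := VU z Vz; split=> //; exact: is_derive_continuous dS.
Qed.

End SquareRootBranches.

Lemma complex_sqrt_exists (R : realType) (tau : R[i]) : tau != 0 ->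
  exists2 sigma, sigma != 0 & tau = sigma ^+ 2.
Proof. by move=> tau0; exists (sqrtC tau); rewrite ?sqrtC_eq0 ?sqrtCK. Qed.

Theorem corollary11 (R : realType) (r : nat) (hr : (3 <= r)%N) :
  ((forall (E : equation R r) (p : R * R) (F : R * R -> R * R), dom E p.1 ->
      (transformational_part E p F <->
       of_normal_form (@real_half_power R r) E p F)) /\
   uniformly_semi_normalized R r) /\
  ((forall (E : equation R[i] r) (p : R[i] * R[i])
           (F : R[i] * R[i] -> R[i] * R[i]), dom E p.1 ->
      (transformational_part E p F <->
       of_normal_form (@complex_half_power R r) E p F)) /\
   uniformly_semi_normalized R[i] r).
Proof.
case: r hr => [//|n] hr; split; split.
- move=> E p F Ep.
  refine (normal_form_classification (@realType_archimedean R) (@realType_complete R) hr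
    (half := @real_half_power R n.+1) _ _ F Ep).
  + by move=> tau _; eexists; reflexivity.
  + by move=> tau h; exact: real_half_power_ode.
- exact (uniform_semi_normalization (@realType_archimedean R) (@realType_complete R) hr).
- move=> E p F Ep.
  refine (normal_form_classification (@complex_archimedean R) (@complex_complete R) hr
    (half := @complex_half_power R n.+1) _ _ F Ep).
  + move=> tau tau0; rewrite /complex_half_power.
    have [_|_] := boolP (odd n.+1); first by eexists; reflexivity.
    have [sigma s0 ->] := complex_sqrt_exists tau0.
    have [rho Hrho] := sqrt_branch_exists (@complex_archimedean R) (@complex_complete R) s0.
    by exists (fun s => rho s ^+ n.+1.-1), rho.
  + move=> tau h tau0; rewrite /complex_half_power.
    have [oddr ->|_ [rho Hrho ->]] := boolP (odd n.+1); first exact: odd_half_power_ode.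
    exact: sqrt_branch_power_ode.
- exact (uniform_semi_normalization (@complex_archimedean R) (@complex_complete R) hr).
Qed.
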